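(* Assume that $r<p$ if $k=0$, or that $r<kp/(p-k)$ if $0<k<p$. Assume that $F''$ is strictly convex, and let $u_\infty$ be the (unique) minimizer of ${\cal P}_\infty$. Let $(u_\ell)_{\ell>0}$ be a family of minimizers, $u_\ell$ being a minimizer of ${\cal P}_\ell$. If $\ell_n\to+\infty$ and $u^*\in W^{1,p}_{\rm loc}(\Omega_\infty)$, with $u^*=0$ on $\partial\Omega_\infty$, are such that $u_{\ell_n|\Omega_{\ell_0}}\rightharpoonup u^*_{|\Omega_{\ell_0}}$ weakly in $W^{1,p}(\Omega_{\ell_0})$ for all $\ell_0>0$, then $u^*=u_\infty$. Moreover, $u_\ell\to u_\infty$ strongly in $W^{1,p}(\Omega_{\ell_0})$ as $\ell\to+\infty$, for all $\ell_0>0$.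
   Context: Let $1\le r<n$ be integers, $p>1$, $\frac1p+\frac1{p'}=1$, $0\le k<p$ real. Let $\omega'\subset\mathbb{R}^r$ be a bounded open set, $0\in\omega'$, starshaped with respect to $0$, whose gauge function $g(x')=\inf\{t>0;\ x'/t\in\omega'\}$ is Lipschitz on $\mathbb{R}^r$. Let $\omega''\subset\mathbb{R}^{n-r}$ be a bounded open set. For $\ell>0$ let $\omega'_\ell=\ell\omega'$, $\Omega_\ell=\omega'_\ell\times\omega''$, and $\Omega_\infty=\mathbb{R}^r\times\omega''$. Write $x=(x',x'')$, $\xi=(\xi',\xi'')\in\mathbb{R}^r\times\mathbb{R}^{n-r}$, $\nabla'=(\partial_1,\dots,\partial_r)$, $\nabla''=(\partial_{r+1},\dots,\partial_n)$. $|\cdot|$ is the Euclidean norm. A function of $x''$ only is also regarded as a function of $x$ independent of $x'$. Boundary values are understood in the sense of traces. Let $F:\mathbb{R}^n\to\mathbb{R}$ be convex, $F''(\xi'')=F(0,\xi'')$, $G(\xi)=F(\xi)-F''(\xi'')$. Assume there are constants $0<\lambda\le\Lambda$ such that for all $\xi\in\mathbb{R}^n$, $$\lambda|\xi|^p\le F(\xi)\le\Lambda(|\xi|^p+1),\qquad \lambda(|\xi'|^p+k|\xi''|^{p-k}|\xi'|^k)\le G(\xi)\le\Lambda(|\xi'|^p+k|\xi''|^{p-k}|\xi'|^k)$$ (terms with factor $k$ are absent if $k=0$). If $k>0$, assume moreover that $F''$ is uniformly strictly convex: there is $\beta>0$ such that for all $\xi'',\zeta''\in\mathbb{R}^{n-r}$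 and all $\theta,\mu\in[0,1]$ with $\theta+\mu=1$, $$F''(\theta\xi''+\mu\zeta'')\le\theta F''(\xi'')+\mu F''(\zeta'')-k\beta\theta\mu(\theta^{p-1}+\mu^{p-1})|\xi''-\zeta''|^p.$$ Let $f''\in L^{p'}(\omega'')$. Problem ${\cal P}_\ell$: minimize over $W^{1,p}_0(\Omega_\ell)$ the functional $J_\ell(v)=\int_{\Omega_\ell}[F(\nabla v(x))-f''(x'')v(x)]\,dx$. Problem ${\cal P}_\infty$: minimize over $W^{1,p}_0(\omega'')$ the functional $J_\infty(v)=\int_{\omega''}[F''(\nabla''v(x''))-f''(x'')v(x'')]\,dx''$. Both problems have at least one minimizer; strict convexity of $F''$ makes the minimizer of ${\cal P}_\infty$ unique. *)

(* Defs.v *)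
From HB Require Import structures.
From mathcomp Require Import all_boot all_order all_algebra.
From mathcomp Require Import all_classical all_reals all_analysis.
Set Implicit Arguments.
Unset Strict Implicit.
Unset Printing Implicit Defensive.
Import Order.TTheory GRing.Theory Num.Theory.
Import numFieldNormedType.Exports.
Local Open Scope classical_set_scope.
Local Open Scope ring_scope.

(* The Borel sigma-algebra of R^n, generated by the coordinate functions, as
   for [n.-tuple T]. *)
Section measurable_rV.
Context {d : measure_display} {T : measurableType d}.
Variable n : nat.

Let coors : 'I_n -> 'rV[T]_n -> T := fun i x => x 0 i.

Let rV_set0 : g_sigma_preimage coors set0.
Proof. exact: sigma_algebra0. Qed.

Let rV_setC A : g_sigma_preimage coors A -> g_sigma_preimage coors (~` A).
Proof. exact: sigma_algebraC. Qed.

Let rV_bigcup (F : _^nat) : (forall i, g_sigma_preimage coors (F i)) ->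
  g_sigma_preimage coors (\bigcup_i (F i)).
Proof. exact: sigma_algebra_bigcup. Qed.

HB.instance Definition _ := @isMeasurable.Build (measure_tuple_display d)
  'rV[T]_n (g_sigma_preimage coors) rV_set0 rV_setC rV_bigcup.

End measurable_rV.

Lemma measurable_coord d (T : measurableType d) n (i : 'I_n) :
  measurable_fun [set: 'rV[T]_n] (fun x : 'rV[T]_n => x 0 i).
Proof.
move=> _ Y mY; rewrite setTI; apply: sub_sigma_algebra => /=.
rewrite -bigcup_seq/=; exists i => /=; first by rewrite mem_index_enum.
by exists Y => //; rewrite setTI.
Qed.

Lemma measurable_fun_rVP d d' (S : measurableType d) (T : measurableType d') n
    (f : S -> 'rV[T]_n) :
  (forall i, measurable_fun [set: S] (fun x => f x 0 i)) ->
  measurable_fun [set: S] f.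
Proof.
move=> mf _ Y mY; rewrite setTI.
suff : @measurable _ 'rV[T]_n `<=` [set A | measurable (f @^-1` A)] by apply.
apply: smallest_sub.
  split => /=; first by rewrite preimage_set0.
    by move=> A mA; rewrite setTD preimage_setC; exact: measurableC.
  by move=> F mF; rewrite preimage_bigcup; exact: bigcup_measurable.
move=> A; rewrite -bigcup_seq/= => -[i _ [B mB <-]] /=.
by rewrite setTI; have := mf i measurableT _ mB; rewrite setTI.
Qed.

Section lebesgue_rV.
Context {R : realType}.

Definition cons_rV n (x : R * 'rV[R]_n) : 'rV[R]_n.+1 := row_mx x.1%:M x.2.

(* n-dimensional Lebesgue measure, as an iterated product measure. *)
Fixpoint lebesgue_rV (n : nat) : set 'rV[R]_n -> \bar R :=
  if n is n'.+1 return set 'rV[R]_n -> \bar R then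
    pushforward (lebesgue_measure \x @lebesgue_rV n')%E (@cons_rV n')
  else \d_(0 : 'rV[R]_0).

Lemma measurable_cons_rV n : measurable_fun setT (@cons_rV n).
Proof.
apply: measurable_fun_rVP => i.
have -> : (fun x : R * 'rV[R]_n => cons_rV x 0 i) =
    fun x => if fintype.split (i : 'I_(1 + n)) is inr j then x.2 0 j else x.1.
  apply/funext => x; rewrite /cons_rV mxE.
  by case: splitP => j _ //; rewrite !ord1 mxE eqxx mulr1n.
case: (fintype.split (i : 'I_(1 + n))) => [j|j]; first exact: measurable_fst.
by apply: (measurableT_comp (measurable_coord j)); exact: measurable_snd.
Qed.

Definition uncons_rV n (v : 'rV[R]_n.+1) : R * 'rV[R]_n :=
  (v 0 0, @rsubmx _ 1 1 n v).

Lemma cons_rVK n : cancel (@cons_rV n) (@uncons_rV n).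
Proof.
move=> [a v]; rewrite /uncons_rV /cons_rV /= row_mxKr; congr pair.
have -> : (0 : 'I_n.+1) = lshift n (0 : 'I_1) by exact/val_inj.
by rewrite (@row_mxEl _ 1 1 n) mxE eqxx mulr1n.
Qed.

Lemma measurable_uncons_rV n : measurable_fun setT (@uncons_rV n).
Proof.
apply/measurable_fun_pairP; split; first exact: measurable_coord.
apply: measurable_fun_rVP => i.
rewrite (_ : (fun _ => _) = fun v : 'rV[R]_n.+1 => v 0 (rshift 1 i)).
  exact: measurable_coord.
by apply/funext => v /=; rewrite mxE.
Qed.

Section lebesgue_rV_step.
Variables (n : nat) (mu : {sigma_finite_measure set 'rV[R]_n -> \bar R}).
Let nu := pushforward (lebesgue_measure \x mu)%E (@cons_rV n).

Let nu0 : nu set0 = 0%E.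
Proof. by rewrite /nu /pushforward preimage_set0 measure0. Qed.

Let nu_ge0 A : (0 <= nu A)%E.
Proof. exact: (measure_ge0 (lebesgue_measure \x mu)%E). Qed.

Let nu_sigma_additive : semi_sigma_additive nu.
Proof.
have mc A : measurable A -> measurable (@cons_rV n @^-1` A).
  by move=> mA; rewrite -[X in measurable X]setTI; exact: measurable_cons_rV.
move=> F mF tF mUF; rewrite /nu /pushforward preimage_bigcup.
apply: measure_semi_sigma_additive.
- by move=> k; exact: mc.
- apply/trivIsetP => /= i j _ _ ij; rewrite -preimage_setI.
  by move/trivIsetP : tF => /(_ _ _ _ _ ij) ->//; rewrite preimage_set0.
- by rewrite -preimage_bigcup; exact: mc.
Qed.

HB.instance Definition _ := isMeasure.Build _ _ _ nu
  nu0 nu_ge0 nu_sigma_additive.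

Let nu_sigma_finite : sigma_finite setT nu.
Proof.
have [F TF Foo] : sigma_finite setT (lebesgue_measure \x mu)%E.
  have /sigma_finiteP[F [TF ndF Foo]] := sigma_finiteT (@lebesgue_measure R).
  have /sigma_finiteP[G [TG ndG Goo]] := sigma_finiteT mu.
  exists (fun k => F k `*` G k).
    rewrite -setXTT TF TG; apply/seteqP; split=> -[x y].
      move=> [/= [i _ Fx] [j _ Gy]]; exists (maxn i j) => //; split.
        by move: x Fx; exact/subsetPset/ndF/leq_maxl.
      by move: y Gy; exact/subsetPset/ndG/leq_maxr.
    by move=> [i _ []/= ? ?]; split; exists i.
  move=> k; have [? ?] := Foo k; have [? ?] := Goo k.
  split; first exact: measurableX.
  by rewrite product_measure1E// lte_mul_pinfty// ge0_fin_numE.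
exists (fun k => @uncons_rV n @^-1` F k).
  by rewrite -preimage_bigcup -TF preimage_setT.
move=> k; have [mF Fk] := Foo k; split.
  by rewrite -[X in measurable X]setTI; exact: measurable_uncons_rV.
rewrite /nu /pushforward -comp_preimage.
by rewrite (_ : _ \o _ = id) ?preimage_id//; apply/funext/cons_rVK.
Qed.

HB.instance Definition _ := Measure_isSigmaFinite.Build _ _ _ nu
  nu_sigma_finite.

Definition lebesgue_rV_step : {sigma_finite_measure set 'rV[R]_n.+1 -> \bar R} :=
  nu.

End lebesgue_rV_step.

Lemma lebesgue_rV_subproof n :
  exists mu : {sigma_finite_measure set 'rV[R]_n -> \bar R},
    @lebesgue_rV n = mu.
Proof.
elim: n => [|n [mu muE]]; first by exists (dirac (0 : 'rV[R]_0)).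
by exists (lebesgue_rV_step mu); rewrite /= muE.
Qed.

Section lebesgue_rV_measure.
Variable n : nat.
Local Notation mu := (@lebesgue_rV n).

Let mu0 : mu set0 = 0%E.
Proof. by have [nu ->] := lebesgue_rV_subproof n; exact: measure0. Qed.

Let mu_ge0 A : (0 <= mu A)%E.
Proof. by have [nu ->] := lebesgue_rV_subproof n; exact: measure_ge0. Qed.

Let mu_sigma_additive : semi_sigma_additive mu.
Proof.
have [nu ->] := lebesgue_rV_subproof n.
exact: measure_semi_sigma_additive.
Qed.

HB.instance Definition _ := isMeasure.Build _ _ _ mu
  mu0 mu_ge0 mu_sigma_additive.

Let mu_sigma_finite : sigma_finite setT mu.
Proof. by have [nu ->] := lebesgue_rV_subproof n; exact: sigma_finiteT. Qed.

HB.instance Definition _ := Measure_isSigmaFinite.Build _ _ _ mu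
  mu_sigma_finite.

End lebesgue_rV_measure.

Lemma lebesgue_rV_box n (A : 'I_n -> set R) :
  (forall i, measurable (A i)) ->
  lebesgue_rV [set x : 'rV[R]_n | forall i, A i (x 0 i)] =
  (\prod_(i < n) lebesgue_measure (A i))%E.
Proof.
elim: n A => [|n IH] A mA.
  rewrite big_ord0 /= diracE mem_set//; first by case.
rewrite big_ord_recl -IH; last by move=> i; exact: mA.
rewrite /= /pushforward.
set B := [set x : 'rV[R]_n | _].
have mB : measurable B.
  rewrite (_ : B = \bigcap_i [set x : 'rV[R]_n | A (lift ord0 i) (x 0 i)]); last first.
    by apply/seteqP; split => x /= h i; [move=> _; exact: h|exact: h].
  apply: fin_bigcap_measurable => // i _.
  by rewrite -[X in measurable X]setTI; exact: measurable_coord.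
transitivity ((lebesgue_measure \x @lebesgue_rV n)%E (A ord0 `*` B)); last first.
  exact: (product_measure1E (@lebesgue_measure R) (@lebesgue_rV n) (mA ord0) mB).
congr ((lebesgue_measure \x @lebesgue_rV n)%E _).
apply/seteqP; split => -[a v] /=.
  move=> h; split; last first.
    move=> i; have := h (lift ord0 i).
    have -> : lift ord0 i = rshift 1 i by exact/val_inj.
    by rewrite /cons_rV (@row_mxEr _ 1 1 n).
  have := h ord0; have -> : (ord0 : 'I_n.+1) = lshift n (0 : 'I_1) by exact/val_inj.
  by rewrite /cons_rV (@row_mxEl _ 1 1 n) mxE eqxx mulr1n.
move=> [Aa Bv] i; rewrite /cons_rV.
case: (unliftP ord0 i) => [j ->|->].
  have -> : (lift ord0 j : 'I_n.+1) = rshift 1 j by exact/val_inj.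
  rewrite (@row_mxEr _ 1 1 n).
  have -> : rshift 1 j = lift ord0 j by exact/val_inj.
  exact: Bv.
have -> : (ord0 : 'I_n.+1) = lshift n (0 : 'I_1) by exact/val_inj.
rewrite (@row_mxEl _ 1 1 n) mxE eqxx mulr1n.
by have -> : lshift n (0 : 'I_1) = ord0 by exact/val_inj.
Qed.

End lebesgue_rV.

Arguments lebesgue_rV {R} n.

Section sobolev.
Context {R : realType} {n : nat}.
Implicit Types (D : set 'rV[R]_n) (u phi : 'rV[R]_n -> R) (p : R).

Local Notation mu := (@lebesgue_rV R n).

(* The Euclidean norm: the norm [`|x|] of the library on 'rV is the sup norm. *)
Definition enorm (x : 'rV[R]_n) : R := Num.sqrt (\sum_(i < n) x 0 i ^+ 2).

Definition partial (i : 'I_n) u : 'rV[R]_n -> R :=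
  fun x => 'D_(delta_mx 0 i) u x.

Definition smooth u := forall s : seq 'I_n,
  let v := foldr partial u s in
  continuous v /\ forall i x, derivable v x (delta_mx 0 i).

(* The space C_c^oo(D); the support condition is stated with a compact subset of D
   outside of which phi vanishes. *)
Definition test_function D phi := smooth phi /\
  exists K : set 'rV[R]_n,
    [/\ compact K, K `<=` D & forall x, ~ K x -> phi x = 0].

Definition L1loc D u := measurable_fun D u /\
  forall K : set 'rV[R]_n, compact K -> K `<=` D ->
    mu.-integrable K (EFin \o u).

Definition is_weak_gradient D u (g : 'rV[R]_n -> 'rV[R]_n) :=
  [/\ L1loc D u, forall i, L1loc D (fun x => g x 0 i) &
    forall phi, test_function D phi -> forall i,
      \int[mu]_(x in D) (u x * partial i phi x) =
      - \int[mu]_(x in D) (g x 0 i * phi x)].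

(* The weak gradient is only determined almost everywhere on D; [grad D u] is a
   representative of it. When u has no weak gradient on D, [grad D u] is 0:
   uses of [grad] and [Wnorm] are to be guarded by membership in W^{1,p}(D). *)
Definition grad D u : 'rV[R]_n -> 'rV[R]_n :=
  xget (fun=> 0) [set g | is_weak_gradient D u g].

Definition Lp_norm p D u : \bar R := 'N[mu]_(p%:E)[EFin \o (u \_ D)]%E.

Definition Lp p D u := measurable_fun D u /\ (Lp_norm p D u < +oo)%E.

Definition W1p p D u := Lp p D u /\
  exists2 g, is_weak_gradient D u g & forall i, Lp p D (fun x => g x 0 i).

Definition Wnorm p D u : \bar R :=
  (Lp_norm p D u + Lp_norm p D (enorm \o grad D u))%E.

Definition W1p_strong_cvg (I : Type) p D (F : set_system I)
    (v : I -> 'rV[R]_n -> R) u :=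
  [/\ \forall i \near F, W1p p D (v i), W1p p D u &
    Wnorm p D (fun x => v i x - u x) @[i --> F] --> 0%E].

(* Bounded linear functionals on W^{1,p}(D). Boundedness makes them compatible
   with almost everywhere equality. *)
Definition W1p_dual p D (L : ('rV[R]_n -> R) -> R) :=
  (forall (a : R) u v, W1p p D u -> W1p p D v ->
     L (fun x => a * u x + v x) = a * L u + L v) /\
  (exists C : R, forall u, W1p p D u -> ((`|L u|)%:E <= C%:E * Wnorm p D u)%E).

Definition W1p_weak_cvg (I : Type) p D (F : set_system I)
    (v : I -> 'rV[R]_n -> R) u :=
  [/\ \forall i \near F, W1p p D (v i), W1p p D u &
    forall L, W1p_dual p D L -> L (v i) @[i --> F] --> L u].

(* W^{1,p}_0(D), the closure of C_c^oo(D) in W^{1,p}(D) *)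
Definition W1p0 p D u := exists phi : nat -> 'rV[R]_n -> R,
  (forall k, test_function D (phi k)) /\ W1p_strong_cvg p D \oo phi u.

Definition W1p_loc p D u := forall V : set 'rV[R]_n,
  open V -> compact (closure V) -> closure V `<=` D -> W1p p V u.

(* Zero trace on the boundary of D, for D possibly unbounded
   and without regularity assumption on the boundary: every cut-off of u
   belongs to the closure of C_c^oo(D). *)
Definition zero_trace p D u := forall rho, test_function setT rho ->
  W1p0 p D (fun x => rho x * u x).

Definition energy D (F : 'rV[R]_n -> R) (f : 'rV[R]_n -> R) u : R :=
  \int[mu]_(x in D) (F (grad D u x) - f x * u x).

Definition is_minimizer p D F f u := W1p0 p D u /\
  forall v, W1p0 p D v -> energy D F f u <= energy D F f v.

Definition strictly_convex (F : 'rV[R]_n -> R) := forall x y (t : R),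
  x != y -> 0 < t < 1 ->
  F (t *: x + (1 - t) *: y) < t * F x + (1 - t) * F y.

Definition starshaped0 D := forall x (t : R),
  D x -> 0 <= t <= 1 -> D (t *: x).

Definition gauge D (x : 'rV[R]_n) : R := inf [set t | 0 < t /\ D (t^-1 *: x)].

End sobolev.

(* R^n = R^r x R^m with m = n - r; [lsubmx x] and [rsubmx x] are x' and x''. *)
Section cylinders.
Context {R : realType} {r m : nat}.

Definition cylinder (w' : set 'rV[R]_r) (w'' : set 'rV[R]_m) :
    set 'rV[R]_(r + m) := [set x | w' (lsubmx x) /\ w'' (rsubmx x)].

Definition Omega w' w'' (l : R) := cylinder [set l *: x | x in w'] w''.

Definition Omega_oo w'' := cylinder setT w''.

Definition from_rsub (T : Type) (f : 'rV[R]_m -> T) : 'rV[R]_(r + m) -> T :=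
  fun x => f (rsubmx x).

Definition Fsec (F : 'rV[R]_(r + m) -> R) (xi'' : 'rV[R]_m) : R :=
  F (row_mx 0 xi'').

Definition Gpart F (xi : 'rV[R]_(r + m)) : R := F xi - Fsec F (rsubmx xi).

(* |xi'|^p + k |xi''|^(p-k) |xi'|^k; the second term vanishes when k = 0. *)
Definition Gbound (p k : R) (xi : 'rV[R]_(r + m)) : R :=
  enorm (lsubmx xi) `^ p +
  k * enorm (rsubmx xi) `^ (p - k) * enorm (lsubmx xi) `^ k.

End cylinders.

(* Main.v *)
Require Import Defs.
From mathcomp Require Import all_boot all_order all_algebra.
From mathcomp Require Import all_classical all_reals all_analysis measurable_realfun.
From mathcomp Require Import ring lra.
Set Implicit Arguments.
Unset Strict Implicit.
Unset Printing Implicit Defensive.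
Import Order.TTheory GRing.Theory Num.Theory.
Import numFieldNormedType.Exports.
Local Open Scope classical_set_scope.
Local Open Scope ring_scope.

(** The minimizer u_l is compared with u_oo through cut-off functions of x', and
    the difference of the two functionals turns out to be convex enough to bound
    the distance of the gradients.

    Let rho = chi(x'/l)^q, where chi is a fixed test function of omega' with
    0 <= chi <= 1 and q is large. The function (1 - rho) u_l + rho u_oo competes
    with u_l, and the convexity of F gives ([cut_off_estimate])
      int rho G(grad u_l) + int rho e_l <= int R_l,
    where e_l = F''(grad'' u_l) - f'' u_l - F''(grad'' u_oo) + f'' u_oo is called
    the excess below, and where the remainder R_l only involves u_l - u_oo and
    grad'' u_oo multiplied by grad rho, hence powers of 1/l. The growth of G bounds
    R_l by eps rho |u_l - u_oo|^p + C l^(-s) (|u_l - u_oo|^p + |grad'' u_oo|^p), with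
    s > r by the assumption on r, and with eps = 0 if k = 0 ([remainder_bound]).

    The excess is not nonnegative pointwise, but its integral against any weight
    rho(x') >= 0 is, because u_oo minimizes the energy of every slice x' = const.
    More precisely, for theta in [0,1], the minimality of u_oo against
    theta u_l + (1 - theta) u_oo on the slices bounds the integral of rho times the
    convexity gap
      theta F''(grad'' u_l) + (1 - theta) F''(grad'' u_oo)
        - F''(theta grad'' u_l + (1 - theta) grad'' u_oo)
    by theta int rho e_l ([gap_le_excess]). If k > 0 the uniform convexity of F''
    bounds this gap from below by a multiple of |grad'' (u_l - u_oo)|^p, and
    Poincare's inequality in x'', which holds with any weight depending on x' only
    ([poincare]), absorbs the term with eps into the excess ([energy_decay]).

    Comparing u_l with 0 bounds int |u_l|^p over Omega_l by a multiple of
    |Omega_l|, of order l^r ([minimizer_size]). Since s > r, the integrals of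
    G(grad u_l) and of the gap tend to 0 on every fixed Omega_l0
    ([energy_vanishes]). The first one controls grad' u_l. For the second one,
    strict convexity and compactness turn a small gap into a small distance where
    grad'' u_oo is bounded ([gap_distance]), and for small theta the gap is also
    coercive ([gap_coercive]), which takes care of the set where grad'' u_oo is
    large. Hence grad'' u_l tends to grad'' u_oo in L^p(Omega_l0), and so does u_l to
    u_oo by Poincare's inequality ([strong_convergence]).

    A weak limit u* of a sequence of the u_l must agree with the strong limit: the
    functional v |-> int v sgn(u* - u_oo) is continuous on W^{1,p}(Omega_l0)
    ([weak_strong_unique]).

    Weak gradients are handled through [Wclosure]: a function together with its
    gradient is a limit of smooth functions and their gradients, so that
    inequalities are proved for smooth functions and pass to the limit. *)

(** * Borel sets and Lebesgue measure of R^n *)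

Section borel_rV.
Context {R : realType} {n : nat}.
Local Notation mu := (@lebesgue_rV R n).
Implicit Types (a b x : 'rV[R]_n).

Definition obox a b : set 'rV[R]_n := [set x | forall i, a 0 i < x 0 i < b 0 i].

Lemma coord_preimage_measurable (i : 'I_n) (A : set R) :
  measurable A -> measurable [set x : 'rV[R]_n | A (x 0 i)].
Proof. by move=> mA; rewrite -[X in measurable X]setTI; exact: measurable_coord. Qed.

Lemma forall_measurable (A : 'I_n -> set R) : (forall i, measurable (A i)) ->
  measurable [set x : 'rV[R]_n | forall i, A i (x 0 i)].
Proof.
move=> mA; rewrite (_ : mkset _ = \bigcap_i [set x : 'rV[R]_n | A i (x 0 i)]).
  by apply: fin_bigcap_measurable => // i _; exact: coord_preimage_measurable.
by apply/seteqP; split => x /= h i; [move=> _; exact: h|exact: h].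
Qed.

Lemma oboxE a b : obox a b = [set x | forall i, `]a 0 i, b 0 i[%classic (x 0 i)].
Proof. by apply/seteqP; split => x /= h i; have := h i; rewrite in_itv. Qed.

Lemma measurable_obox a b : measurable (obox a b).
Proof.
rewrite oboxE; apply: (forall_measurable (A := fun i => `]a 0 i, b 0 i[%classic)).
by move=> i; exact: measurable_itv.
Qed.

Lemma lebesgue_obox a b :
  mu (obox a b) = (\prod_(i < n) lebesgue_measure `](a 0 i)%R, (b 0 i)%R[%classic)%E.
Proof.
rewrite oboxE (lebesgue_rV_box (A := fun i => `]a 0 i, b 0 i[%classic))//.
Qed.

Lemma lebesgue_obox_lty a b : (mu (obox a b) < +oo)%E.
Proof.
rewrite lebesgue_obox ltey_eq; apply/orP; left; elim/big_ind : _ => //.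
  by move=> x y xf yf; rewrite fin_numM.
by move=> i _; rewrite /= lebesgue_measure_itv; case: ifPn.
Qed.

Definition cbox a b : set 'rV[R]_n := [set x | forall i, a 0 i <= x 0 i <= b 0 i].

Lemma compact_cbox a b : compact (cbox a b).
Proof.
have := @rV_compact R n (fun i => `[a 0 i, b 0 i]%classic) (fun i => @segment_compact _ _ _).
by congr compact; apply/seteqP.
Qed.

Lemma obox_sub_cbox a b : obox a b `<=` cbox a b.
Proof. by move=> x h i; have /andP[/ltW-> /ltW->] := h i. Qed.

(** Around each of its points an open set contains a closed box with rational
    corners, and there are countably many of these. *)
Lemma open_bigcup_obox (U : set 'rV[R]_n) : open U ->
  let q2b (q : {ffun 'I_n -> rat * rat}) :=
    obox (\row_i ratr (q i).1) (\row_i ratr (q i).2) in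
  U = \bigcup_(q in [set q : {ffun 'I_n -> rat * rat} |
    cbox (\row_i ratr (q i).1) (\row_i ratr (q i).2) `<=` U]) q2b q.
Proof.
move=> oU q2b; apply/seteqP; split => [x Ux|x [q /= qU] /obox_sub_cbox]; last exact: qU.
have /nbhs_ballP[e /= e0 eU] := open_nbhs_nbhs (conj oU Ux).
have exq (i : 'I_n) : exists q : rat * rat,
    x 0 i - e < ratr q.1 < x 0 i /\ x 0 i < ratr q.2 < x 0 i + e.
  have [q1] := @rat_in_itvoo R (x 0 i - e) (x 0 i) ltac:(lra).
  have [q2] := @rat_in_itvoo R (x 0 i) (x 0 i + e) ltac:(lra).
  by rewrite !in_itv/=; exists (q1, q2).
exists [ffun i => sval (cid (exq i))] => /=.
  move=> y qy; apply: eU; split => // j i; rewrite ord1.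
  have := qy i; rewrite !mxE ffunE; case: cid => q /= [/andP[? ?] /andP[? ?]] /andP[? ?].
  by rewrite /ball/= ltr_norml; apply/andP; split; lra.
move=> i; rewrite !mxE ffunE; case: cid => q /= [/andP[? ?] /andP[? ?]].
by apply/andP; split.
Qed.

Lemma open_measurable_rV (U : set 'rV[R]_n) : open U -> measurable U.
Proof.
move=> oU; rewrite (open_bigcup_obox oU) bigcup_mkcond.
apply: countable_bigcupT_measurable => [|q]; first exact: countableP.
 case: ifPn => _ //.
exact: measurable_obox.
Qed.

Lemma closed_measurable_rV (U : set 'rV[R]_n) : closed U -> measurable U.
Proof.
by move=> cU; rewrite -[U]setCK; apply: measurableC; apply: open_measurable_rV; exact: closed_openC.
Qed.

Lemma compact_measurable_rV (K : set 'rV[R]_n) : compact K -> measurable K.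
Proof. move=> cK; apply: closed_measurable_rV; apply: compact_closed => //; exact: norm_hausdorff. Qed.

Lemma continuous_measurable_rV (D : set 'rV[R]_n) (f : 'rV[R]_n -> R) :
  continuous f -> measurable_fun D f.
Proof.
move=> cf; apply: (@measurable_funS _ _ _ _ setT) => //.
apply: (measurability _ (RGenOpens.measurableE R)).
move=> _ [_ [x [y ->]] <-]; rewrite setTI; apply: open_measurable_rV.
by apply: open_comp => // z _; exact: cf.
Qed.

Lemma oboxI a b c d : obox a b `&` obox c d =
  obox (\row_i Num.max (a 0 i) (c 0 i)) (\row_i Num.min (b 0 i) (d 0 i)).
Proof.
apply/seteqP; split => x /=.
  move=> [h1 h2] i; rewrite !mxE gt_max lt_min.
  by have /andP[-> ->] := h1 i; have /andP[-> ->] := h2 i.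
move=> h; split => i; have := h i; rewrite !mxE gt_max lt_min;
  by move=> /andP[/andP[? ?] /andP[? ?]]; apply/andP.
Qed.

Lemma setI_closed_obox : setI_closed [set A | exists a b, A = obox a b].
Proof.
by move=> _ _ [a [b ->]] [c [d ->]]; rewrite oboxI; do 2 eexists.
Qed.

Lemma bigcup_obox (i : 'I_n) (s t : R) :
  [set x : 'rV[R]_n | s < x 0 i < t] = \bigcup_k
    obox (\row_j if j == i then s else - k%:R) (\row_j if j == i then t else k%:R).
Proof.
apply/seteqP; split => x /=; last first.
  by move=> [k _ /(_ i)]; rewrite !mxE eqxx.
move=> xi; have [k xk] : exists k : nat, forall j, `|x 0 j| < k%:R.
  exists (Num.truncn `|x|).+1 => j; apply: le_lt_trans (truncnS_gt _).
  rewrite [leRHS]mx_normrE; exact: (le_bigmax _ (fun ij : 'I_1 * 'I_n => `|x ij.1 ij.2|) (0, j)).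
exists k => // j; rewrite !mxE; case: eqP => [->//|_].
by have := xk j; rewrite ltr_norml.
Qed.

(** The slab where the i-th coordinate lies in an open interval is a countable
    union of boxes. *)
Lemma measurable_rVE :
  @measurable _ 'rV[R]_n = <<s [set A | exists a b, A = obox a b] >>.
Proof.
apply/seteqP; split; last first.
  apply: smallest_sub; first exact: sigma_algebra_measurable.
  by move=> _ [a [b ->]]; exact: measurable_obox.
apply: smallest_sub; first exact: smallest_sigma_algebra.
move=> A; rewrite -bigcup_seq/= => -[i _ [B mB <-]] /=; rewrite setTI.
pose H := <<s [set A | exists a b : 'rV[R]_n, A = obox a b] >>.
have [H0 HC HU] : sigma_algebra [set: 'rV[R]_n] H by exact: smallest_sigma_algebra.
suff : @measurable _ R `<=` [set B | H [set x : 'rV[R]_n | B (x 0 i)]] by apply.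
rewrite [X in X `<=` _](RGenOpens.measurableE R); apply: smallest_sub.
  split => [|C HCi|C HCi] /=; first exact: H0.
  - have := HC _ HCi; congr H; apply/seteqP; by split => x /=; [case=> _|].
  - have := HU _ HCi; congr H; apply/seteqP; by split => x /=.
move=> _ [s [t ->]] /=.
have := bigcup_obox i s t.
rewrite [X in X = _](_ : _ = [set x : 'rV[R]_n | `]s, t[%classic (x 0 i)]).
  by move=> ->; apply: HU => k; apply: sub_sigma_algebra; do 2 eexists.
by apply/seteqP; split => x; rewrite /= in_itv.
Qed.

(** Open boxes form a pi-system that generates the Borel sets. *)
Lemma lebesgue_rV_unique (m1 : {measure set 'rV[R]_n -> \bar R}) :
  (forall a b, mu (obox a b) = m1 (obox a b)) ->
  forall A, measurable A -> mu A = m1 A.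
Proof.
move=> m1E.
apply: (measure_unique _ (fun k => obox (const_mx (- k%:R)) (const_mx k%:R))
  measurable_rVE setI_closed_obox).
- by move=> k; do 2 eexists.
- apply/seteqP; split => // x _; exists (Num.truncn `|x|).+1 => // j; rewrite !mxE -ltr_norml.
  apply: le_lt_trans (truncnS_gt _).
  rewrite [leRHS]mx_normrE; exact: (le_bigmax _ (fun ij : 'I_1 * 'I_n => `|x ij.1 ij.2|) (0, j)).
- by move=> A [a [b ->]]; exact: m1E.
- by move=> k; exact: lebesgue_obox_lty.
Qed.

Lemma measurable_addr_rV (v : 'rV[R]_n) :
  measurable_fun setT (fun x : 'rV[R]_n => x + v).
Proof.
apply: measurable_fun_rVP => i.
rewrite (_ : (fun _ => _) = fun x : 'rV[R]_n => x 0 i + v 0 i); last by apply/funext => x; rewrite mxE.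
by apply: measurable_funD => //; exact: measurable_coord.
Qed.

(** On boxes this is the translation invariance of the sides. *)
Lemma lebesgue_rV_translation (v : 'rV[R]_n) A : measurable A ->
  mu A = pushforward mu (fun x => x + v) A.
Proof.
apply: (@lebesgue_rV_unique (measure_function_pushforward__canonical__measure_function_Measure mu (measurable_addr_rV v))).
move=> a b; rewrite /= /pushforward.
rewrite (_ : _ @^-1` _ = obox (a - v) (b - v)); last first.
  by apply/seteqP; split => x /= h i; have := h i; rewrite !mxE ltrBlDr ltrBrDr.
rewrite !lebesgue_obox; apply: eq_bigr => i _.
rewrite !lebesgue_measure_itv/= !lte_fin !mxE ltrD2r; case: ifPn => // _.
by rewrite !EFinN -!EFinB; congr EFin; ring.
Qed.

Lemma integral_translation (v : 'rV[R]_n) (f : 'rV[R]_n -> \bar R) :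
  measurable_fun [set: 'rV[R]_n] f ->
  (\int[mu]_x (f \o (fun x : 'rV[R]_n => x + v)%R) x = \int[mu]_x f x)%E.
Proof.
have ge0E (g : 'rV[R]_n -> \bar R) : measurable_fun [set: 'rV[R]_n] g -> (forall x, 0 <= g x)%E ->
    (\int[mu]_x (g \o (fun x : 'rV[R]_n => x + v)%R) x = \int[mu]_x g x)%E.
  move=> mg g0; rewrite [RHS](eq_measure_integral
    (measure_function_pushforward__canonical__measure_function_Measure mu
      (measurable_addr_rV v))); last by move=> A mA _; exact: lebesgue_rV_translation.
  rewrite ge0_integral_pushforward//; exact: measurable_addr_rV.
move=> mf; rewrite integralE [RHS]integralE; congr (_ - _)%E.
  have -> : ((f \o +%R^~ v)^\+ = f^\+ \o +%R^~ v)%E by apply/funext => x; rewrite /= !funeposE.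
  exact: ge0E (measurable_funepos mf) (funepos_ge0 f).
have -> : ((f \o +%R^~ v)^\- = f^\- \o +%R^~ v)%E by apply/funext => x; rewrite /= !funenegE.
exact: ge0E (measurable_funeneg mf) (funeneg_ge0 f).
Qed.

End borel_rV.

(** * Fubini's theorem for R^r x R^m *)

Section product_rV.
Context {R : realType} {r m : nat}.
Local Notation mu := (@lebesgue_rV R (r + m)).
Local Notation mu1 := (@lebesgue_rV R r).
Local Notation mu2 := (@lebesgue_rV R m).

Let row2 (z : 'rV[R]_r * 'rV[R]_m) : 'rV[R]_(r + m) := row_mx z.1 z.2.

Lemma measurable_row_mx : measurable_fun setT row2.
Proof.
apply: measurable_fun_rVP => i; rewrite /row2.
case: (split_ordP i) => j ->.
  under eq_fun do rewrite row_mxEl.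
  by apply: (measurableT_comp (measurable_coord j)); exact: measurable_fst.
under eq_fun do rewrite row_mxEr.
by apply: (measurableT_comp (measurable_coord j)); exact: measurable_snd.
Qed.

(** Both sides give a box the product of the lengths of its sides. *)
Lemma lebesgue_rV_prod A : measurable A -> mu A = pushforward (mu1 \x mu2)%E row2 A.
Proof.
apply: (@lebesgue_rV_unique _ _ (measure_function_pushforward__canonical__measure_function_Measure (mu1 \x mu2)%E measurable_row_mx)).
move=> a b; rewrite /= /pushforward.
rewrite (_ : _ @^-1` _ = obox (lsubmx a) (lsubmx b) `*` obox (rsubmx a) (rsubmx b)).
  rewrite product_measure1E; [|exact: measurable_obox..].
  rewrite [LHS]lebesgue_obox [X in _ = (X * _)%E]lebesgue_obox [X in _ = (_ * X)%E]lebesgue_obox.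
  by rewrite big_split_ord/=; congr (_ * _)%E; apply: eq_bigr => i _; rewrite !mxE.
apply/seteqP; split => -[x y] /=.
  move=> h; split => i.
    by have := h (lshift m i); rewrite /row2 row_mxEl !mxE.
  by have := h (rshift r i); rewrite /row2 row_mxEr !mxE.
move=> [h1 h2] i; rewrite /row2; case: (split_ordP i) => j ->.
  by have := h1 j; rewrite row_mxEl !mxE.
by have := h2 j; rewrite row_mxEr !mxE.
Qed.

Lemma integral_rV_prod (f : 'rV[R]_(r + m) -> \bar R) : measurable_fun [set: 'rV[R]_(r + m)] f ->
  (\int[mu]_x f x = \int[mu1 \x mu2]_z (f \o row2) z)%E.
Proof.
have ge0E (g : 'rV[R]_(r + m) -> \bar R) : measurable_fun [set: 'rV[R]_(r + m)] g -> (forall x, 0 <= g x)%E ->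
    (\int[mu]_x g x = \int[mu1 \x mu2]_z (g \o row2) z)%E.
  move=> mg g0; rewrite (eq_measure_integral
    (measure_function_pushforward__canonical__measure_function_Measure (mu1 \x mu2)%E
      measurable_row_mx)); last by move=> A mA _; exact: lebesgue_rV_prod.
  by rewrite ge0_integral_pushforward//; exact: measurable_row_mx.
move=> mf; rewrite integralE [RHS]integralE; congr (_ - _)%E.
  have -> : ((f \o row2)^\+ = f^\+ \o row2)%E by apply/funext => x; rewrite /= !funeposE.
  exact: ge0E (measurable_funepos mf) (funepos_ge0 f).
have -> : ((f \o row2)^\- = f^\- \o row2)%E by apply/funext => x; rewrite /= !funenegE.
exact: ge0E (measurable_funeneg mf) (funeneg_ge0 f).
Qed.

Lemma fubini_rV (f : 'rV[R]_(r + m) -> R) : mu.-integrable setT (EFin \o f) ->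
  (\int[mu]_x (f x)%:E = \int[mu1]_x \int[mu2]_y (f (row_mx x y))%:E)%E.
Proof.
move=> intf; have mf := measurable_int mu intf.
rewrite integral_rV_prod//; symmetry.
apply: (@integral12_prod_meas1 _ _ _ _ _ mu1 mu2 (fun z => (f (row2 z))%:E)).
apply/integrableP; split.
  exact: (measurableT_comp mf measurable_row_mx).
have /integrableP[_] := intf.
rewrite (integral_rV_prod (f := fun x => `|(f x)%:E|%E))//.
by apply: measurableT_comp.
Qed.

Lemma tonelli_rV (f : 'rV[R]_(r + m) -> \bar R) : measurable_fun [set: 'rV[R]_(r + m)] f ->
  (forall x, 0 <= f x)%E ->
  (\int[mu]_x f x = \int[mu1]_x \int[mu2]_y f (row_mx x y))%E.
Proof.
move=> mf f0; rewrite integral_rV_prod//.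
rewrite (@fubini_tonelli1 _ _ _ _ _ mu1 mu2 (f \o row2))//.
- exact: (measurableT_comp mf measurable_row_mx).
- by move=> z; exact: f0.
Qed.

End product_rV.

(** * Smooth functions *)

Section line_derivative.
Context {R : realType} {V : normedModType R}.
Implicit Types (f : V -> R) (v x : V).

(** Directional derivatives are one-variable derivatives along lines; this is
    how the one-variable chain rule and mean value theorem are used below. *)
Lemma is_derive_line f x v (t d : R) :
  is_derive t 1 (fun h : R => f (h *: v + x)) d <-> is_derive (t *: v + x) v f d.
Proof.
have E : (fun h : R => h^-1 *: (((fun h : R => f (h *: v + x)) \o shift t) (h *: (1 : R)) -
    f (t *: v + x))) =
  (fun h : R => h^-1 *: ((f \o shift (t *: v + x)) (h *: v) - f (t *: v + x))).
  apply/funext => h /=; congr (_ *: (f _ - _)).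
  by rewrite -[h *: (1 : R)]/(h * 1) mulr1 scalerDl addrA.
split => -[D1 D2]; split.
- by move: D1; rewrite /derivable E.
- by move: D2; rewrite /derive E.
- by move: D1; rewrite /derivable -E.
- by move: D2; rewrite /derive -E.
Qed.

Lemma is_derive_line0 f x v (d : R) :
  is_derive (0 : R) 1 (fun h : R => f (h *: v + x)) d <-> is_derive x v f d.
Proof. by rewrite is_derive_line scale0r add0r. Qed.

(** The mean value theorem on the line through x directed by v. *)
Lemma derive_increment f (df : V -> R) x v (C t : R) : 0 <= t ->
  (forall y, is_derive y v f (df y)) -> (forall y, `|df y| <= C) ->
  `|f (t *: v + x) - f x| <= C * t.
Proof.
move=> t0 fdf dfC.
have dl (h : R) : is_derive h (1 : R) (fun h : R => f (h *: v + x)) (df (h *: v + x)).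
  by apply/is_derive_line; exact: fdf.
have cl : {within `[0, t], continuous (fun h : R => f (h *: v + x))}.
  by apply: derivable_within_continuous => h _; case: (dl h).
have [c _] := MVT_segment t0 (fun h _ => dl h) cl.
rewrite scale0r add0r subr0 => ->; rewrite normrM (ger0_norm t0).
by rewrite ler_wpM2r.
Qed.

End line_derivative.

Section smooth_functions.
Context {R : realType}.
Implicit Types n l : nat.

Fixpoint Ck n (k : nat) (u : 'rV[R]_n -> R) : Prop := continuous u /\
  if k is k'.+1 then forall i : 'I_n, exists2 du : 'rV[R]_n -> R,
    (forall x, is_derive x (delta_mx 0 i) u (du x)) & Ck k' du
  else True.

Lemma CkS n k (u : 'rV[R]_n -> R) : Ck k.+1 u -> Ck k u.
Proof.
elim: k u => [|k IH] u [cu Du]; split => // i.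
by have [du udu Cdu] := Du i; exists du => //; exact: IH.
Qed.

(** This stratified form of smoothness is what inductions need: C^k passes
    from functions to their products and compositions by induction on k. *)
Lemma smoothP n (u : 'rV[R]_n -> R) : smooth u <-> forall k, Ck k u.
Proof.
split=> [su k|Cu s].
  elim: k u su => [|k IH] u su; first by split=> //; case: (su [::]).
  have [cu du] := su [::]; split=> // i; exists (partial i u).
    by move=> x; split=> //; exact: du.
  by apply: IH => s; have := su (rcons s i); rewrite foldr_rcons.
suff Csu : forall k, Ck k (foldr partial u s).
  have [cu Du] := Csu 1%N; split=> // i x.
  by have [du /(_ x) udu _] := Du i; case: udu.
elim: s => //= i s IH k; have [_ /(_ i)[du udu Cdu]] := IH k.+1.
suff -> : partial i (foldr partial u s) = du by [].
by apply/funext => x; rewrite /partial; case: (udu x).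
Qed.

Lemma Ck_cst n k (c : R) : @Ck n k (cst c).
Proof.
elim: k c => [|k IH] c; first by split=> //; exact: cst_continuous.
split=> [|i]; first exact: cst_continuous.
by exists (cst 0) => // x; exact: is_derive_cst.
Qed.

Lemma continuousD_rV n (u v : 'rV[R]_n -> R) :
  continuous u -> continuous v -> continuous (fun x => u x + v x).
Proof. by move=> cu cv x; exact: (continuousD (cu x) (cv x)). Qed.

Lemma continuousM_rV n (u v : 'rV[R]_n -> R) :
  continuous u -> continuous v -> continuous (fun x => u x * v x).
Proof. by move=> cu cv x; exact: (continuousM (cu x) (cv x)). Qed.

Lemma Ck_add n k (u v : 'rV[R]_n -> R) : Ck k u -> Ck k v -> Ck k (fun x => u x + v x).
Proof.
elim: k u v => [|k IH] u v [cu Du] [cv Dv].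
  by split=> //; exact: continuousD_rV.
split=> [|i]; first exact: continuousD_rV.
have [du udu Cdu] := Du i; have [dv vdv Cdv] := Dv i.
by exists (fun x => du x + dv x); [move=> x; exact: is_deriveD|exact: IH].
Qed.

Lemma Ck_mul n k (u v : 'rV[R]_n -> R) : Ck k u -> Ck k v -> Ck k (fun x => u x * v x).
Proof.
elim: k u v => [|k IH] u v Cu Cv; move: (Cu) (Cv) => [cu Du] [cv Dv].
  by split=> //; exact: continuousM_rV.
split=> [|i]; first exact: continuousM_rV.
 have [du udu Cdu] := Du i; have [dv vdv Cdv] := Dv i.
exists (fun x => u x * dv x + v x * du x); first by move=> x; exact: is_deriveM.
by apply: Ck_add; apply: IH => //; exact: CkS.
Qed.

(** Restrictions to x' or x'', slices and dilations send every coordinate line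
    to a coordinate line, or to a point when c j = 0. *)
Definition coordinate_map n l (A : 'rV[R]_n -> 'rV[R]_l) (c : 'I_n -> R) (s : 'I_n -> 'I_l) :=
  continuous A /\ forall j x t,
    A (t *: delta_mx 0 j + x) = (t * c j) *: delta_mx 0 (s j) + A x.

Lemma is_derive_coordinate_map n l (A : 'rV[R]_n -> 'rV[R]_l) c s (u du : 'rV[R]_l -> R) j x :
  coordinate_map A c s -> is_derive (A x) (delta_mx 0 (s j)) u (du (A x)) ->
  is_derive x (delta_mx 0 j) (u \o A) (c j * du (A x)).
Proof.
move=> [_ AE] /is_derive_line0 udu; apply/is_derive_line0.
rewrite (_ : (fun h => _) = (fun h : R => u (h *: delta_mx 0 (s j) + A x)) \o (fun t => t * c j)).
  rewrite mulrC; apply: is_derive1_comp; first by rewrite mul0r.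
  rewrite (_ : (fun t => t * c j) = (c j \*o id)); last by apply/funext => t; rewrite /= mulrC.
  by rewrite -[X in is_derive _ _ _ X]mulr1; exact: is_deriveZ.
by apply/funext => t; rewrite /= AE.
Qed.

Lemma Ck_coordinate_map n l (A : 'rV[R]_n -> 'rV[R]_l) c s k (u : 'rV[R]_l -> R) :
  coordinate_map A c s -> Ck k u -> Ck k (u \o A).
Proof.
move=> hA; elim: k u => [|k IH] u [cu Du].
  by split => // x; apply: continuous_comp; [exact: hA.1|exact: cu].
split; first by move=> x; apply: continuous_comp; [exact: hA.1|exact: cu].
move=> j; have [du udu Cdu] := Du (s j); exists (fun x => c j * du (A x)).
  by move=> x; exact: (is_derive_coordinate_map (du := du) hA).
by apply: Ck_mul; [exact: Ck_cst|exact: IH].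
Qed.

Lemma smooth_cst n (c : R) : smooth (fun _ : 'rV[R]_n => c).
Proof. by apply/smoothP => k; exact: Ck_cst. Qed.

Lemma smoothD n (u v : 'rV[R]_n -> R) : smooth u -> smooth v -> smooth (fun x => u x + v x).
Proof. by move=> /smoothP su /smoothP sv; apply/smoothP => k; exact: Ck_add. Qed.

Lemma smoothM n (u v : 'rV[R]_n -> R) : smooth u -> smooth v -> smooth (fun x => u x * v x).
Proof. by move=> /smoothP su /smoothP sv; apply/smoothP => k; exact: Ck_mul. Qed.

Lemma smooth_ext n (u v : 'rV[R]_n -> R) : u =1 v -> smooth u -> smooth v.
Proof. by move=> /funext ->. Qed.

Lemma smoothX n (u : 'rV[R]_n -> R) q : smooth u -> smooth (fun x => u x ^+ q).
Proof.
move=> su; elim: q => [|q IH]; first exact: smooth_cst.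
by apply: smooth_ext (smoothM su IH) => x; rewrite exprS.
Qed.

Lemma smooth_coordinate_map n l (A : 'rV[R]_n -> 'rV[R]_l) c s (u : 'rV[R]_l -> R) :
  coordinate_map A c s -> smooth u -> smooth (u \o A).
Proof. by move=> hA /smoothP su; apply/smoothP => k; exact: (Ck_coordinate_map hA). Qed.

Lemma smooth_partial n (u : 'rV[R]_n -> R) i : smooth u -> smooth (partial i u).
Proof. by move=> su s; have := su (rcons s i); rewrite foldr_rcons. Qed.

Lemma smooth_is_derive n (u : 'rV[R]_n -> R) i x : smooth u ->
  is_derive x (delta_mx 0 i) u (partial i u x).
Proof. by move=> su; have [_ du] := su [::]; split => //; exact: du. Qed.

Lemma smooth_continuous n (u : 'rV[R]_n -> R) : smooth u -> continuous u.
Proof. by move=> su; have [] := su [::]. Qed.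

Lemma partialE n (u : 'rV[R]_n -> R) i x d :
  is_derive x (delta_mx 0 i) u d -> partial i u x = d.
Proof. by case. Qed.

Lemma partialD n (u v : 'rV[R]_n -> R) i x : smooth u -> smooth v ->
  partial i (fun x => u x + v x) x = partial i u x + partial i v x.
Proof.
move=> su sv; apply: partialE.
exact: is_deriveD (smooth_is_derive i x su) (smooth_is_derive i x sv).
Qed.

Lemma partialM n (u v : 'rV[R]_n -> R) i x : smooth u -> smooth v ->
  partial i (fun x => u x * v x) x = u x * partial i v x + v x * partial i u x.
Proof.
move=> su sv; apply: partialE.
exact: is_deriveM (smooth_is_derive i x su) (smooth_is_derive i x sv).
Qed.

Lemma partial_cst n (c : R) i x : partial i (fun _ : 'rV[R]_n => c) x = 0.
Proof. by apply: partialE; exact: is_derive_cst. Qed.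

Lemma partial_coordinate_map n l (A : 'rV[R]_n -> 'rV[R]_l) c s (u : 'rV[R]_l -> R) j x :
  coordinate_map A c s -> smooth u ->
  partial j (u \o A) x = c j * partial (s j) u (A x).
Proof.
move=> hA su; apply: partialE.
exact: (is_derive_coordinate_map hA (smooth_is_derive (s j) (A x) su)).
Qed.

Lemma smooth_prod n (I : Type) (s : seq I) (u : I -> 'rV[R]_n -> R) :
  (forall i, smooth (u i)) -> smooth (fun x => \prod_(i <- s) u i x).
Proof.
move=> su; elim: s => [|i s IH].
  by apply: (smooth_ext _ (smooth_cst 1)) => x; rewrite big_nil.
by apply: smooth_ext (smoothM (su i) IH) => x; rewrite big_cons.
Qed.

End smooth_functions.

(** * Bump functions *)

Section flat_function.
Context {R : realType}.
Implicit Types (t : R) (j : nat).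

(** The derivatives of exp(-1/t), extended by 0 to t <= 0, are combinations of
    these functions, all of which are flat at 0. *)
Definition flat j t : R := if 0 < t then t^-1 ^+ j * expR (- t^-1) else 0.

Lemma flat_ge0 j t : 0 <= flat j t.
Proof.
rewrite /flat; case: ifPn => // t0.
by rewrite mulr_ge0 ?expR_ge0// exprn_ge0// invr_ge0 ltW.
Qed.

(** The exponential series dominates each of its terms, here at 1/t. *)
Lemma flat_le j t : flat j t <= (j.+2)`!%:R * t ^+ 2.
Proof.
rewrite /flat; case: ifPn => t0; last by rewrite mulr_ge0// sqr_ge0.
have x0 : 0 < t^-1 by rewrite invr_gt0.
have := expR_ge1Dxn j.+1 (ltW x0); set f := (j.+2)`!%:R; set x := t^-1.
have f0 : 0 < f by rewrite ltr0n fact_gt0.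
move=> h; have {}h : x ^+ j.+2 <= f * expR x.
  by rewrite mulrC -ler_pdivrMr//; apply: le_trans h; rewrite lerDr.
have -> : t ^+ 2 = x ^- 2 by rewrite /x exprVn invrK.
rewrite ler_pdivlMr ?exprn_gt0// mulrAC -exprD addn2 expRN.
by rewrite ler_pdivrMr ?expR_gt0.
Qed.

(** At 0 the quadratic bound [flat_le] makes the difference quotients vanish in
    the limit. *)
Lemma is_derive_flat j t : is_derive t (1 : R) (flat j) (- j%:R * flat j.+1 t + flat j.+2 t).
Proof.
have [t0|t0|<-] := ltgtP 0 t.
- pose g : R -> R := (fun y : R => y^-1) ^+ j * (expR \o - (fun y : R => y^-1)).
  apply: (near_eq_is_derive (f := g)).
    near=> y; rewrite /g /flat ifT//; last by near: y; exact: lt_nbhsr.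
    by rewrite !fctE.
  have dV : is_derive t (1 : R) (fun y : R => y^-1) (- t ^- 2).
    rewrite -[X in is_derive _ _ _ X]mulr1; apply: is_deriveV => //.
    by rewrite gt_eqF.
  have dE : is_derive t (1 : R) (expR \o - (fun y : R => y^-1)) (expR (- t^-1) * t ^- 2).
    by apply: is_derive1_comp; rewrite -[X in is_derive _ _ _ X]opprK; exact: is_deriveN.
  have := is_deriveM (is_deriveX j dV) dE; congr (is_derive _ _ _ _).
  rewrite /flat t0; set e := expR _; set x := t^-1.
  have -> : t ^- 2 = x ^+ 2 by rewrite /x exprVn.
  rewrite /GRing.scale/= !fctE -/x -/e.
  case: j {g dV dE} => [|j]; first by rewrite !expr0 /=; ring.
  by rewrite /= !exprS; ring.
- apply: (near_eq_is_derive (f := cst 0)).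
    near=> y; rewrite /flat ifF//; apply/negbTE; rewrite -leNgt ltW//.
    by near: y; exact: lt_nbhsl.
  rewrite /flat ltNge (ltW t0)/= mulr0 addr0; exact: is_derive_cst.
- rewrite {2 3}/flat ltxx mulr0 addr0.
  suff cv : h^-1 *: ((flat j \o shift 0) (h *: (1 : R)) - flat j 0) @[h --> (0:R)^'] --> (0 : R).
    by split; [apply/cvg_ex; exists 0|apply: cvg_lim].
  apply/cvgrPdist_le => e e0; near=> h.
  have h0 : h != 0 by near: h; exact: nbhs_dnbhs_neq.
  rewrite sub0r normrN /= {2}/flat ltxx subr0 addr0.
  rewrite -[h *: 1]/(h * 1) mulr1 -[_ *: _]/(h^-1 * flat j h) normrM normfV.
  rewrite (ger0_norm (flat_ge0 _ _)) mulrC ler_pdivrMr ?normr_gt0//.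
  apply: le_trans (flat_le j h) _; rewrite -real_normK ?num_real// expr2 mulrA.
  rewrite ler_wpM2r// -ler_pdivlMl ?ltr0n ?fact_gt0//.
  near: h; apply: (@dnbhs0_le _ R).
  by rewrite mulr_gt0// invr_gt0 ltr0n fact_gt0.
Unshelve. all: by end_near. Qed.

Lemma continuous_flat j : continuous (flat j).
Proof.
by move=> t; apply: differentiable_continuous; apply/derivable1_diffP; case: (is_derive_flat j t).
Qed.

Lemma Ck_flat n k j (i : 'I_n) (c d : R) :
  Ck k (fun x : 'rV[R]_n => flat j (c * x 0 i + d)).
Proof.
have cf j' : continuous (fun x : 'rV[R]_n => flat j' (c * x 0 i + d)).
  move=> x; apply: (@continuous_comp _ _ _ (fun x : 'rV[R]_n => c * x 0 i + d) (flat j')).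
    apply: continuousD; last exact: cst_continuous.
    by apply: continuousM; [exact: cst_continuous|exact: coord_continuous].
  exact: continuous_flat.
elim: k j => [|k IH] j; split=> // i'.
pose df (t : R) := - j%:R * flat j.+1 t + flat j.+2 t.
exists (fun x => (c * (i' == i)%:R) * df (c * x 0 i + d)) => [x|].
  apply/is_derive_line0; rewrite (_ : (fun h => _) =
    flat j \o (fun h : R => (c * (i' == i)%:R) * h + (c * x 0 i + d))); last first.
    by apply/funext => h /=; rewrite !mxE eqxx/= eq_sym; congr flat; ring.
  rewrite [X in is_derive _ _ _ X]mulrC; apply: is_derive1_comp.
    by rewrite mulr0 add0r; exact: is_derive_flat.
  rewrite -[X in is_derive _ _ _ X]addr0; apply: is_deriveD.
  have := is_deriveZ (c * (i' == i)%:R) (is_derive_id (0 : R) 1).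
  by rewrite -[_ *: 1]/(_ * 1) mulr1.
apply: Ck_mul; first exact: Ck_cst.
rewrite /df; apply: Ck_add; last exact: IH.
by apply: Ck_mul; [exact: Ck_cst|exact: IH].
Qed.

Definition box_bump n (a b x : 'rV[R]_n) : R :=
  \prod_(i < n) (flat 0 (x 0 i - a 0 i) * flat 0 (b 0 i - x 0 i)).

Lemma smooth_bump n (a b : 'rV[R]_n) : smooth (box_bump a b).
Proof.
apply: smooth_prod => i; apply: smoothM; apply/smoothP => k.
  have := Ck_flat k 0 i 1 (- a 0 i); congr Ck; apply/funext => x; congr flat; ring.
have := Ck_flat k 0 i (- 1) (b 0 i); congr Ck; apply/funext => x; congr flat; ring.
Qed.

Lemma flat0_le1 t : flat 0 t <= 1.
Proof.
rewrite /flat; case: ifPn => // t0; rewrite expr0 mul1r -expR0 ler_expR.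
by rewrite oppr_le0 invr_ge0 ltW.
Qed.

Lemma bump_ge0 n (a b x : 'rV[R]_n) : 0 <= box_bump a b x.
Proof. by apply: prodr_ge0 => i _; rewrite mulr_ge0// flat_ge0. Qed.

Lemma bump_le1 n (a b x : 'rV[R]_n) : box_bump a b x <= 1.
Proof.
by apply: prodr_ile1 => i _; rewrite mulr_ge0 ?flat_ge0//= mulr_ile1 ?flat_ge0 ?flat0_le1.
Qed.

Lemma bump_gt0 n (a b x : 'rV[R]_n) : obox a b x -> 0 < box_bump a b x.
Proof.
move=> abx; apply: prodr_gt0 => i _; have /andP[ax xb] := abx i.
by rewrite mulr_gt0// /flat subr_gt0 ?ax ?xb expr0 mul1r expR_gt0.
Qed.

Lemma bump_eq0 n (a b x : 'rV[R]_n) : ~ obox a b x -> box_bump a b x = 0.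
Proof.
move=> nx; apply/eqP; rewrite prodf_seq_eq0; apply/hasP.
have /existsNP[i /negP nxi] := nx; exists i; first exact: mem_index_enum.
move: nxi; rewrite /= negb_and mulf_eq0 /flat !subr_gt0.
by move=> /orP[/negbTE->|/negbTE->]; rewrite eqxx ?orbT.
Qed.

Lemma test_function_bump n (a b : 'rV[R]_n) (D : set 'rV[R]_n) :
  cbox a b `<=` D -> test_function D (box_bump a b).
Proof.
move=> abD; split; first exact: smooth_bump.
exists (cbox a b); split => //; first exact: compact_cbox.
by move=> x nx; apply: bump_eq0 => /obox_sub_cbox.
Qed.

End flat_function.

(** * Integrals of real functions *)

Section real_integrable.
Context d (T : measurableType d) {R : realType}.
Variable mu : {measure set T -> \bar R}.
Implicit Types (D : set T) (f g : T -> R).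
Local Notation rint D f := (mu.-integrable D (EFin \o f)).

Lemma rint_measurable D f : rint D f -> measurable_fun D f.
Proof. by move=> /(measurable_int mu)/measurable_EFinP. Qed.

Lemma rintD D f g : measurable D -> rint D f -> rint D g -> rint D (fun x => f x + g x).
Proof. by move=> mD intf intg; exact: (integrableD mD intf intg). Qed.

Lemma rintB D f g : measurable D -> rint D f -> rint D g -> rint D (fun x => f x - g x).
Proof. by move=> mD intf intg; exact: (integrableB mD intf intg). Qed.

Lemma rintZ D f (c : R) : measurable D -> rint D f -> rint D (fun x => c * f x).
Proof. by move=> mD intf; exact: (integrableZl mD c intf). Qed.

Lemma rint_le D f g : measurable D -> measurable_fun D f -> rint D g ->
  (forall x, D x -> `|f x| <= g x) -> rint D f.
Proof.
move=> mD mf intg fg; apply: (le_integrable mD _ _ intg); first exact/measurable_EFinP.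
by move=> x Dx /=; rewrite lee_fin (le_trans (fg _ Dx))// ler_norm.
Qed.

Lemma rint_abs D f : measurable D -> rint D f -> rint D (fun x => `|f x|).
Proof. by move=> mD intf; exact: (integrable_abse intf). Qed.

Lemma rint_mulb D f g (C : R) : measurable D -> rint D f -> measurable_fun D g ->
  (forall x, D x -> `|g x| <= C) -> rint D (fun x => g x * f x).
Proof.
move=> mD intf mg gC; apply: (rint_le (g := fun x => C * `|f x|)) => //.
- by apply: measurable_funM => //; exact: rint_measurable.
- by apply: rintZ => //; exact: rint_abs.
- by move=> x Dx; rewrite normrM ler_wpM2r// gC.
Qed.

Lemma rint_indic D (A : set T) : measurable D -> measurable A -> (mu A < +oo)%E ->
  rint D \1_A.
Proof.
move=> mD mA fA; apply/integrableP; split.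
  by apply/measurable_EFinP; exact: measurable_indic.
rewrite (_ : (fun x => _) = EFin \o \1_A).
  rewrite integral_indic//; apply: le_lt_trans fA.
  by apply: le_measure; rewrite ?inE//; exact: measurableI.
by apply/funext => x /=; rewrite indicE; case: (x \in A); rewrite ?normr1 ?normr0.
Qed.

Lemma rint_cst D (c : R) : measurable D -> (mu D < +oo)%E -> rint D (fun=> c).
Proof.
move=> mD fD; apply: (rint_le (g := fun x => `|c| * \1_D x)) => //.
  by apply: rintZ => //; exact: rint_indic.
by move=> x Dx; rewrite indicE mem_set// mulr1.
Qed.

Lemma EFin_Rintegral D f : measurable D -> rint D f ->
  (\int[mu]_(x in D) f x)%:E = (\int[mu]_(x in D) (f x)%:E)%E.
Proof. by move=> mD intf; rewrite /Rintegral fineK//; exact: integrable_fin_num. Qed.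

Lemma rint_dominated D (f_ : nat -> T -> R) f g : measurable D ->
  (forall k, measurable_fun D (f_ k)) -> measurable_fun D f ->
  (forall x, D x -> f_ ^~ x @ \oo --> f x) -> rint D g ->
  (forall k x, D x -> `|f_ k x| <= g x) ->
  \int[mu]_(x in D) f_ k x @[k --> \oo] --> \int[mu]_(x in D) f x.
Proof.
move=> mD mf_ mf f_f intg f_g.
have intf_ k : rint D (f_ k) by apply: rint_le intg _ => // x; exact: f_g.
have [] := @dominated_convergence _ _ _ mu D mD
  (fun k => EFin \o f_ k) (EFin \o f) (EFin \o g).
- by move=> k; exact/measurable_EFinP.
- exact/measurable_EFinP.
- apply: nearW => x Dx; apply: cvg_EFin; first exact: nearW.
  exact: f_f.
- by [].
- by apply: nearW => x k Dx /=; rewrite lee_fin; exact: f_g.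
move=> intf _; rewrite /= -(EFin_Rintegral mD intf) => /fine_cvg; exact.
Qed.

End real_integrable.

(** * Integration by parts *)

Section integration_by_parts.
Context {R : realType} {n : nat}.
Local Notation mu := (@lebesgue_rV R n).
Implicit Types (D : set 'rV[R]_n).

Lemma coord_le_norm (x : 'rV[R]_n) i : `|x 0 i| <= `|x|.
Proof.
rewrite [leRHS]mx_normrE.
exact: (le_bigmax _ (fun ij : 'I_1 * 'I_n => `|x ij.1 ij.2|) (0, i)).
Qed.

Lemma measurable_norm_le (M : R) : measurable [set x : 'rV[R]_n | (`|x| <= M)%R].
Proof.
rewrite (_ : mkset _ = [set: 'rV[R]_n] `&` (fun x : 'rV[R]_n => `|x|) @^-1` `]-oo, M]%classic).
  apply: (@continuous_measurable_rV R n setT (fun x : 'rV[R]_n => `|x|)) => //.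
  by move=> x; exact: norm_continuous.
by apply/seteqP; split => x /=; rewrite in_itv/=; [|case].
Qed.

Lemma norm_le_lty (M : R) : (mu [set x : 'rV[R]_n | (`|x| <= M)%R] < +oo)%E.
Proof.
apply: le_lt_trans (lebesgue_obox_lty (const_mx (- M - 1)) (const_mx (M + 1))).
apply: le_measure; rewrite ?inE.
- exact: measurable_norm_le.
- exact: measurable_obox.
- move=> x /= xM i; rewrite !mxE.
  by have := le_trans (coord_le_norm x i) xM; rewrite ler_norml => /andP[? ?]; apply/andP; split; lra.
Qed.

Lemma bounded_le D : bounded_set D -> exists2 M : R, 0 < M & forall x, D x -> `|x| <= M.
Proof.
move=> [M0 [_ bD]]; exists (`|M0| + 1); first by rewrite ltr_wpDl.
by apply: bD; rewrite (le_lt_trans (ler_norm _))// ltrDl.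
Qed.

Lemma bounded_lebesgue_lty D : measurable D -> bounded_set D -> (mu D < +oo)%E.
Proof.
move=> mD /bounded_le[M M0 DM]; apply: le_lt_trans (norm_le_lty M).
by apply: le_measure; rewrite ?inE//; exact: measurable_norm_le.
Qed.

Lemma bounded_support_integrable D (h : 'rV[R]_n -> R) (M C : R) : measurable D ->
  measurable_fun D h -> (forall x, D x -> M < `|x| -> h x = 0) ->
  (forall x, D x -> `|h x| <= C) -> mu.-integrable D (EFin \o h).
Proof.
move=> mD mh h0 hC.
pose B := [set x : 'rV[R]_n | (`|x| <= M)%R].
have mB : measurable B by exact: measurable_norm_le.
apply: (rint_le (g := fun x => `|C| * \1_B x)) => //.
  by apply: rintZ => //; apply: rint_indic => //; exact: norm_le_lty.
move=> x Dx; rewrite indicE; case: (boolP (x \in B)) => [_|].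
  by rewrite mulr1 (le_trans (hC _ Dx))// ler_norm.
by rewrite mulr0 notin_setE /B/= => /negP; rewrite -ltNge => /(h0 _ Dx) ->; rewrite normr0.
Qed.

Lemma norm_delta_le1 (i : 'I_n) : `|delta_mx 0 i : 'rV[R]_n| <= 1.
Proof.
rewrite [leLHS]mx_normrE; apply/bigmax_leP; split => // -[a b] _ /=.
by rewrite mxE; case: (_ && _); rewrite ?normr1 ?normr0.
Qed.

(** The difference quotients of h in a coordinate direction have integral zero
    by translation invariance, and they converge boundedly to the derivative. *)
Lemma integral_partial0 (h dh : 'rV[R]_n -> R) (i : 'I_n) (M C : R) :
  measurable_fun [set: 'rV[R]_n] h -> measurable_fun [set: 'rV[R]_n] dh ->
  (forall x, is_derive x (delta_mx 0 i) h (dh x)) ->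
  (forall x, M < `|x| -> h x = 0) ->
  (forall x, `|h x| <= C) -> (forall x, `|dh x| <= C) ->
  \int[mu]_x dh x = 0.
Proof.
move=> mh mdh hdh h0 hC dhC.
have hint : mu.-integrable setT (EFin \o h).
  by apply: (bounded_support_integrable (M := M) (C := C)) => // x _; exact: h0.
pose e : 'rV[R]_n := delta_mx 0 i.
pose s (k : nat) : R := k.+1%:R^-1.
pose q k x : R := (s k)^-1 * (h (x + s k *: e) - h x).
have s0 k : 0 < s k by rewrite /s invr_gt0.
have s1 k : s k <= 1 by rewrite /s invf_le1// ler1n.
have mhs k : measurable_fun [set: 'rV[R]_n] (fun x => h (x + s k *: e)).
  exact: (measurableT_comp mh (measurable_addr_rV _)).
have far k x : M + 1 < `|x| -> M < `|x + s k *: e|.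
  have := ler_normB (x + s k *: e) (s k *: e); rewrite addrK.
  have : `|s k *: e| <= 1.
    by rewrite normrZ gtr0_norm// mulr_ile1 ?(ltW (s0 k))// norm_delta_le1.
  by lra.
have hsint k : mu.-integrable setT (EFin \o (fun x => h (x + s k *: e))).
  apply: (bounded_support_integrable (M := M + 1) (C := C)) => // x _ Mx.
  by apply: h0; exact: far.
have mq k : measurable_fun [set: 'rV[R]_n] (q k).
  by apply: measurable_funM => //; exact: measurable_funB.
have q0 k : \int[mu]_x q k x = 0.
  rewrite RintegralZl//; last exact: rintB.
  rewrite RintegralB// /Rintegral.
  have := integral_translation (s k *: e) (measurable_int mu hint).
  by rewrite /= => ->; rewrite subrr mulr0.
pose B := [set x : 'rV[R]_n | (`|x| <= M + 1)%R].
have /(_ q dh (fun x => C * \1_B x)) c0 := @rint_dominated _ _ _ mu setT.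
have {c0} : \int[mu]_x q k x @[k --> \oo] --> \int[mu]_x dh x.
  apply: c0 => //.
  - move=> x _.
    have [/cvg_ex[l hl] <-] := hdh x; have -> : 'D_(delta_mx 0 i) h x = l by exact: cvg_lim hl.
    have sl : (forall k, s k != 0) /\ s @ \oo --> (0 : R).
      by split => [k|]; [rewrite gt_eqF|exact: cvg_harmonic].
    move/cvgr_dnbhsP : hl => /(_ s sl) hl.
    by under [X in X @ _ --> _]eq_fun do rewrite /q (addrC x).
  - by apply: rintZ => //; apply: rint_indic => //; [exact: measurable_norm_le|exact: norm_le_lty].
  - move=> k x _; rewrite indicE; case: (boolP (x \in B)) => [_|].
      rewrite mulr1 /q normrM gtr0_norm ?invr_gt0// mulrC ler_pdivrMr//.
      have := derive_increment (V := 'rV[R]_n) x (ltW (s0 k)) hdh dhC.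
      by rewrite (addrC x).
    rewrite mulr0 notin_setE /B/= => /negP; rewrite -ltNge => Mx.
    by rewrite /q h0 ?far// h0 ?subr0 ?mulr0 ?normr0//; lra.
under eq_fun do rewrite q0.
by move=> c0; exact: (cvg_unique _ c0 (cvg_cst _)).
Qed.

End integration_by_parts.

(** * The fundamental lemma of the calculus of variations *)

Section fundamental_lemma.
Context {R : realType} {n : nat}.
Local Notation mu := (@lebesgue_rV R n).
Implicit Types (D : set 'rV[R]_n) (g : 'rV[R]_n -> R).

Lemma mul_indic_restrict (g : 'rV[R]_n -> R) A x : g x * \1_A x = (g \_ A) x.
Proof. by rewrite indicE /patch; case: ifPn; rewrite ?mulr1 ?mulr0. Qed.

Lemma Rintegral_restrict D A g : D `<=` A ->
  \int[mu]_(x in D) g x = \int[mu]_(x in A) (g \_ D) x.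
Proof.
by move=> DA; rewrite -Rintegral_mkcondr; congr Rintegral; apply/seteqP; split=> x; [split=> //; exact: DA|case].
Qed.

(** The sets over which the integral of g vanishes form a lambda-system that
    contains the boxes. *)
Lemma box_integrals_ae0 g : mu.-integrable setT (EFin \o g) ->
  \int[mu]_x g x = 0 ->
  (forall a b, \int[mu]_(x in obox a b) g x = 0) -> ae_eq mu setT (EFin \o g) (cst 0%E).
Proof.
move=> intg g0 gbox.
pose H := [set A : set 'rV[R]_n | measurable A /\ \int[mu]_(x in A) g x = 0].
have gA (A : set 'rV[R]_n) : measurable A -> mu.-integrable A (EFin \o g).
  by move=> mA; exact: (integrableS (E := setT)).
have HA (A : set 'rV[R]_n) : measurable A -> \int[mu]_(x in A) g x = 0.
  suff /(_ A) : @measurable _ 'rV[R]_n `<=` H by move=> h /h[].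
  rewrite measurable_rVE; apply: (lambda_system_subset setI_closed_obox) => //.
    split => //.
    - move=> B C CB [mB B0] [mC C0]; split; first exact: measurableD.
      have := @Rintegral_setU _ _ _ mu (B `\` C) C g (measurableD mB mC) mC.
      rewrite setUC setDUK// C0 B0 addr0 => <-//; first exact: gA.
      by apply/disj_setPS => x [[]].
    - move=> F ndF HF; split; first by apply: bigcup_measurable => k _; case: (HF k).
      have mU : measurable (\bigcup_i F i) by apply: bigcup_measurable => k _; case: (HF k).
      have c : \int[mu]_x (g \_ (F k)) x @[k --> \oo] --> \int[mu]_x (g \_ (\bigcup_i F i)) x.
        apply: (rint_dominated (g := fun x => `|g x|)) => //.
        + by move=> k; apply/measurable_restrict => //; rewrite ?setTI; [case: (HF k)|exact: (rint_measurable (gA _ (HF k).1))].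
        + by apply/measurable_restrict => //; rewrite setTI; exact: (rint_measurable (gA _ mU)).
        + move=> x _; have [[N _ FNx]|nx] := pselect ((\bigcup_i F i) x); last first.
            rewrite (_ : (fun k => _) = fun=> 0); last first.
              apply/funext => k; rewrite /patch memNset// => Fx; apply: nx; by exists k.
            by rewrite /patch memNset//; exact: cvg_cst.
          apply: cvg_near_cst; exists N => // k /= Nk.
          rewrite /patch !mem_set//; first by exists N.
          by move: x FNx; apply/subsetPset/ndF.
        + exact: rint_abs.
        + by move=> k x _; rewrite /patch; case: ifPn => //; rewrite normr0.
      rewrite (Rintegral_restrict g (subsetT _)).
      have {}c : (fun=> 0 : R) @ \oo --> \int[mu]_x (g \_ (\bigcup_i F i)) x.
        move: c; rewrite (_ : (fun k => _) = fun=> 0)//; apply/funext => k.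
        by rewrite -(Rintegral_restrict g (subsetT _)); case: (HF k).
      exact: (cvg_unique _ c (cvg_cst _)).
  by move=> _ [a [b ->]]; split; [exact: measurable_obox|exact: gbox].
have mg : measurable_fun [set: 'rV[R]_n] g := rint_measurable intg.
have mP : measurable [set x | 0 <= g x].
  rewrite -[X in measurable X]setTI (_ : mkset _ = g @^-1` `[0, +oo[%classic); first exact: mg.
  by apply/seteqP; split => x; rewrite /= in_itv/= andbT.
apply/(ae_eq_integral_abs mu measurableT); first exact/measurable_EFinP.
have i0 : \int[mu]_x `|g x| = 0.
  have intn : mu.-integrable [set: 'rV[R]_n] (EFin \o (fun x => `|g x|)) by exact: rint_abs.
  have intnS (A : set 'rV[R]_n) : measurable A -> mu.-integrable A (EFin \o ((fun x => `|g x|))).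
    by move=> mA; exact: (integrableS (E := setT)).
  rewrite -(setvU [set x | 0 <= g x]) Rintegral_setU//; last 3 first.
  - exact: measurableC.
  - by apply: intnS; exact: measurableU (measurableC mP) mP.
  - by apply/disj_setPS => x [].
  rewrite [X in _ + X](eq_Rintegral _ (g := g)); last by move=> x /set_mem/= gx; rewrite ger0_norm.
  rewrite [X in X + _](eq_Rintegral _ (g := fun x => (-1) * g x)); last first.
    by move=> x /set_mem/= /negP; rewrite -ltNge mulN1r => gx; rewrite ltr0_norm.
  have mP' := measurableC mP.
  by rewrite RintegralZl ?(HA _ mP) ?(HA _ mP') ?mulr0 ?addr0//; exact: gA.
by rewrite -[RHS]/(0%:E) -i0 EFin_Rintegral//; exact: rint_abs.
Qed.

(** The powers 1 - (1 - box_bump)^k are test functions that increase to the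
    indicator function of the box. *)
Lemma test_orthogonal_box D g (a b : 'rV[R]_n) : L1loc D g ->
  (forall phi, test_function D phi -> \int[mu]_(x in D) (g x * phi x) = 0) ->
  measurable D -> cbox a b `<=` D -> \int[mu]_(x in obox a b) g x = 0.
Proof.
move=> [mg gK] gphi mD abD.
have mK : measurable (cbox a b) by apply: compact_measurable_rV; exact: compact_cbox.
have QD : obox a b `<=` D by move=> x /obox_sub_cbox/abD.
pose phi k x := 1 - (1 - box_bump a b x) ^+ k.
have tphi k : test_function D (phi k).
  have [sb [K [cK KD b0]]] := test_function_bump abD; split.
    have s1 (c : R) : smooth (fun x : 'rV[R]_n => 1 + c * box_bump a b x).
      exact: (smoothD (smooth_cst 1) (smoothM (smooth_cst c) sb)).
    apply: smooth_ext (smoothD (smooth_cst 1) (smoothM (smooth_cst (-1)) (smoothX k (s1 (-1))))) => x.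
    by rewrite /phi !mulN1r.
  by exists K; split => // x /b0; rewrite /phi => ->; rewrite subr0 expr1n subrr.
have ph01 k x : 0 <= phi k x <= 1.
  rewrite /phi subr_ge0 gerBl exprn_ge0 ?subr_ge0 ?bump_le1// andbT.
  by rewrite exprn_ile1// ?subr_ge0 ?bump_le1// gerBl bump_ge0.
have mQ := measurable_obox a b.
have c0 : \int[mu]_(x in D) (g x * phi k x) @[k --> \oo] --> \int[mu]_(x in D) (g \_ (obox a b)) x.
  apply: (rint_dominated (g := fun x => `|(g \_ (cbox a b)) x|)) => //.
  - move=> k; apply: measurable_funM => //; apply: continuous_measurable_rV.
    by apply: smooth_continuous; case: (tphi k).
  - by apply/measurable_restrict => //; exact: measurable_funS mg.
  - move=> x Dx; rewrite -mul_indic_restrict.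
    apply: cvgM; first exact: cvg_cst.
    rewrite indicE; case: (boolP (x \in obox a b)) => [/set_mem xQ|].
      rewrite -[X in _ --> X]subr0; apply: cvgB; first exact: cvg_cst.
      apply: cvg_expr; rewrite ger0_norm ?subr_ge0 ?bump_le1// gtrBl.
      exact: bump_gt0.
    rewrite notin_setE => xQ; under eq_fun do rewrite /phi bump_eq0// subr0 expr1n subrr.
    exact: cvg_cst.
  - apply: rint_abs => //.
    have := gK _ (@compact_cbox _ _ a b) abD.
    by rewrite -[X in integrable _ X](setIidr abD) integrable_restrict// restrict_EFin.
  - move=> k x Dx /=; rewrite /patch; case: ifPn => [_|].
      by have /andP[? ?] := ph01 k x; rewrite normrM [X in _ * X]ger0_norm// ler_piMr.
    rewrite notin_setE => xK; rewrite /phi bump_eq0; last by move/obox_sub_cbox.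
    by rewrite subr0 expr1n subrr mulr0.
rewrite (Rintegral_restrict g QD).
move: c0; under eq_fun do rewrite gphi//.
by move=> c0; exact: (cvg_unique _ c0 (cvg_cst _)).
Qed.

(** The fundamental lemma of the calculus of variations: an open set is a
    countable union of boxes whose closures it contains. *)
Lemma test_orthogonal_ae0 D g : open D -> L1loc D g ->
  (forall phi, test_function D phi -> \int[mu]_(x in D) (g x * phi x) = 0) ->
  ae_eq mu D g (cst 0).
Proof.
move=> oD gD gphi; have mD := open_measurable_rV oD.
have box0 (a b : 'rV[R]_n) : cbox a b `<=` D -> mu.-negligible (~` [set x | obox a b x -> g x = 0]).
  move=> abD; have mQ := measurable_obox a b.
  have QD : obox a b `<=` D by move=> x /obox_sub_cbox/abD.
  have intQ : mu.-integrable (obox a b) (EFin \o g).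
    apply: integrableS (obox_sub_cbox (a := a) (b := b)) _ => //.
      by apply: compact_measurable_rV; exact: compact_cbox.
    by apply: gD.2 => //; exact: compact_cbox.
  suff : ae_eq mu setT (EFin \o (g \_ (obox a b))) (cst 0%E).
    apply: negligibleS => x /= nx; apply: contra_not nx => nx Qx.
    by have [] := nx I; rewrite /patch mem_set.
  apply: box_integrals_ae0.
  - by rewrite -restrict_EFin -integrable_restrict// setTI.
  - by rewrite -Rintegral_restrict//; exact: test_orthogonal_box gphi mD abD.
  - move=> c d; rewrite -Rintegral_mkcondr oboxI.
    apply: (test_orthogonal_box gD gphi mD) => x xI; apply: abD => i.
    by have := xI i; rewrite !mxE ge_max le_min => /andP[/andP[_ ->] /andP[_ ->]].
pose Q k := if unpickle k is Some q then
  let a := \row_i ratr ((q : {ffun 'I_n -> rat * rat}) i).1 in let b := \row_i ratr (q i).2 in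
  if `[< cbox a b `<=` D >] then ~` [set x | obox a b x -> g x = 0] else set0 else set0.
have : mu.-negligible (\bigcup_k Q k).
  apply: negligible_bigcup => k; rewrite /Q; case: unpickle => [q|]; last exact: negligible_set0.
  by case: asboolP => [|_]; [exact: box0|exact: negligible_set0].
apply: negligibleS => x /= nx; have /not_implyP[Dx gx] := nx.
move: Dx; rewrite {1}(open_bigcup_obox oD) => -[q /= qD qx].
exists (pickle q) => //; rewrite /Q pickleK asboolT//=.
by move/(_ qx).
Qed.

End fundamental_lemma.

(** * Weak gradients *)

Section weak_gradient.
Context {R : realType} {n : nat}.
Local Notation mu := (@lebesgue_rV R n).
Implicit Types (D : set 'rV[R]_n) (u phi : 'rV[R]_n -> R).

Definition nabla u : 'rV[R]_n -> 'rV[R]_n := fun x => \row_i partial i u x.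

Lemma continuous_compact_bounded (K : set 'rV[R]_n) u : compact K -> continuous u ->
  exists2 C : R, 0 <= C & forall x, K x -> `|u x| <= C.
Proof.
move=> cK cu; have [K0|K0] := pselect (K !=set0); last first.
  by exists 0 => // x Kx; exfalso; apply: K0; exists x.
have cu' : {within K, continuous (fun x => `|u x|)}.
  apply: continuous_subspaceT => x; apply: continuous_comp; first exact: cu.
  exact: norm_continuous.
have [c _ cmax] := compact_EVT_max K0 cK cu'.
by exists `|u c| => // x Kx; apply: cmax; rewrite inE.
Qed.

Lemma partial_support (K : set 'rV[R]_n) u i : closed K -> (forall x, ~ K x -> u x = 0) ->
  forall x, ~ K x -> partial i u x = 0.
Proof.
move=> cK u0 x Kx; apply: partialE; apply: (near_eq_is_derive (f := cst 0)).
  have oK : open (~` K) by exact: closed_openC.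
  have := open_nbhs_nbhs (conj oK Kx).
  by apply: filterS => y /u0.
Qed.

Lemma test_function_smooth D phi : test_function D phi -> smooth phi.
Proof. by case. Qed.

Lemma test_function_partial D phi i : test_function D phi -> test_function D (partial i phi).
Proof.
move=> [sphi [K [cK KD phi0]]]; split; first exact: smooth_partial.
exists K; split => //; apply: partial_support => //.
by apply: compact_closed => //; exact: norm_hausdorff.
Qed.

Lemma test_function_out D phi x : test_function D phi -> ~ D x -> phi x = 0.
Proof. by move=> [_ [K [_ KD phi0]]] Dx; apply: phi0 => /KD. Qed.

Lemma test_function_bounded D phi : test_function D phi ->
  exists2 C : R, 0 <= C & forall x, `|phi x| <= C.
Proof.
move=> [sphi [K [cK KD phi0]]].
have [C C0 phiC] := continuous_compact_bounded cK (smooth_continuous sphi).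
exists C => // x; have [/phiC//|/phi0->] := pselect (K x); by rewrite normr0.
Qed.

Lemma test_function_support_bounded D phi : test_function D phi ->
  exists M : R, forall x, M < `|x| -> phi x = 0.
Proof.
move=> [sphi [K [cK KD phi0]]]; have [M M0 KM] := bounded_le (compact_bounded cK).
by exists M => x Mx; apply: phi0 => /KM; rewrite leNgt Mx.
Qed.

Lemma smooth_measurable D u : smooth u -> measurable_fun D u.
Proof. by move=> su; apply: continuous_measurable_rV; exact: smooth_continuous. Qed.

Lemma L1loc_test_integrable D u phi : measurable D -> L1loc D u -> test_function D phi ->
  mu.-integrable D (EFin \o (fun x => u x * phi x)).
Proof.
move=> mD [mu_ uK] tphi; have [sphi [K [cK KD phi0]]] := tphi.
have [C C0 phiC] := test_function_bounded tphi.
have uKD : mu.-integrable D (EFin \o (u \_ K)).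
  rewrite -restrict_EFin -integrable_restrict//; last exact: compact_measurable_rV.
  by rewrite setIidr//; exact: uK.
have := rint_mulb mD uKD (smooth_measurable sphi) (fun x _ => phiC x).
congr (integrable _ _ _); apply/funext => x; congr EFin.
rewrite mulrC /patch; case: ifPn => //.
by rewrite notin_setE => /phi0 ->; rewrite !mulr0.
Qed.

Lemma L1locB D u v : measurable D -> L1loc D u -> L1loc D v -> L1loc D (fun x => u x - v x).
Proof.
move=> mD [mu_ uK] [mv vK]; split; first exact: measurable_funB.
by move=> K cK KD; apply: rintB; [exact: compact_measurable_rV|exact: uK|exact: vK].
Qed.

(** The fundamental lemma, applied to each coordinate of the difference. *)
Lemma weak_gradient_unique D u g h : open D ->
  is_weak_gradient D u g -> is_weak_gradient D u h ->
  forall i, ae_eq mu D (fun x => g x 0 i) (fun x => h x 0 i).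
Proof.
move=> oD [_ gL gE] [_ hL hE] i; have mD := open_measurable_rV oD.
have : ae_eq mu D (fun x => g x 0 i - h x 0 i) (cst 0).
  apply: test_orthogonal_ae0 => //; first exact: L1locB.
  move=> phi tphi; under eq_Rintegral do rewrite mulrBl.
  rewrite RintegralB//; [|exact: L1loc_test_integrable..].
  by apply/eqP; rewrite subr_eq0 -eqr_opp -gE// -hE.
by apply: filterS => x /= + Dx => /(_ Dx)/eqP; rewrite subr_eq0 => /eqP.
Qed.

Lemma weak_gradientB D u v g h : measurable D ->
  is_weak_gradient D u g -> is_weak_gradient D v h ->
  is_weak_gradient D (fun x => u x - v x) (fun x => g x - h x).
Proof.
move=> mD [uL gL gE] [vL hL hE]; split; first exact: L1locB.
  by move=> i; under eq_fun do rewrite mxE [X in _ + X]mxE; exact: L1locB.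
move=> phi tphi i; have tdphi := test_function_partial i tphi.
under eq_Rintegral do rewrite mulrBl.
rewrite RintegralB//; [|exact: L1loc_test_integrable..].
rewrite gE// hE// -opprB opprK; apply/eqP; rewrite eqr_opp addrC; apply/eqP.
rewrite -RintegralB//; [|exact: L1loc_test_integrable..].
by apply: eq_Rintegral => x _; rewrite !mxE; ring.
Qed.

Lemma continuous_L1loc D u : measurable D -> continuous u -> L1loc D u.
Proof.
move=> mD cu; split; first exact: continuous_measurable_rV.
move=> K cK KD; have mK := compact_measurable_rV cK.
have [C C0 uC] := continuous_compact_bounded cK cu.
apply: (rint_le (g := cst C)) => //; first exact: continuous_measurable_rV.
by apply: rint_cst => //; apply: bounded_lebesgue_lty => //; exact: compact_bounded.
Qed.

(** The integral of the i-th partial derivative of u phi vanishes. *)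
Lemma smooth_weak_gradient D u : measurable D -> smooth u -> is_weak_gradient D u (nabla u).
Proof.
move=> mD su; split.
- by apply: continuous_L1loc => //; exact: smooth_continuous.
- move=> i; under eq_fun do rewrite mxE.
  by apply: continuous_L1loc => //; apply/smooth_continuous/smooth_partial.
move=> phi tphi i; under [X in _ = - X]eq_Rintegral do rewrite mxE.
have sphi := test_function_smooth tphi; have tdphi := test_function_partial i tphi.
have uL : L1loc D u by apply: continuous_L1loc => //; exact: smooth_continuous.
have duL : L1loc D (partial i u).
  by apply: continuous_L1loc => //; apply/smooth_continuous/smooth_partial.
apply/eqP; rewrite -addr_eq0 -RintegralD//; [|exact: L1loc_test_integrable..].
have tw : test_function D (fun x => u x * phi x).
  split; first exact: smoothM.
  have [_ [K [cK KD phi0]]] := tphi; exists K; split => // x /phi0 ->; exact: mulr0.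
have [M wM] := test_function_support_bounded tw.
have [C C0 wC] := test_function_bounded tw.
have [C' C'0 dwC] := test_function_bounded (test_function_partial i tw).
apply/eqP; rewrite Rintegral_mkcond.
rewrite (_ : _ \_ D = partial i (fun x => u x * phi x)); last first.
  apply/funext => x; rewrite /patch; case: ifPn => [_|].
    by rewrite partialM// [X in _ + X]mulrC.
  rewrite notin_setE => Dx; exact/esym/(test_function_out (test_function_partial i tw)).
apply: (integral_partial0 (h := fun x => u x * phi x) (i := i) (M := M) (C := C + C')) => //.
- by apply: smooth_measurable; exact: smoothM.
- by apply: smooth_measurable; apply: smooth_partial; exact: smoothM.
- by move=> x; apply: smooth_is_derive; exact: smoothM.
- by move=> x; rewrite (le_trans (wC x))// lerDl.
- by move=> x; rewrite (le_trans (dwC x))// lerDr.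
Qed.

End weak_gradient.

(** * Powers and the Euclidean norm *)

Section powers.
Context {R : realType}.
Implicit Types a b t p q eps : R.

Lemma ler_powR_base p a b : 0 <= p -> 0 <= a -> a <= b -> a `^ p <= b `^ p.
Proof.
by move=> p0 a0 ab; apply: ge0_ler_powR => //; rewrite nnegrE// (le_trans a0).
Qed.

Lemma powR2_ge1 p : 0 <= p -> 1 <= 2 `^ p :> R.
Proof. by move=> p0; rewrite -[leLHS](powRr0 2) ler_powR// ler1n. Qed.

Lemma powRD_le p a b : 0 <= p -> 0 <= a -> 0 <= b ->
  (a + b) `^ p <= 2 `^ p * (a `^ p + b `^ p).
Proof.
move=> p0 a0 b0; wlog ab : a b a0 b0 / a <= b.
  by move=> h; have [/ltW|] := ltP b a; [rewrite addrC [X in _ * X]addrC|]; exact: h.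
apply: (@le_trans _ _ ((2 * b) `^ p)).
  by apply: ler_powR_base => //; [rewrite addr_ge0|lra].
by rewrite powRM// ler_wpM2l ?powR_ge0// lerDr powR_ge0.
Qed.

Lemma norm_powRD_le p a b : 0 <= p -> `|a + b| `^ p <= 2 `^ p * (`|a| `^ p + `|b| `^ p).
Proof.
move=> p0; apply: le_trans (powRD_le p0 (normr_ge0 a) (normr_ge0 b)).
by apply: ler_powR_base => //; exact: ler_normD.
Qed.

(** If a > t then a <= t (a/t)^p. *)
Lemma le_small_powR p a t : 1 <= p -> 0 <= a -> 0 < t -> a <= t + t `^ (1 - p) * a `^ p.
Proof.
move=> p1 a0 t0; have [at0|ta] := leP a t; first by rewrite ler_wpDr// mulr_ge0// powR_ge0.
apply: ler_wpDl; first exact: ltW.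
have {}a0 : 0 < a by exact: lt_trans ta.
have -> : a `^ p = a `^ (p - 1) * a.
  by rewrite -{3}[a]powRr1 ?ltW// -powRD ?subrK// (gt_eqF a0) implybT.
rewrite mulrA ler_peMl ?(ltW a0)// -(opprB p) powRN mulrC ler_pdivlMr ?powR_gt0// mul1r.
by apply: ler_powR_base; lra.
Qed.

(** Young's inequality with a small coefficient on one of the two terms. *)
Lemma young_eps p q eps : 0 < p -> 0 < q -> p^-1 + q^-1 = 1 -> 0 < eps ->
  exists2 C : R, 0 <= C & forall a b, 0 <= a -> 0 <= b ->
    a * b <= eps * a `^ p + C * b `^ q.
Proof.
move=> p0 q0 pq eps0; pose s := (eps * p) `^ p^-1.
have s0 : 0 < s by rewrite powR_gt0// mulr_gt0.
exists ((s `^ q)^-1 / q); first by rewrite !mulr_ge0 ?invr_ge0 ?powR_ge0 ?ltW.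
move=> a b a0 b0.
have -> : a * b = (s * a) * (s^-1 * b) by rewrite mulrACA divff ?mul1r// gt_eqF.
have sV0 : 0 <= s^-1 by rewrite invr_ge0 ltW.
apply: le_trans (conjugate_powR _ _ p0 q0 pq) _; [exact: mulr_ge0 (ltW _) _|exact: mulr_ge0|].
rewrite !powRM ?(ltW s0)// -powRrM mulVf ?gt_eqF// powRr1; last by rewrite mulr_ge0 ?(ltW eps0) ?(ltW p0).
rewrite -powR_inv1 ?(ltW s0)// -powRrM mulN1r powRN.
rewrite [leLHS](_ : _ = eps * a `^ p + (s `^ q)^-1 / q * b `^ q)//.
by field; rewrite !gt_eqF// powR_gt0.
Qed.

Lemma powR_small p eps : 0 < p -> 0 < eps -> exists2 d, 0 < d &
  forall a, 0 <= a -> a <= d -> a `^ p <= eps.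
Proof.
move=> p0 eps0; exists (eps `^ p^-1); first exact: powR_gt0.
move=> a a0 ad; apply: le_trans (ler_powR_base (ltW p0) a0 ad) _.
by rewrite -powRrM mulVf ?gt_eqF// powRr1// ltW.
Qed.

Lemma is_derive_norm_powR p (x : R) : 1 < p ->
  is_derive x (1 : R) (fun t : R => `|t| `^ p) (p * (x * `|x| `^ (p - 2))).
Proof.
move=> p1; have [x0|x0|<-] := ltgtP 0 x.
- apply: (near_eq_is_derive (f := (@powR R) ^~ p)).
    by near=> y; rewrite ger0_norm// ltW//; near: y; exact: lt_nbhsr.
  have := is_derive1_powR p x0; congr (is_derive _ _ _ _); congr (_ * _).
  rewrite ger0_norm ?(ltW x0)// -{2}[x]powRr1 ?(ltW x0)// -powRD; last by rewrite (gt_eqF x0) implybT.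
  by congr (_ `^ _); lra.
- apply: (near_eq_is_derive (f := (@powR R) ^~ p \o -%R)).
    by near=> y; rewrite /= ler0_norm// ltW//; near: y; exact: lt_nbhsl.
  have Nx0 : 0 < - x by rewrite oppr_gt0.
  have := is_derive1_comp (is_derive1_powR p Nx0) (is_deriveN (is_derive_id x (1 : R))).
  congr (is_derive _ _ _ _); rewrite mulrN1 -mulrN; congr (_ * _).
  rewrite ltr0_norm// -[X in X * _]opprK mulNr; congr (- _).
  rewrite -{2}[- x]powRr1 ?(ltW Nx0)// -powRD; last by rewrite (gt_eqF Nx0) implybT.
  by congr (_ `^ _); lra.
- rewrite mul0r mulr0.
  suff cv : h^-1 *: (((fun t : R => `|t| `^ p) \o shift 0) (h *: (1 : R)) - `|0 : R| `^ p)
      @[h --> (0:R)^'] --> (0 : R).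
    by split; [apply/cvg_ex; exists 0|apply: cvg_lim].
  apply/cvgrPdist_le => e e0.
  have [d d0 dP] := @powR_small (p - 1) e ltac:(lra) e0.
  near=> h; have h0 : h != 0 by near: h; exact: nbhs_dnbhs_neq.
  rewrite sub0r normrN /= addr0 -[h *: 1]/(h * 1) mulr1.
  rewrite -[_ *: _]/(h^-1 * _) normr0 powR0 ?subr0; last by rewrite gt_eqF//; lra.
  rewrite normrM normfV (ger0_norm (powR_ge0 _ _)).
  have hgt0 : 0 < `|h| by rewrite normr_gt0.
  have -> : `|h| `^ p = `|h| * `|h| `^ (p - 1) by rewrite mulr_powRB1//; lra.
  rewrite mulKf ?gt_eqF//; apply: dP => //.
  by near: h; exact: (@dnbhs0_le _ R).
Unshelve. all: by end_near. Qed.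

Lemma continuous_norm_powR p : 1 < p -> continuous (fun t : R => `|t| `^ p).
Proof.
move=> p1 t; apply: differentiable_continuous; apply/derivable1_diffP.
by case: (is_derive_norm_powR t p1).
Qed.

Lemma measurable_norm_powR d (T : measurableType d) (D : set T) (u : T -> R) p :
  measurable_fun D u -> measurable_fun D (fun x => `|u x| `^ p).
Proof.
move=> mu; apply: (measurableT_comp (measurable_powR p)).
exact: (measurableT_comp (@normr_measurable R setT)).
Qed.

End powers.

Section euclidean_norm.
Context {R : realType} {n : nat}.
Implicit Types x y : 'rV[R]_n.

Lemma enorm_ge0 x : 0 <= enorm x. Proof. exact: sqrtr_ge0. Qed.

Lemma enorm_sqr x : enorm x ^+ 2 = \sum_(i < n) x 0 i ^+ 2.
Proof. by rewrite sqr_sqrtr// sumr_ge0// => i _; exact: sqr_ge0. Qed.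

Lemma coord_le_enorm x i : `|x 0 i| <= enorm x.
Proof.
rewrite -(@ler_pXn2r _ 2)// ?nnegrE ?enorm_ge0// enorm_sqr real_normK ?num_real//.
by rewrite (bigD1 i)//= lerDl sumr_ge0// => j _; exact: sqr_ge0.
Qed.

Lemma enormZ c x : enorm (c *: x) = `|c| * enorm x.
Proof.
rewrite /enorm -sqrtr_sqr -sqrtrM ?sqr_ge0//; congr Num.sqrt.
by rewrite mulr_sumr; apply: eq_bigr => i _; rewrite mxE exprMn.
Qed.

Lemma enorm0 : enorm (0 : 'rV[R]_n) = 0.
Proof. by rewrite /enorm big1 ?sqrtr0// => i _; rewrite mxE expr0n. Qed.

Lemma enormN x : enorm (- x) = enorm x.
Proof. by rewrite -scaleN1r enormZ normrN1 mul1r. Qed.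

(** A weak form of the triangle inequality, sufficient for p-th powers. *)
Lemma enormD x y : enorm (x + y) <= 2 * Num.max (enorm x) (enorm y).
Proof.
set M := Num.max _ _.
have M0 : 0 <= M by rewrite le_max enorm_ge0.
rewrite -(@ler_pXn2r _ 2)// ?nnegrE ?enorm_ge0 ?mulr_ge0// enorm_sqr.
apply: (@le_trans _ _ (2 * enorm x ^+ 2 + 2 * enorm y ^+ 2)).
  rewrite !enorm_sqr !mulr_sumr -big_split/=; apply: ler_sum => i _; rewrite mxE.
  by have := sqr_ge0 (x 0 i - y 0 i); nra.
have : enorm x ^+ 2 <= M ^+ 2 by rewrite ler_pXn2r ?nnegrE ?enorm_ge0// le_max lexx.
have : enorm y ^+ 2 <= M ^+ 2 by rewrite ler_pXn2r ?nnegrE ?enorm_ge0// le_max lexx orbT.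
by rewrite exprMn; lra.
Qed.

Lemma enorm_powRD p x y : 0 <= p ->
  enorm (x + y) `^ p <= 2 `^ p * (enorm x `^ p + enorm y `^ p).
Proof.
move=> p0; apply: (@le_trans _ _ ((2 * Num.max (enorm x) (enorm y)) `^ p)).
  by apply: ler_powR_base; rewrite ?enorm_ge0 ?enormD.
rewrite powRM// ?le_max ?enorm_ge0// ler_wpM2l ?powR_ge0//.
by case: (leP (enorm x) (enorm y)) => _; [rewrite lerDr powR_ge0|rewrite lerDl powR_ge0].
Qed.

Lemma enorm_powRB p x y : 0 <= p ->
  enorm (x - y) `^ p <= 2 `^ p * (enorm x `^ p + enorm y `^ p).
Proof. by move=> p0; rewrite -(enormN y); exact: enorm_powRD. Qed.

Lemma enorm_le_sum x : enorm x <= \sum_(i < n) `|x 0 i|.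
Proof.
rewrite -(@ler_pXn2r _ 2)// ?nnegrE ?enorm_ge0 ?sumr_ge0// enorm_sqr.
rewrite expr2 mulr_suml; apply: ler_sum => i _.
rewrite -real_normK ?num_real// expr2 ler_wpM2l// (bigD1 i)//= lerDl sumr_ge0//.
Qed.

Lemma norm_le_enorm x : `|x| <= enorm x.
Proof.
rewrite [leLHS]mx_normrE; apply/bigmax_leP; split => [|[a b] _ /=]; first exact: enorm_ge0.
by rewrite ord1; exact: coord_le_enorm.
Qed.

Lemma enorm_le_norm x : enorm x <= n%:R * `|x|.
Proof.
apply: le_trans (enorm_le_sum x) _.
rewrite -[n in n%:R]card_ord -sum1_card natr_sum mulr_suml.
by apply: ler_sum => i _; rewrite mul1r coord_le_norm.
Qed.

Lemma continuous_enorm : continuous (@enorm R n).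
Proof.
move=> x; apply: (@continuous_comp _ _ _ (fun x => \sum_(i < n) x 0 i ^+ 2) Num.sqrt); last exact: sqrt_continuous.
suff cs (s : seq 'I_n) : continuous (fun x : 'rV[R]_n => \sum_(i <- s) x 0 i ^+ 2) by exact: cs.
elim: s => [|i s IH].
  by under eq_fun do rewrite big_nil; exact: cst_continuous.
under eq_fun do rewrite big_cons expr2.
apply: continuousD_rV => //.
by apply: continuousM_rV; exact: coord_continuous.
Qed.

Lemma measurable_enorm d (T : measurableType d) (D : set T) (g : T -> 'rV[R]_n) :
  measurable_fun D g -> measurable_fun D (fun z => enorm (g z)).
Proof.
move=> mg; apply: (measurableT_comp (f := @enorm R n)) => //.
by apply: continuous_measurable_rV; exact: continuous_enorm.
Qed.

Lemma measurable_rV_coord d (T : measurableType d) (D : set T) (g : T -> 'rV[R]_n) i :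
  measurable_fun D g -> measurable_fun D (fun z => g z 0 i).
Proof. by move=> mg; exact: (measurableT_comp (measurable_coord i)). Qed.

Lemma measurable_rVP d (T : measurableType d) (D : set T) (g : T -> 'rV[R]_n) :
  measurable D -> (forall i, measurable_fun D (fun z => g z 0 i)) -> measurable_fun D g.
Proof.
move=> mD mg.
have mgD : measurable_fun [set: T] (fun z => \row_i ((fun z => g z 0 i) \_ D) z).
  apply: measurable_fun_rVP => i; under eq_fun do rewrite mxE.
  by apply/measurable_restrict => //; rewrite setTI; exact: mg.
apply: (eq_measurable_fun (fun z => \row_i ((fun z => g z 0 i) \_ D) z)).
  by move=> z zD; apply/rowP => i; rewrite mxE /patch zD.
exact: measurable_funS mgD.
Qed.

End euclidean_norm.

Section block_norm.
Context {R : realType} {r m : nat}.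
Implicit Types x : 'rV[R]_(r + m).

Lemma enorm_split x : enorm x ^+ 2 = enorm (lsubmx x) ^+ 2 + enorm (rsubmx x) ^+ 2.
Proof.
rewrite !enorm_sqr big_split_ord/=.
by congr (_ + _); apply: eq_bigr => i _; rewrite mxE.
Qed.

Lemma enorm_rsub_le x : enorm (rsubmx x) <= enorm x.
Proof.
rewrite -(@ler_pXn2r _ 2)// ?nnegrE ?enorm_ge0// (enorm_split x) lerDr sqr_ge0//.
Qed.

Lemma enorm_le_lrsub x : enorm x <= enorm (lsubmx x) + enorm (rsubmx x).
Proof.
rewrite -(@ler_pXn2r _ 2)// ?nnegrE ?addr_ge0 ?enorm_ge0// (enorm_split x).
have := enorm_ge0 (lsubmx x); have := enorm_ge0 (rsubmx x); nra.
Qed.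

Lemma enorm_row0 (z : 'rV[R]_m) : enorm (row_mx (0 : 'rV[R]_r) z) = enorm z.
Proof.
apply/eqP; rewrite -(@eqrXn2 _ 2)// ?enorm_ge0// enorm_split row_mxKl row_mxKr enorm0.
by rewrite expr0n add0r.
Qed.

End block_norm.

(** * Coordinate maps *)

Section coordinate_maps.
Context {R : realType}.

Lemma continuous_rVP n l (A : 'rV[R]_n -> 'rV[R]_l) :
  (forall j, continuous (fun x => A x 0 j)) -> continuous A.
Proof.
move=> cA x U [P AP PU]; rewrite /nbhs/=.
apply: (@filterS _ (nbhs x) _ [set y | forall j, P 0 j (A y 0 j)]).
  by move=> y /= Py; apply: PU => i j; rewrite ord1.
apply: (@filter_forall _ _ _ (nbhs x) _) => j.
exact: (cA j x (P 0 j) (AP 0 j)).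
Qed.

Lemma continuous_lsubmx r m : continuous (@lsubmx R 1 r m).
Proof.
by apply: continuous_rVP => j; under eq_fun do rewrite mxE; exact: coord_continuous.
Qed.

Lemma continuous_rsubmx r m : continuous (@rsubmx R 1 r m).
Proof.
by apply: continuous_rVP => j; under eq_fun do rewrite mxE; exact: coord_continuous.
Qed.

(** The coordinate of x' that follows the j-th coordinate of x; i0 is a default
    value for the coordinates of x''. *)
Definition lsub_index r m (i0 : 'I_r) (j : 'I_(r + m)) : 'I_r :=
  if fintype.split j is inl i then i else i0.

Definition rsub_index r m (i0 : 'I_m) (j : 'I_(r + m)) : 'I_m :=
  if fintype.split j is inr i then i else i0.

Lemma coordinate_map_lsub r m (i0 : 'I_r) : coordinate_map (@lsubmx R 1 r m)
  (fun j => if fintype.split j is inl _ then 1 else 0) (lsub_index i0).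
Proof.
split; first exact: continuous_lsubmx.
move=> j x t; apply/rowP => i; rewrite /lsub_index !mxE eqxx/=; congr (_ + _).
case: split_ordP => k ->; rewrite ?mulr1 ?mulr0 ?mul0r ?(inj_eq (@lshift_inj _ _))//.
by rewrite eq_lrshift mulr0.
Qed.

Lemma coordinate_map_rsub r m (i0 : 'I_m) : coordinate_map (@rsubmx R 1 r m)
  (fun j => if fintype.split j is inr _ then 1 else 0) (rsub_index i0).
Proof.
split; first exact: continuous_rsubmx.
move=> j x t; apply/rowP => i; rewrite /rsub_index !mxE eqxx/=; congr (_ + _).
case: split_ordP => k ->; rewrite ?mulr1 ?mulr0 ?mul0r ?(inj_eq (@rshift_inj _ _))//.
by rewrite eq_rlshift mulr0.
Qed.

Lemma coordinate_map_slice r m (y : 'rV[R]_r) :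
  coordinate_map (fun z : 'rV[R]_m => row_mx y z) (fun=> 1) (fun j => rshift r j).
Proof.
split.
  apply: continuous_rVP => j; case: (split_ordP j) => k ->.
    by under eq_fun do rewrite row_mxEl; exact: cst_continuous.
  by under eq_fun do rewrite row_mxEr; exact: coord_continuous.
move=> j x t; apply/rowP => i; rewrite [RHS]mxE [X in _ = X + _]mxE [X in _ = _ * X + _]mxE eqxx/=.
case: (split_ordP i) => k ->; rewrite ?(row_mxEl, row_mxEr).
  by rewrite eq_lrshift mulr0 add0r.
by rewrite !mxE eqxx (inj_eq (@rshift_inj _ _)) mulr1.
Qed.

Lemma coordinate_map_scale n (c : R) :
  coordinate_map (fun x : 'rV[R]_n => c *: x) (fun=> c) id.
Proof.
split; first by move=> x; exact: scaler_continuous.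
by move=> j x t; rewrite scalerDr scalerA mulrC.
Qed.

End coordinate_maps.

(** * Convex functions of growth p *)

Section convex_growth.
Context {R : realType} {n : nat}.
Variables (p Lambda lambda : R) (F : 'rV[R]_n -> R).
Hypotheses (p1 : 1 < p) (lambda0 : 0 < lambda) (Lambda0 : 0 < Lambda).
Hypothesis F_convex : forall x y (t : R), 0 <= t <= 1 ->
  F (t *: x + (1 - t) *: y) <= t * F x + (1 - t) * F y.
Hypothesis F_lower : forall x, lambda * enorm x `^ p <= F x.
Hypothesis F_upper : forall x, F x <= Lambda * (enorm x `^ p + 1).
Implicit Types x y : 'rV[R]_n.

Let p0 : 0 <= p. Proof. by apply: ltW; apply: lt_trans p1. Qed.

Let pm1 : 0 < p - 1. Proof. by rewrite subr_gt0. Qed.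

Lemma convex_growth_ge0 x : 0 <= F x.
Proof. by apply: le_trans (F_lower x); rewrite mulr_ge0 ?powR_ge0 ?ltW. Qed.

(** y is the convex combination of x and x + (y - x)/t with weight t on the
    latter, where F has at most power growth. *)
Lemma convex_increment x y (t : R) : 0 < t <= 1 ->
  F y <= F x + (Lambda * 2 `^ p) * (t * (enorm x `^ p + 1) + t `^ (1 - p) * enorm (y - x) `^ p).
Proof.
move=> /andP[t0 t1].
have yE : y = t *: (x + t^-1 *: (y - x)) + (1 - t) *: x.
  rewrite scalerDr scalerA divff ?gt_eqF// scale1r scalerBl scale1r.
  by apply/rowP => i; rewrite !mxE; ring.
rewrite {1}yE; apply: le_trans (F_convex _ _ _) _; first by rewrite (ltW t0).
rewrite addrC lerD//; first by rewrite ler_piMl ?convex_growth_ge0// gerBl ltW.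
apply: le_trans (ler_wpM2l (ltW t0) (F_upper _)) _.
rewrite mulrCA -mulrA ler_wpM2l ?(ltW Lambda0)//.
have P1 : 1 <= 2 `^ p :> R := powR2_ge1 p0.
have h := enorm_powRD x (t^-1 *: (y - x)) p0.
apply: (@le_trans _ _ (t * (2 `^ p * (enorm x `^ p + enorm (t^-1 *: (y - x)) `^ p) + 1))).
  by rewrite ler_wpM2l ?(ltW t0)// lerD2r.
rewrite enormZ normfV (gtr0_norm t0) powRM ?invr_ge0 ?(ltW t0) ?enorm_ge0//.
have -> : t `^ (1 - p) = t * t^-1 `^ p.
  rewrite -powR_inv1 ?(ltW t0)// -powRrM mulN1r powRD; first by rewrite powRr1 ?(ltW t0).
  by rewrite (gt_eqF t0) implybT.
have := powR_ge0 (enorm x) p; set A := _ `^ p; set B := (_^-1) `^ p; set C := enorm (y - x) `^ p.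
move=> A0; rewrite -subr_ge0.
have -> : 2 `^ p * (t * (A + 1) + t * B * C) - t * (2 `^ p * (A + B * C) + 1) = t * (2 `^ p - 1) by ring.
by rewrite mulr_ge0 ?(ltW t0)// subr_ge0.
Qed.

(** A fixed small t in [convex_increment], applied from x to y and from y to x. *)
Lemma convex_growth_continuous : continuous F.
Proof.
move=> x; apply/(@cvgrPdist_le _ _ _ (nbhs x)) => e e0.
pose K := Lambda * 2 `^ p.
have K0 : 0 < K by rewrite mulr_gt0// powR_gt0.
pose A := enorm x `^ p.
have A0 : 0 <= A by exact: powR_ge0.
pose B := 2 `^ p * (A + 1) + 1.
have P1 : 1 <= 2 `^ p :> R := powR2_ge1 p0.
have AB : A + 1 <= B by rewrite /B; nra.
have B0 : 0 < B by lra.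
pose t := Num.min 1 (e / (2 * (K * B))).
have t0 : 0 < t by rewrite lt_min ltr01 divr_gt0// !mulr_gt0.
have t1 : t <= 1 by rewrite ge_min lexx.
have tKB : K * (t * B) <= e / 2.
  have : t <= e / (2 * (K * B)) by rewrite ge_min lexx orbT.
  by rewrite ler_pdivlMr ?mulr_gt0//; nra.
pose s := t `^ (1 - p).
have s0 : 0 < s by exact: powR_gt0.
have [d d0 dP] := @powR_small R p (Num.min 1 (e / (2 * (K * s)))) (lt_trans ltr01 p1)
  ltac:(by rewrite lt_min ltr01 divr_gt0// !mulr_gt0).
have nx : \forall y \near x, n%:R * `|x - y| <= d.
  have d1 : 0 < d / n.+1%:R by rewrite divr_gt0.
  near=> y; have : `|x - y| <= d / n.+1%:R by near: y; exact: cvgr_dist_le.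
  rewrite ler_pdivlMr// mulrC; apply: le_trans.
  by rewrite ler_wpM2r// ler_nat.
near=> y; have yd : enorm (y - x) <= d.
  apply: le_trans (enorm_le_norm _) _; rewrite distrC; by near: y.
have := dP _ (enorm_ge0 _) yd; rewrite le_min => /andP[C1 C2].
have {C2} Ce : K * (s * enorm (y - x) `^ p) <= e / 2.
  by move: C2; rewrite ler_pdivlMr ?mulr_gt0//; nra.
have h1 := @convex_increment x y t ltac:(by rewrite t0).
have h2 := @convex_increment y x t ltac:(by rewrite t0).
rewrite -(opprB y x) enormN in h2.
have h3 : enorm y `^ p <= 2 `^ p * (A + enorm (y - x) `^ p).
  by rewrite -{1}(subrKC x y); exact: enorm_powRD.
have h4 : enorm y `^ p + 1 <= B.
  by rewrite /B lerD2r; apply: le_trans h3 _; rewrite ler_wpM2l ?powR_ge0// lerD2l.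
rewrite -/K -/s -/A in h1 h2.
have h5 : K * (t * (A + 1)) <= e / 2.
  by apply: le_trans tKB; rewrite ler_wpM2l ?(ltW K0)// ler_wpM2l ?(ltW t0).
have h6 : K * (t * (enorm y `^ p + 1)) <= e / 2.
  by apply: le_trans tKB; rewrite ler_wpM2l ?(ltW K0)// ler_wpM2l ?(ltW t0).
rewrite mulrDr in h1; rewrite mulrDr in h2; rewrite ler_norml; move: h1 h2 h5 h6 Ce.
move: (F x) (F y) (K * _) (K * _) (K * _) => a b c1 c2 c3 *.
by apply/andP; split; lra.
Unshelve. all: by end_near. Qed.

Definition gap (t : R) x y : R := t * F x + (1 - t) * F y - F (t *: x + (1 - t) *: y).

Lemma gap_ge0 (t : R) x y : 0 <= t <= 1 -> 0 <= gap t x y.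
Proof. by move=> t01; rewrite /gap subr_ge0; exact: F_convex. Qed.

(** For a small weight t the gap controls the full power of x, because
    F (t x + (1 - t) y) only sees a multiple t^p of it, and t^p << t. *)
Lemma gap_coercive : exists2 t : R, 0 < t < 1 & exists2 C : R, 1 <= C &
  forall x y, enorm x `^ p <= C * (gap t x y + (enorm y `^ p + 1)).
Proof.
pose P := 2 `^ p; have P0 : 0 < P by exact: powR_gt0.
have [d d0 dP] := @powR_small R (p - 1) (lambda / (2 * (Lambda * P))) pm1
  ltac:(by rewrite divr_gt0// !mulr_gt0).
pose t := Num.min (2^-1) d.
have t0 : 0 < t by rewrite lt_min invr_gt0 d0 ltr0n.
have th : t <= 2^-1 by rewrite ge_min lexx.
have td : t <= d by rewrite ge_min lexx orbT.
exists t; first by rewrite t0/=; lra.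
have tp : Lambda * P * t `^ p <= t * lambda / 2.
  have -> : t `^ p = t * t `^ (p - 1) by rewrite mulr_powRB1 ?(ltW t0)// (lt_trans ltr01 p1).
  have := dP _ (ltW t0) td; rewrite ler_pdivlMr ?mulr_gt0//.
  set s := t `^ (p - 1); set L := Lambda * P => sL.
  rewrite mulrCA -mulrA ler_wpM2l ?(ltW t0)//; lra.
pose C := 2 / (t * lambda) * (1 + Lambda * (P + 1)) + 1.
have tl0 : 0 < 2 / (t * lambda) by rewrite divr_gt0// mulr_gt0.
exists C; first by rewrite /C lerDr mulr_ge0 ?(ltW tl0)// addr_ge0// mulr_ge0 ?(ltW Lambda0)//; lra.
move=> x y; set X := enorm x `^ p; set Y := enorm y `^ p.
have X0 : 0 <= X by exact: powR_ge0.
have Y0 : 0 <= Y by exact: powR_ge0.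
have g0 : 0 <= gap t x y by apply: gap_ge0; rewrite ltW//=; lra.
have h1 : F (t *: x + (1 - t) *: y) <= Lambda * (P * (t `^ p * X + Y) + 1).
  apply: le_trans (F_upper _) _; rewrite ler_wpM2l ?(ltW Lambda0)// lerD2r.
  apply: le_trans (enorm_powRD (t *: x) ((1 - t) *: y) p0) _.
  apply: ler_wpM2l; first exact: powR_ge0.
  apply: lerD; first by rewrite enormZ powRM ?enorm_ge0// gtr0_norm.
  rewrite ler_powR_base ?enorm_ge0// enormZ ler_piMl ?enorm_ge0// ger0_norm; lra.
have h2 := F_lower x; rewrite -/X in h2.
have h3 : 0 <= (1 - t) * F y by rewrite mulr_ge0 ?convex_growth_ge0//; lra.
have h4 : t * (lambda * X) <= t * F x by rewrite ler_wpM2l ?(ltW t0).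
have h5 : Lambda * P * t `^ p * X <= t * lambda / 2 * X by rewrite ler_wpM2r.
have key : t * lambda / 2 * X <= gap t x y + Lambda * (P * Y + 1).
  rewrite /gap; move: h1; rewrite !mulrDr !mulrA mulr1 => h1; nra.
have -> : X = 2 / (t * lambda) * (t * lambda / 2 * X) by field; rewrite !gt_eqF.
apply: (@le_trans _ _ (2 / (t * lambda) * ((1 + Lambda * (P + 1)) * (gap t x y + (Y + 1))))).
  rewrite ler_wpM2l ?(ltW tl0)//; apply: le_trans key _.
  rewrite mulrDl mul1r mulrDr.
  have : Lambda * (P * Y + 1) <= Lambda * (P + 1) * (Y + 1) by rewrite -mulrA ler_wpM2l ?(ltW Lambda0)//; nra.
  have : 0 <= Lambda * (P + 1) * gap t x y by rewrite !mulr_ge0 ?(ltW Lambda0)//; lra.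
  lra.
rewrite mulrA /C [X in _ <= X]mulrDl mul1r lerDl; lra.
Qed.

(** On bounded y, strict convexity and compactness turn a small gap into a
    small distance; far away in x the gap is coercive. *)
Lemma gap_distance (t : R) (C : R) : 0 < t < 1 -> 1 <= C ->
  (forall x y, enorm x `^ p <= C * (gap t x y + (enorm y `^ p + 1))) ->
  (forall x y, x != y -> 0 < gap t x y) ->
  forall (M eps : R), 0 <= M -> 0 < eps -> exists2 C' : R, 0 <= C' &
  forall x y, enorm y <= M -> enorm (x - y) `^ p <= eps + C' * gap t x y.
Proof.
move=> /andP[t0 t1] C1 coer gap_gt0 M eps M0 eps0.
have g0 x y : 0 <= gap t x y by apply: gap_ge0; rewrite !ltW.
have C0 : 0 < C by exact: lt_le_trans C1.
pose P := 2 `^ p; have P0 : 0 < P by exact: powR_gt0.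
pose L := 2 * C * (M `^ p + 1).
have Mp0 : 0 <= M `^ p by exact: powR_ge0.
(* beyond L the gap dominates; elsewhere x and y range over a compact set *)
pose K := [set z : 'rV[R]_(n + n) | [/\ enorm (lsubmx z) `^ p <= L, enorm (rsubmx z) <= M &
  eps <= enorm (lsubmx z - rsubmx z) `^ p]].
have cF := convex_growth_continuous.
have cnp (f : 'rV[R]_(n + n) -> 'rV[R]_n) : continuous f -> continuous (fun z => enorm (f z) `^ p).
  move=> cf; rewrite (_ : (fun z => _) = (fun z => `|enorm (f z)| `^ p)); last first.
    by apply/funext => z; rewrite ger0_norm// enorm_ge0.
  move=> z; apply: (@continuous_comp _ _ _ (fun z => enorm (f z)) (fun s : R => `|s| `^ p)).
    by apply: (@continuous_comp _ _ _ f (@enorm R n)); [exact: cf|exact: continuous_enorm].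
  exact: continuous_norm_powR.
have cl := @continuous_lsubmx R n n; have cr := @continuous_rsubmx R n n.
have cd : continuous (fun z : 'rV[R]_(n + n) => lsubmx z - rsubmx z).
  by move=> z; exact: (continuousB (cl z) (cr z)).
have ccomb : continuous (fun z : 'rV[R]_(n + n) => t *: lsubmx z + (1 - t) *: rsubmx z).
  apply: continuous_rVP => j; under eq_fun do rewrite !mxE.
  by apply: continuousD_rV; apply: continuousM_rV; try exact: cst_continuous; exact: coord_continuous.
have cgap : continuous (fun z : 'rV[R]_(n + n) => gap t (lsubmx z) (rsubmx z)).
  have cFl : continuous (fun z : 'rV[R]_(n + n) => F (lsubmx z)).
    by move=> z; apply: (@continuous_comp _ _ _ (@lsubmx R 1 n n) F); [exact: cl|exact: cF].
  have cFr : continuous (fun z : 'rV[R]_(n + n) => F (rsubmx z)).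
    by move=> z; apply: (@continuous_comp _ _ _ (@rsubmx R 1 n n) F); [exact: cr|exact: cF].
  have cFc : continuous (fun z : 'rV[R]_(n + n) => F (t *: lsubmx z + (1 - t) *: rsubmx z)).
    by move=> z; apply: (@continuous_comp _ _ _ (fun z : 'rV[R]_(n + n) => t *: lsubmx z + (1 - t) *: rsubmx z) F); [exact: ccomb|exact: cF].
  have cl2 := continuousD_rV (continuousM_rV (@cst_continuous _ _ t) cFl)
    (continuousM_rV (@cst_continuous _ _ (1 - t)) cFr).
  by move=> z; exact: (continuousB (cl2 z) (cFc z)).
have cK : compact K.
  apply: bounded_closed_compact.
    have pL : exists2 L', 0 <= L' & forall a, 0 <= a -> a `^ p <= L -> a <= L'.
      exists (L `^ p^-1); first exact: powR_ge0.
      move=> a a0 aL; rewrite -[a]powRr1// -(@mulfV _ p) ?gt_eqF// ?(lt_trans ltr01 p1)//.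
      by rewrite powRrM; apply: ler_powR_base; rewrite ?powR_ge0// invr_ge0.
    have [L' L'0 LL'] := pL; exists (L' + M); split; first exact: num_real.
    move=> B LB z [zL zM _]; apply: le_trans (ltW LB).
    apply: le_trans (norm_le_enorm _) _; apply: le_trans (enorm_le_lrsub _) _.
    by rewrite lerD//; apply: LL' => //; exact: enorm_ge0.
  rewrite (_ : K = (fun z => enorm (lsubmx z) `^ p) @^-1` [set s | s <= L] `&`
    ((fun z => enorm (rsubmx z)) @^-1` [set s | s <= M] `&`
    (fun z => enorm (lsubmx z - rsubmx z) `^ p) @^-1` [set s | eps <= s])); last first.
    by apply/seteqP; split => z /=; [case|case=> ? []].
  apply: closedI; first by apply: closed_comp (@closed_le _ L) => z _; exact: cnp.
  apply: closedI.
    apply: closed_comp (@closed_le _ M) => z _.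
    by apply: (@continuous_comp _ _ _ (@rsubmx R 1 n n) (@enorm R n)); [exact: cr|exact: continuous_enorm].
  by apply: closed_comp (@closed_ge _ eps) => z _; exact: cnp.
have [c c0 cP] : exists2 c : R, 0 < c & forall z, K z -> c <= gap t (lsubmx z) (rsubmx z).
  have [K0|K0] := pselect (K !=set0); last first.
    by exists 1 => // z Kz; exfalso; apply: K0; exists z.
  have [z0 /set_mem Kz0 zmin] := compact_EVT_min K0 cK (continuous_subspaceT cgap).
  exists (gap t (lsubmx z0) (rsubmx z0)); last by move=> z Kz; apply: zmin; rewrite inE.
  apply: gap_gt0; apply/eqP => lr; have [_ _] := Kz0.
  by rewrite lr subrr enorm0 powR0 ?gt_eqF ?(lt_trans ltr01 p1)// leNgt eps0.
exists (P * (4 * C) + P * (L + M `^ p) / c).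
  by rewrite addr_ge0// mulr_ge0 ?invr_ge0 ?(ltW c0)// ?mulr_ge0 ?(ltW P0) ?(ltW C0)// addr_ge0// mulr_ge0 ?mulr_ge0 ?(ltW C0)// addr_ge0.
move=> x y yM.
have hM : enorm y `^ p <= M `^ p by apply: ler_powR_base => //; exact: enorm_ge0.
have hd := enorm_powRB x y p0; rewrite -/P in hd.
have gxy := g0 x y; have hc := coer x y.
set X := enorm x `^ p in hd hc *; set Y := enorm y `^ p in hd hc hM *.
set dd := enorm (x - y) `^ p in hd *; set g := gap t x y in hc gxy *.
have X0 : 0 <= X by exact: powR_ge0.
have Y0 : 0 <= Y by exact: powR_ge0.
have PLc0 : 0 <= P * (L + M `^ p) / c.
  by rewrite mulr_ge0 ?invr_ge0 ?(ltW c0)// mulr_ge0 ?(ltW P0)// addr_ge0// !mulr_ge0 ?(ltW C0)// addr_ge0.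
have PC0 : 0 <= P * (4 * C) by rewrite !mulr_ge0 ?(ltW P0) ?(ltW C0).
have [XL|LX] := leP X L; last first.
  have h1 : X <= 2 * C * g.
    have : C * (Y + 1) <= C * (M `^ p + 1) by rewrite ler_wpM2l ?(ltW C0)// lerD2r.
    by move: LX hc; rewrite /L mulrDr; lra.
  have h2 : Y <= X.
    apply: le_trans hM (le_trans _ (ltW LX)).
    by rewrite /L; nra.
  have h3 : dd <= P * (4 * C) * g.
    apply: le_trans hd _; rewrite -mulrA ler_wpM2l ?(ltW P0)//; lra.
  apply: le_trans h3 _; rewrite mulrDl; have := mulr_ge0 PLc0 gxy; lra.
have [ddeps|epsdd] := leP dd eps.
  by rewrite ler_wpDr// mulr_ge0// addr_ge0.
have Kz : K (row_mx x y) by rewrite /K /= row_mxKl row_mxKr; split => //; exact: ltW.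
have := cP _ Kz; rewrite row_mxKl row_mxKr -/g => cg.
have h4 : dd <= P * (L + M `^ p) by apply: le_trans hd _; rewrite ler_wpM2l ?(ltW P0)// lerD.
have h5 : P * (L + M `^ p) <= P * (L + M `^ p) / c * g.
  rewrite -mulrA ler_peMr//; last by rewrite mulrC ler_pdivlMr// mul1r.
  by rewrite mulr_ge0 ?(ltW P0)// addr_ge0// !mulr_ge0 ?(ltW C0)// addr_ge0.
rewrite mulrDl; have := mulr_ge0 PC0 gxy; lra.
Qed.

End convex_growth.

(** * Norms of L^p *)

Section lp_norms.
Context {R : realType} {n : nat}.
Local Notation mu := (@lebesgue_rV R n).
Variable p : R.
Hypothesis p1 : 1 < p.
Implicit Types (D : set 'rV[R]_n) (u v : 'rV[R]_n -> R) (g h : 'rV[R]_n -> 'rV[R]_n).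
Local Notation rint D f := (mu.-integrable D (EFin \o f)).

Let p0 : 0 < p. Proof. exact: lt_trans p1. Qed.
Let p0' : 0 <= p. Proof. exact: ltW. Qed.

Lemma rint_ae D u v : measurable D -> rint D u -> measurable_fun D v -> ae_eq mu D u v -> rint D v.
Proof.
move=> mD intu mv uv; have mu_ := rint_measurable intu.
apply/integrableP; split; first exact/measurable_EFinP.
have /integrableP[_] := intu; apply: le_lt_trans; rewrite le_eqVlt; apply/orP; left; apply/eqP.
apply: ae_eq_integral => //.
- by apply: measurableT_comp => //; exact/measurable_EFinP.
- by apply: measurableT_comp => //; exact/measurable_EFinP.
by apply: filterS uv => x /= uv Dx; rewrite uv.
Qed.

Lemma Rintegral_ae D u v : measurable D -> measurable_fun D u -> measurable_fun D v ->
  ae_eq mu D u v -> \int[mu]_(x in D) u x = \int[mu]_(x in D) v x.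
Proof.
move=> mD mu_ mv uv; congr fine; apply: ae_eq_integral => //; try exact/measurable_EFinP.
by apply: filterS uv => x /= uv Dx; rewrite uv.
Qed.

Lemma Lp_normE D u :
  Lp_norm p D u = ((\int[mu]_(x in D) (`|u x| `^ p)%:E) `^ p^-1)%E.
Proof.
rewrite /Lp_norm unlock /Lnorm.
suff -> : (\int[mu]_x `|(EFin \o (u \_ D)) x| `^ p = \int[mu]_(x in D) (`|u x| `^ p)%:E)%E by [].
rewrite [RHS]integral_mkcond; apply: eq_integral => x _.
rewrite [LHS]/= [LHS]poweR_EFin /patch; case: ifPn => // _.
by rewrite normr0 powR0// gt_eqF.
Qed.

Lemma LpP D u : measurable D ->
  Lp p D u <-> measurable_fun D u /\ rint D (fun x => `|u x| `^ p).
Proof.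
move=> mD; rewrite /Lp Lp_normE; split => -[mu_ h]; split => //.
  apply/integrableP; split; first by apply/measurable_EFinP; exact: measurable_norm_powR.
  under eq_integral do rewrite /= ger0_norm ?powR_ge0//.
  by apply: lty_poweRy h; rewrite invr_eq0 gt_eqF.
apply: poweR_lty; have /integrableP[_] := h.
by under eq_integral do rewrite /= ger0_norm ?powR_ge0//.
Qed.

Lemma Lp_norm_EFin D u : measurable D -> rint D (fun x => `|u x| `^ p) ->
  Lp_norm p D u = ((\int[mu]_(x in D) `|u x| `^ p) `^ p^-1)%:E.
Proof. by move=> mD intu; rewrite Lp_normE -poweR_EFin EFin_Rintegral. Qed.

Lemma Lp_norm_ae D u v : measurable D -> measurable_fun D u -> measurable_fun D v ->
  ae_eq mu D u v -> Lp_norm p D u = Lp_norm p D v.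
Proof.
move=> mD mu_ mv uv; rewrite !Lp_normE.
suff -> : (\int[mu]_(x in D) (`|u x| `^ p)%:E = \int[mu]_(x in D) (`|v x| `^ p)%:E)%E by [].
apply: ae_eq_integral => //; try (by apply/measurable_EFinP; exact: measurable_norm_powR).
by apply: filterS uv => x /= uv Dx; rewrite uv.
Qed.

(** The density whose integral is the p-th power of a norm equivalent to the
    one of W^{1,p}. *)
Definition wdens (a : R) (z : 'rV[R]_n) : R := `|a| `^ p + enorm z `^ p.

Lemma wdens_ge0 a z : 0 <= wdens a z.
Proof. by rewrite addr_ge0// powR_ge0. Qed.

Lemma wdensD a b y z : wdens (a + b) (y + z) <= 2 `^ p * (wdens a y + wdens b z).
Proof.
apply: le_trans (lerD (norm_powRD_le a b p0') (enorm_powRD y z p0')) _.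
by rewrite -mulrDr addrACA.
Qed.

Lemma wdensZ c a z : wdens (c * a) (c *: z) = `|c| `^ p * wdens a z.
Proof. by rewrite /wdens normrM enormZ !powRM ?enorm_ge0// mulrDr. Qed.

Lemma wdensN a z : wdens (- a) (- z) = wdens a z.
Proof. by rewrite /wdens normrN enormN. Qed.

Lemma measurable_wdens D u g : measurable_fun D u -> measurable_fun D g ->
  measurable_fun D (fun x => wdens (u x) (g x)).
Proof.
move=> mu_ mg; apply: measurable_funD; first exact: measurable_norm_powR.
apply: (measurableT_comp (measurable_powR p)).
exact: measurable_enorm.
Qed.

Lemma rint_wdensD D u v g h : measurable D ->
  measurable_fun D u -> measurable_fun D v -> measurable_fun D g -> measurable_fun D h ->
  rint D (fun x => wdens (u x) (g x)) -> rint D (fun x => wdens (v x) (h x)) ->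
  rint D (fun x => wdens (u x + v x) (g x + h x)).
Proof.
move=> mD mu_ mv mg mh intu intv.
apply: (rint_le (g := fun x => 2 `^ p * (wdens (u x) (g x) + wdens (v x) (h x)))) => //.
- apply: measurable_wdens; first exact: measurable_funD.
  apply: measurable_rVP => // i; under eq_fun do rewrite mxE.
  by apply: measurable_funD; exact: measurable_rV_coord.
- by apply: rintZ => //; exact: rintD.
- by move=> x _; rewrite ger0_norm ?wdens_ge0// wdensD.
Qed.

Lemma enorm_powR_le_sum z : enorm z `^ p <= n%:R `^ p * \sum_(i < n) `|z 0 i| `^ p.
Proof.
apply: (@le_trans _ _ ((n%:R * `|z|) `^ p)).
  by apply: ler_powR_base => //; [exact: enorm_ge0|exact: enorm_le_norm].
rewrite powRM// ler_wpM2l ?powR_ge0//.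
have [->|z0] := eqVneq `|z| 0.
  by rewrite powR0 ?gt_eqF// sumr_ge0// => i _; exact: powR_ge0.
have [[a i] zE] := mx_norm_neq0 z0; rewrite -[`|z|]/(mx_norm z) zE ord1 (bigD1 i)//= lerDl.
by rewrite sumr_ge0// => j _; exact: powR_ge0.
Qed.

Lemma rint_sum D (f : 'I_n -> 'rV[R]_n -> R) : measurable D -> (forall i, rint D (f i)) ->
  rint D (fun x => \sum_(i < n) f i x).
Proof.
move=> mD intf.
rewrite (_ : EFin \o _ = fun x => (\sum_(i < n) (f i x)%:E)%E); last first.
  by apply/funext => x /=; rewrite sumEFin.
by apply: integrable_sum => // i _; exact: intf.
Qed.

Lemma rint_enorm_powR D g : measurable D -> measurable_fun D g ->
  (forall i, rint D (fun x => `|g x 0 i| `^ p)) <-> rint D (fun x => enorm (g x) `^ p).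
Proof.
move=> mD mg; have meg : measurable_fun D (fun x => enorm (g x) `^ p).
  by apply: (measurableT_comp (measurable_powR p)); exact: measurable_enorm.
split => [intg|intg i].
  apply: (rint_le (g := fun x => n%:R `^ p * \sum_(i < n) `|g x 0 i| `^ p)) => //.
    apply: rintZ => //; exact: rint_sum.
  by move=> x _; rewrite ger0_norm ?powR_ge0// enorm_powR_le_sum.
apply: rint_le intg _ => //; first by apply: measurable_norm_powR; exact: measurable_rV_coord.
move=> x _; rewrite ger0_norm ?powR_ge0//; apply: ler_powR_base => //.
exact: coord_le_enorm.
Qed.

Lemma rint_wdens D u g : measurable D -> measurable_fun D u -> measurable_fun D g ->
  rint D (fun x => wdens (u x) (g x)) ->
  rint D (fun x => `|u x| `^ p) /\ rint D (fun x => enorm (g x) `^ p).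
Proof.
move=> mD mu_ mg intug; split; apply: rint_le intug _ => //.
- exact: measurable_norm_powR.
- by move=> x _; rewrite ger0_norm ?powR_ge0// lerDl powR_ge0.
- by apply: (measurableT_comp (measurable_powR p)); exact: measurable_enorm.
- by move=> x _; rewrite ger0_norm ?powR_ge0// lerDr powR_ge0.
Qed.

Lemma Rintegral_wdens D u g : measurable D ->
  rint D (fun x => `|u x| `^ p) -> rint D (fun x => enorm (g x) `^ p) ->
  \int[mu]_(x in D) wdens (u x) (g x) =
  \int[mu]_(x in D) `|u x| `^ p + \int[mu]_(x in D) enorm (g x) `^ p.
Proof. by move=> mD intu intg; rewrite RintegralD. Qed.

Lemma cvg_powRV0 (I : Type) (F : set_system I) {FF : Filter F} (a : I -> R) (q : R) : 0 < q ->
  (forall i, 0 <= a i) -> a @ F --> 0 -> (fun i => a i `^ q) @ F --> 0.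
Proof.
move=> q0 a0 /cvgrPdist_le ca; apply/cvgrPdist_le => e e0.
have [d d0 dP] := powR_small q0 e0; near=> i.
rewrite sub0r normrN ger0_norm ?powR_ge0//; apply: dP => //.
have : `|0 - a i| <= d by near: i; exact: ca.
by rewrite sub0r normrN ger0_norm.
Unshelve. all: by end_near. Qed.

Lemma squeeze0 (I : Type) (F : set_system I) {FF : Filter F} (a b : I -> R) (C : R) :
  (\forall i \near F, 0 <= a i <= C * b i) -> b @ F --> 0 -> a @ F --> 0.
Proof.
move=> ab cb; apply: (squeeze_cvgr ab); first exact: cvg_cst.
by rewrite -(mulr0 C); apply: cvgM => //; exact: cvg_cst.
Qed.

End lp_norms.

(** * Closures of sets of smooth functions in W^{1,p} *)

Section sobolev_approximation.
Context {R : realType} {n : nat}.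
Local Notation mu := (@lebesgue_rV R n).
Variable p : R.
Hypothesis p1 : 1 < p.
Implicit Types (D : set 'rV[R]_n) (u v phi : 'rV[R]_n -> R) (g h : 'rV[R]_n -> 'rV[R]_n)
  (S : set ('rV[R]_n -> R)).
Local Notation rint D f := (mu.-integrable D (EFin \o f)).

Let p0 : 0 < p. Proof. exact: lt_trans p1. Qed.
Let p0' : 0 <= p. Proof. exact: ltW. Qed.

Definition wdist D u g phi := \int[mu]_(x in D) wdens p (phi x - u x) (nabla phi x - g x).

(** u, with gradient g, is in the closure of S in W^{1,p}(D). For S the test
    functions this is W^{1,p}_0(D); keeping g explicit avoids choosing
    representatives of weak gradients. *)
Definition Wclosure S D u g := [/\ measurable_fun D u, measurable_fun D g,
  rint D (fun x => wdens p (u x) (g x)) &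
  exists phi : nat -> 'rV[R]_n -> R, (forall k, S (phi k)) /\ wdist D u g (phi k) @[k --> \oo] --> 0].

Lemma continuous_bounded_on D u : bounded_set D -> continuous u ->
  exists2 C : R, 0 <= C & forall x, D x -> `|u x| <= C.
Proof.
move=> /bounded_le[M M0 DM] cu.
have := @continuous_compact_bounded _ _ (cbox (const_mx (- M)) (const_mx M)) u.
case=> [||C C0 uC]; [exact: compact_cbox|exact: cu|exists C => // x /DM xM].
by apply: uC => i; rewrite !mxE -ler_norml; exact: le_trans (coord_le_norm x i) xM.
Qed.

Lemma continuous_nabla phi : smooth phi -> continuous (nabla phi).
Proof.
move=> sphi; apply: continuous_rVP => j; under eq_fun do rewrite mxE.
by apply/smooth_continuous/smooth_partial.
Qed.

Lemma measurable_nabla D phi : measurable D -> smooth phi -> measurable_fun D (nabla phi).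
Proof.
move=> mD sphi; apply: measurable_rVP => // i; under eq_fun do rewrite mxE.
by apply: smooth_measurable; exact: smooth_partial.
Qed.

Lemma enorm_nabla_bounded D phi : bounded_set D -> smooth phi ->
  exists2 C : R, 0 <= C & forall x, D x -> enorm (nabla phi x) <= C.
Proof.
move=> bD sphi; have [|C C0 nC] := @continuous_bounded_on D (fun x => enorm (nabla phi x)) bD.
  move=> x; apply: (@continuous_comp _ _ _ (nabla phi) (@enorm R n)).
    exact: continuous_nabla.
  exact: continuous_enorm.
by exists C => // x /nC; rewrite ger0_norm// enorm_ge0.
Qed.

Lemma rint_wdens_smooth D phi : measurable D -> bounded_set D -> smooth phi ->
  rint D (fun x => wdens p (phi x) (nabla phi x)).
Proof.
move=> mD bD sphi.
have [C C0 phiC] := continuous_bounded_on bD (smooth_continuous sphi).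
have [C' C'0 dphiC] := enorm_nabla_bounded bD sphi.
apply: (rint_le (g := cst (C `^ p + C' `^ p))) => //.
- by apply: measurable_wdens; [exact: smooth_measurable|exact: measurable_nabla].
- by apply: rint_cst => //; exact: bounded_lebesgue_lty.
move=> x Dx; rewrite ger0_norm ?wdens_ge0//.
by apply: lerD; apply: ler_powR_base => //; [exact: phiC|exact: enorm_ge0|exact: dphiC].
Qed.

Lemma rV_measurableB D g h : measurable D -> measurable_fun D g -> measurable_fun D h ->
  measurable_fun D (fun x => g x - h x).
Proof.
move=> mD mg mh; apply: measurable_rVP => // i; under eq_fun do rewrite mxE [X in _ + X]mxE.
by apply: measurable_funB; exact: measurable_rV_coord.
Qed.

Lemma rV_measurableD D g h : measurable D -> measurable_fun D g -> measurable_fun D h ->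
  measurable_fun D (fun x => g x + h x).
Proof.
move=> mD mg mh; apply: measurable_rVP => // i; under eq_fun do rewrite mxE.
by apply: measurable_funD; exact: measurable_rV_coord.
Qed.

Lemma rV_measurableZ D u g : measurable D -> measurable_fun D u -> measurable_fun D g ->
  measurable_fun D (fun x => u x *: g x).
Proof.
move=> mD mu_ mg; apply: measurable_rVP => // i; under eq_fun do rewrite mxE.
by apply: measurable_funM => //; exact: measurable_rV_coord.
Qed.

Lemma rint_wdensB D u v g h : measurable D ->
  measurable_fun D u -> measurable_fun D v -> measurable_fun D g -> measurable_fun D h ->
  rint D (fun x => wdens p (u x) (g x)) -> rint D (fun x => wdens p (v x) (h x)) ->
  rint D (fun x => wdens p (u x - v x) (g x - h x)).
Proof.
move=> mD mu_ mv mg mh intu intv.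
have mNv : measurable_fun D (fun x => - v x) by exact: measurableT_comp.
have mNh : measurable_fun D (fun x => - h x).
  apply: measurable_rVP => // i; under eq_fun do rewrite mxE.
  by apply: measurableT_comp => //; exact: measurable_rV_coord.
have intNv : rint D (fun x => wdens p (- v x) (- h x)).
  by under eq_fun do rewrite wdensN.
exact: rint_wdensD mNv _ mNh _ intNv.
Qed.

Lemma rint_wdist D u g phi : measurable D -> bounded_set D -> measurable_fun D u -> measurable_fun D g ->
  rint D (fun x => wdens p (u x) (g x)) -> smooth phi ->
  rint D (fun x => wdens p (phi x - u x) (nabla phi x - g x)).
Proof.
move=> mD bD mu_ mg intug sphi.
exact: (rint_wdensB mD (smooth_measurable sphi) mu_ (measurable_nabla mD sphi) mg
  (rint_wdens_smooth mD bD sphi) intug).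
Qed.

Lemma wdist_ge0 D u g phi : 0 <= wdist D u g phi.
Proof. by apply: Rintegral_ge0 => x _; exact: wdens_ge0. Qed.

Lemma Rintegral_le_subset D D' u : measurable D -> measurable D' -> D' `<=` D ->
  rint D u -> (forall x, D x -> 0 <= u x) ->
  \int[mu]_(x in D') u x <= \int[mu]_(x in D) u x.
Proof.
move=> mD mD' D'D intu u0; rewrite (Rintegral_restrict u D'D).
have intu' : rint D (u \_ D').
  rewrite -restrict_EFin -(integrable_restrict mu mD' mD) (setIidr D'D).
  exact: (integrableS mD mD' D'D intu).
apply: (le_Rintegral mD intu' intu) => x Dx.
by rewrite /patch; case: ifPn => _; [exact: lexx|exact: u0].
Qed.

Lemma Wclosure_subset S S' D D' u g : measurable D -> bounded_set D -> S `<=` smooth ->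
  measurable D' -> D' `<=` D -> S `<=` S' -> Wclosure S D u g -> Wclosure S' D' u g.
Proof.
move=> mD bD Ssm mD' D'D SS' [mu_ mg intug [phi [Sphi cphi]]].
split; [exact: measurable_funS mu_|exact: measurable_funS mg|exact: integrableS intug|].
exists phi; split; first by move=> k; apply: SS'.
apply: (squeeze0 (C := 1) _ cphi).
apply: nearW => k; rewrite wdist_ge0/= mul1r /wdist.
have i1 := rint_wdist mD bD mu_ mg intug (Ssm _ (Sphi k)).
exact: (Rintegral_le_subset mD mD' D'D i1 (fun x _ => wdens_ge0 _ _ _)).
Qed.

Lemma wdens0 : wdens p 0 (0 : 'rV[R]_n) = 0.
Proof. by rewrite /wdens normr0 enorm0 powR0 ?addr0// gt_eqF. Qed.

Lemma Wclosure_self S D phi : measurable D -> bounded_set D -> smooth phi -> S phi ->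
  Wclosure S D phi (nabla phi).
Proof.
move=> mD bD sphi Sphi; split; [exact: smooth_measurable|exact: measurable_nabla|exact: rint_wdens_smooth|].
exists (fun=> phi); split => //; rewrite /wdist.
rewrite (_ : (fun k => _) = fun=> 0); first exact: cvg_cst.
apply/funext => k; rewrite (eq_Rintegral _ (g := fun=> 0)); first by rewrite Rintegral_cst ?mul0r.
by move=> x _; rewrite !subrr wdens0.
Qed.

Lemma nabla_lin (a b : R) phi psi x : smooth phi -> smooth psi ->
  nabla (fun y => a * phi y + b * psi y) x = a *: nabla phi x + b *: nabla psi x.
Proof.
move=> sphi spsi; apply/rowP => i; rewrite !mxE.
have sa := smoothM (smooth_cst a) sphi; have sb := smoothM (smooth_cst b) spsi.
rewrite partialD// (partialM _ _ (smooth_cst a) sphi) (partialM _ _ (smooth_cst b) spsi).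
by rewrite !partial_cst; ring.
Qed.

Lemma nablaM phi psi x : smooth phi -> smooth psi ->
  nabla (fun y => phi y * psi y) x = phi x *: nabla psi x + psi x *: nabla phi x.
Proof. by move=> sphi spsi; apply/rowP => i; rewrite !mxE partialM. Qed.

Lemma Wclosure_lin S S' S'' D (a b : R) u v g h : measurable D -> bounded_set D ->
  S `<=` smooth -> S' `<=` smooth ->
  (forall phi psi, S phi -> S' psi -> S'' (fun x => a * phi x + b * psi x)) ->
  Wclosure S D u g -> Wclosure S' D v h ->
  Wclosure S'' D (fun x => a * u x + b * v x) (fun x => a *: g x + b *: h x).
Proof.
move=> mD bD Ssm S'sm SSS [mu_ mg intu [phi [Sphi cphi]]] [mv mh intv [psi [Spsi cpsi]]].
have ma (w : 'rV[R]_n -> R) (c : R) : measurable_fun D w -> measurable_fun D (fun x => c * w x).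
  by move=> mw; exact: measurable_funM.
have mZ (k : 'rV[R]_n -> 'rV[R]_n) (c : R) : measurable_fun D k -> measurable_fun D (fun x => c *: k x).
  by move=> mk; exact: rV_measurableZ.
have iZ (w : 'rV[R]_n -> R) (k : 'rV[R]_n -> 'rV[R]_n) (c : R) : rint D (fun x => wdens p (w x) (k x)) ->
    rint D (fun x => wdens p (c * w x) (c *: k x)).
  by move=> iw; under eq_fun do rewrite wdensZ; exact: (rintZ _ mD iw).
have mab := measurable_funD (ma _ a mu_) (ma _ b mv).
have mgh := rV_measurableD mD (mZ _ a mg) (mZ _ b mh).
have intab := rint_wdensD p1 mD (ma _ a mu_) (ma _ b mv) (mZ _ a mg) (mZ _ b mh)
  (iZ _ _ a intu) (iZ _ _ b intv).
split; [exact: mab|exact: mgh|exact: intab|].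
exists (fun k x => a * phi k x + b * psi k x); split; first by move=> k; exact: SSS.
pose C := 2 `^ p * (`|a| `^ p + `|b| `^ p).
have c0 : (fun k => wdist D u g (phi k) + wdist D v h (psi k)) @ \oo --> 0.
  by have cs := cvgD cphi cpsi; rewrite addr0 in cs; exact: cs.
apply: (squeeze0 (C := C) _ c0); apply: nearW => k; rewrite wdist_ge0/= mulrDr.
have i1 := rint_wdist mD bD mu_ mg intu (Ssm _ (Sphi k)).
have i2 := rint_wdist mD bD mv mh intv (S'sm _ (Spsi k)).
have E : C * wdist D u g (phi k) + C * wdist D v h (psi k) = \int[mu]_(x in D)
    (C * wdens p (phi k x - u x) (nabla (phi k) x - g x) +
     C * wdens p (psi k x - v x) (nabla (psi k) x - h x)).
  apply/esym; apply: (etrans (RintegralD mD (rintZ C mD i1) (rintZ C mD i2))).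
  by congr (_ + _); [exact: (RintegralZl C mD i1)|exact: (RintegralZl C mD i2)].
rewrite E /wdist.
have sm1 := Ssm _ (Sphi k); have sm2 := S'sm _ (Spsi k).
have le x : wdens p (a * phi k x + b * psi k x - (a * u x + b * v x))
    (nabla (fun x0 => a * phi k x0 + b * psi k x0) x - (a *: g x + b *: h x)) <=
    C * wdens p (phi k x - u x) (nabla (phi k) x - g x) +
    C * wdens p (psi k x - v x) (nabla (psi k) x - h x).
  rewrite (nabla_lin _ _ _ sm1 sm2).
  have -> : a * phi k x + b * psi k x - (a * u x + b * v x) =
      a * (phi k x - u x) + b * (psi k x - v x) by ring.
  have -> : a *: nabla (phi k) x + b *: nabla (psi k) x - (a *: g x + b *: h x) =
      a *: (nabla (phi k) x - g x) + b *: (nabla (psi k) x - h x).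
    by apply/rowP => i; rewrite !mxE; ring.
  move: (phi k x - u x) (psi k x - v x) (nabla (phi k) x - g x) (nabla (psi k) x - h x) => A B V W.
  apply: le_trans (wdensD p1 (a * A) (b * B) (a *: V) (b *: W)) _.
  rewrite (wdensZ p a) (wdensZ p b) mulrDr !mulrA.
  apply: lerD; rewrite ler_wpM2r ?wdens_ge0// ler_wpM2l ?powR_ge0//.
    by rewrite lerDl powR_ge0.
  by rewrite lerDr powR_ge0.
have i3 : rint D (fun x => wdens p (a * phi k x + b * psi k x - (a * u x + b * v x))
    (nabla (fun x0 => a * phi k x0 + b * psi k x0) x - (a *: g x + b *: h x))).
  apply: (rint_wdist mD bD mab mgh intab).
  exact: (smoothD (smoothM (smooth_cst a) sm1) (smoothM (smooth_cst b) sm2)).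
exact: (le_Rintegral mD i3 (rintD mD (rintZ C mD i1) (rintZ C mD i2)) (fun x _ => le x)).
Qed.

Lemma Wclosure_mul S S' D eta u g : measurable D -> bounded_set D -> S `<=` smooth ->
  smooth eta -> (forall phi, S phi -> S' (fun x => eta x * phi x)) ->
  Wclosure S D u g ->
  Wclosure S' D (fun x => eta x * u x) (fun x => eta x *: g x + u x *: nabla eta x).
Proof.
move=> mD bD Ssm seta SS' [mu_ mg intu [phi [Sphi cphi]]].
have meta := smooth_measurable (D := D) seta; have mne := measurable_nabla mD seta.
have m1 : measurable_fun D (fun x => eta x * u x) by exact: measurable_funM.
have m2 : measurable_fun D (fun x => eta x *: g x + u x *: nabla eta x).
  by apply: rV_measurableD => //; exact: rV_measurableZ.
have [C1 C10 eC] := continuous_bounded_on bD (smooth_continuous seta).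
have [C2 C20 neC] := enorm_nabla_bounded bD seta.
pose C := C1 `^ p + 2 `^ p * (C1 `^ p + C2 `^ p).
have key w (k : 'rV[R]_n) x : D x ->
    wdens p (eta x * w) (eta x *: k + w *: nabla eta x) <= C * wdens p w k.
  move=> Dx; rewrite /wdens normrM powRM//.
  have h1 : `|eta x| `^ p <= C1 `^ p by apply: ler_powR_base => //; exact: eC.
  have h2 : enorm (nabla eta x) `^ p <= C2 `^ p.
    by apply: ler_powR_base => //; [exact: enorm_ge0|exact: neC].
  have h3 := enorm_powRD (eta x *: k) (w *: nabla eta x) p0'.
  rewrite !enormZ !powRM ?enorm_ge0// in h3.
  have P0 : 0 <= 2 `^ p :> R by exact: powR_ge0.
  have e0 := powR_ge0 `|eta x| p; have n0 := powR_ge0 (enorm (nabla eta x)) p.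
  have w0 := powR_ge0 `|w| p; have k0 := powR_ge0 (enorm k) p.
  rewrite /C; move: h1 h2 h3 P0 e0 n0 w0 k0 (powR_ge0 C1 p) (powR_ge0 C2 p).
  set E := `|eta x| `^ p; set N := enorm (nabla eta x) `^ p; set W := `|w| `^ p; set K := enorm k `^ p.
  set Q := enorm (_ + _) `^ p; set P := 2 `^ p; set c1 := C1 `^ p; set c2 := C2 `^ p.
  clearbody E N W K Q P c1 c2 => h1 h2 h3 P0 e0 n0 w0 k0 c10 c20.
  have h4 : P * (E * K + W * N) <= P * (c1 * K + W * c2).
    by rewrite ler_wpM2l// lerD// ?ler_wpM2r// ler_wpM2l.
  have h5 : E * W <= c1 * W by rewrite ler_wpM2r.
  have := mulr_ge0 c10 k0; have := mulr_ge0 (mulr_ge0 P0 c10) w0.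
  have := mulr_ge0 (mulr_ge0 P0 c20) k0; nra.
have int1 : rint D (fun x => wdens p (eta x * u x) (eta x *: g x + u x *: nabla eta x)).
  apply: (rint_le mD (measurable_wdens _ m1 m2) (rintZ C mD intu)) => x Dx.
  by rewrite ger0_norm ?wdens_ge0//; exact: key.
split; [exact: m1|exact: m2|exact: int1|].
exists (fun k x => eta x * phi k x); split; first by move=> k; exact: SS'.
apply: (squeeze0 (C := C) _ cphi); apply: nearW => k; rewrite wdist_ge0/=.
have sphi := Ssm _ (Sphi k).
have i1 := rint_wdist mD bD mu_ mg intu sphi.
rewrite /wdist -(RintegralZl _ mD i1).
apply: (le_Rintegral mD (rint_wdist mD bD m1 m2 int1 (smoothM seta sphi)) (rintZ C mD i1)).
move=> x Dx; rewrite (nablaM _ seta sphi).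
have -> : eta x * phi k x - eta x * u x = eta x * (phi k x - u x) by ring.
have -> : eta x *: nabla (phi k) x + phi k x *: nabla eta x - (eta x *: g x + u x *: nabla eta x) =
  eta x *: (nabla (phi k) x - g x) + (phi k x - u x) *: nabla eta x.
  by apply/rowP => i; rewrite !mxE; ring.
exact: key.
Qed.

(** Small multiples of 1 and large multiples of p-th powers bound first powers:
    a substitute for Holder's inequality. *)
Lemma le_wdens (t a : R) (z : 'rV[R]_n) : 0 < t ->
  `|a| + enorm z <= 2 * t + t `^ (1 - p) * wdens p a z.
Proof.
move=> t0; have h1 := le_small_powR (ltW p1) (normr_ge0 a) t0.
have h2 := le_small_powR (ltW p1) (enorm_ge0 z) t0.
by apply: le_trans (lerD h1 h2) _; rewrite addrACA -mulrDr mulr_natl mulr2n.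
Qed.

Lemma wdens_L1loc D u g : measurable D -> measurable_fun D u -> measurable_fun D g ->
  rint D (fun x => wdens p (u x) (g x)) -> L1loc D u /\ forall i, L1loc D (fun x => g x 0 i).
Proof.
move=> mD mu_ mg intug.
have dom K : compact K -> K `<=` D -> rint K (fun x => 2 * 1 + 1 `^ (1 - p) * wdens p (u x) (g x)).
  move=> cK KD; have mK := compact_measurable_rV cK.
  apply: rintD => //; last by apply: rintZ => //; exact: (integrableS mD mK KD intug).
  by apply: rint_cst => //; apply: bounded_lebesgue_lty => //; exact: compact_bounded.
split => [|i]; split; try exact: mu_; try exact: measurable_rV_coord.
  move=> K cK KD; have mK := compact_measurable_rV cK.
  apply: (rint_le mK _ (dom K cK KD)); first exact: measurable_funS mu_.
  by move=> x Kx; apply: le_trans (le_wdens _ _ ltr01); rewrite lerDl enorm_ge0.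
move=> K cK KD; have mK := compact_measurable_rV cK.
apply: (rint_le mK _ (dom K cK KD)).
  by apply: measurable_rV_coord; exact: measurable_funS mg.
move=> x Kx; apply: le_trans (le_wdens _ _ ltr01).
by rewrite ler_wpDl// coord_le_enorm.
Qed.

(** First t is chosen small, then k large. *)
Lemma cvg_le_eps (c C : R) (d : nat -> R) : 0 <= c -> d @ \oo --> 0 ->
  (forall (t : R) k, 0 < t -> c <= C * t + t `^ (1 - p) * d k) -> c = 0.
Proof.
move=> c0 dk h; apply/eqP; rewrite eq_le c0 andbT; apply/ler_addgt0Pr => e e0; rewrite add0r.
pose t := e / (2 * (`|C| + 1)).
have C1 : 0 < `|C| + 1 by rewrite ltr_wpDl.
have t0 : 0 < t by rewrite divr_gt0// mulr_gt0.
have s0 : 0 < t `^ (1 - p) by exact: powR_gt0.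
have e2 : 0 < e / 2 / t `^ (1 - p) by rewrite !divr_gt0.
have [k _ dke] : \forall k \near \oo, `|0 - d k| < e / 2 / t `^ (1 - p).
  by move/cvgrPdist_lt : dk; exact.
have := dke k (leqnn k); rewrite sub0r normrN ltr_pdivlMr// => dke'.
apply: le_trans (h t k t0) _; rewrite [leRHS](splitr e); apply: lerD.
  apply: (@le_trans _ _ (`|C| * t)); first by rewrite ler_wpM2r ?ler_norm ?(ltW t0).
  by rewrite /t mulrA ler_pdivrMr ?mulr_gt0//; nra.
apply: ltW; apply: le_lt_trans dke'; rewrite mulrC ler_wpM2r ?(ltW s0)//; exact: ler_norm.
Qed.

(** Integration by parts against a fixed test function passes to the limit. *)
Lemma Wclosure_weak_gradient S D u g : measurable D -> bounded_set D -> S `<=` smooth ->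
  Wclosure S D u g -> is_weak_gradient D u g.
Proof.
move=> mD bD Ssm [mu_ mg intug [phi [Sphi cphi]]].
have [uL gL] := wdens_L1loc mD mu_ mg intug.
split => // psi tpsi i; have tdpsi := test_function_partial i tpsi.
have [C1 C10 psiC] := test_function_bounded tpsi.
have [C2 C20 dpsiC] := test_function_bounded tdpsi.
have i1 := L1loc_test_integrable mD uL tdpsi.
have i2 := L1loc_test_integrable mD (gL i) tpsi.
apply/eqP; rewrite -addr_eq0 -(RintegralD mD i1 i2) -normr_eq0; apply/eqP.
have lD : (mu D < +oo)%E by exact: bounded_lebesgue_lty.
pose C := C1 + C2; have C0 : 0 <= C by rewrite addr_ge0.
apply: (cvg_le_eps (C := C * (2 * fine (mu D))) (d := fun k => C * wdist D u g (phi k))) => //.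
  have cC : (fun k => C * wdist D u g (phi k)) @ \oo --> C * 0 by apply: cvgM; [exact: cvg_cst|exact: cphi].
  by rewrite mulr0 in cC.
move=> t k t0; have sphi := Ssm _ (Sphi k).
have [wL dwL wE] := smooth_weak_gradient mD sphi.
have j1 := L1loc_test_integrable mD wL tdpsi.
have j2 := L1loc_test_integrable mD (dwL i) tpsi.
have w0 : \int[mu]_(x in D) (phi k x * partial i psi x + nabla (phi k) x 0 i * psi x) = 0.
  by rewrite (RintegralD mD j1 j2) (wE _ tpsi) addNr.
have intw := rint_wdist mD bD mu_ mg intug sphi.
rewrite -[X in `|X|]subr0 -w0 -(RintegralB mD (rintD mD i1 i2) (rintD mD j1 j2)).
have ii := rintB mD (rintD mD i1 i2) (rintD mD j1 j2).
apply: le_trans (le_normr_Rintegral mD ii) _.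
have ib : rint D (fun x => C * (2 * t + t `^ (1 - p) * wdens p (phi k x - u x) (nabla (phi k) x - g x))).
  by apply: (rintZ _ mD); apply: (rintD mD (rint_cst _ mD lD)); exact: (rintZ _ mD intw).
apply: le_trans (le_Rintegral mD (rint_abs mD ii) ib _) _.
  move=> x Dx.
  rewrite (_ : _ - _ = - ((phi k x - u x) * partial i psi x + (nabla (phi k) x - g x) 0 i * psi x)); last first.
    by rewrite [(nabla (phi k) x - g x) 0 i]mxE [(- g x) 0 i]mxE; ring.
  rewrite normrN; apply: le_trans (ler_normD _ _) _; rewrite !normrM.
  apply: (@le_trans _ _ (C * (`|phi k x - u x| + enorm (nabla (phi k) x - g x)))).
    rewrite mulrDr; apply: lerD; rewrite mulrC.
      by rewrite ler_wpM2r// (le_trans (dpsiC x))// lerDr.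
    apply: ler_pM => //; [by rewrite (le_trans (psiC x))// lerDl|exact: coord_le_enorm].
  by rewrite ler_wpM2l//; exact: le_wdens.
have ic := rint_cst (2 * t) mD lD; have iw := rintZ (t `^ (1 - p)) mD intw.
rewrite (RintegralZl _ mD (rintD mD ic iw)) (RintegralD mD ic iw) Rintegral_cst//.
rewrite (RintegralZl _ mD intw) mulrDr lerD// le_eqVlt; apply/orP; left; apply/eqP.
  by ring.
by rewrite /wdist; ring.
Qed.

Lemma ae_all_coord D g h : (forall i, ae_eq mu D (fun x => g x 0 i) (fun x => h x 0 i)) ->
  ae_eq mu D g h.
Proof.
move=> gh; have /filterS : {ae mu, forall x, forall i, D x -> g x 0 i = h x 0 i}.
  exact: (filter_forall _ gh).
by apply => x /= gx Dx; apply/rowP => i; exact: gx.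
Qed.

Lemma grad_weak_gradient D u g : is_weak_gradient D u g -> is_weak_gradient D u (grad D u).
Proof. by move=> ug; rewrite /grad; apply: xgetPex; exists g. Qed.

Lemma grad_ae D u g : open D -> is_weak_gradient D u g -> ae_eq mu D (grad D u) g.
Proof.
move=> oD ug; apply: ae_all_coord => i.
exact: (weak_gradient_unique oD (grad_weak_gradient ug) ug i).
Qed.

Lemma weak_gradient_measurable D u g : measurable D -> is_weak_gradient D u g -> measurable_fun D g.
Proof. by move=> mD [_ gL _]; apply: measurable_rVP => // i; case: (gL i). Qed.

Lemma grad_measurable D u g : measurable D -> is_weak_gradient D u g -> measurable_fun D (grad D u).
Proof. by move=> mD /grad_weak_gradient; exact: weak_gradient_measurable. Qed.

Lemma W1p_rint D u : open D -> bounded_set D -> W1p p D u ->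
  [/\ is_weak_gradient D u (grad D u), measurable_fun D u, measurable_fun D (grad D u) &
   rint D (fun x => wdens p (u x) (grad D u x))].
Proof.
move=> oD bD [uLp [g ug gLp]]; have mD := open_measurable_rV oD.
have ug' := grad_weak_gradient ug; have mg := grad_measurable mD ug.
have mg0 := weak_gradient_measurable mD ug.
have /(LpP p1 _ mD)[mu_ intu] := uLp.
split; [exact: ug'|exact: mu_|exact: mg|].
have intg0 : rint D (fun x => enorm (g x) `^ p).
  by apply/(rint_enorm_powR p1 mD mg0) => i; have /(LpP p1 _ mD)[] := gLp i.
have intg : rint D (fun x => enorm (grad D u x) `^ p).
  apply: (rint_ae mD intg0).
    by apply: (measurableT_comp (measurable_powR p)); exact: measurable_enorm.
  by apply: filterS (grad_ae oD ug) => x /= E Dx; rewrite E.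
exact: (rintD mD intu intg).
Qed.

Lemma wdens_W1p D u g : open D -> bounded_set D -> is_weak_gradient D u g ->
  measurable_fun D u -> measurable_fun D g -> rint D (fun x => wdens p (u x) (g x)) ->
  W1p p D u /\ Wnorm p D u =
    ((\int[mu]_(x in D) `|u x| `^ p) `^ p^-1 + (\int[mu]_(x in D) enorm (g x) `^ p) `^ p^-1)%:E.
Proof.
move=> oD bD ug mu_ mg intug; have mD := open_measurable_rV oD.
have [intu intg] := rint_wdens mD mu_ mg intug.
split.
  split; first exact/(LpP p1 _ mD).
  exists g => // i; apply/(LpP p1 _ mD); split; first exact: measurable_rV_coord.
  by have /(rint_enorm_powR p1 mD mg) := intg.
rewrite /Wnorm EFinD (Lp_norm_EFin p1 mD intu); congr (_ + _)%E.
have mgr := grad_measurable mD ug.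
rewrite (@Lp_norm_ae _ _ _ p1 D _ (fun x => enorm (g x)) mD).
- have E : (fun x => `|enorm (g x)| `^ p) = (fun x => enorm (g x) `^ p).
    by apply/funext => x; rewrite ger0_norm// enorm_ge0.
  have intge : rint D (fun x => `|enorm (g x)| `^ p) by rewrite E.
  by rewrite (Lp_norm_EFin p1 mD intge) E.
- exact: measurable_enorm.
- exact: measurable_enorm.
by apply: filterS (grad_ae oD ug) => x /= E Dx; rewrite E.
Qed.

Lemma Wclosure_W1p S D u g : open D -> bounded_set D -> S `<=` smooth -> Wclosure S D u g ->
  W1p p D u /\ Wnorm p D u =
    ((\int[mu]_(x in D) `|u x| `^ p) `^ p^-1 + (\int[mu]_(x in D) enorm (g x) `^ p) `^ p^-1)%:E.
Proof.
move=> oD bD Ssm ug; have [mu_ mg intug _] := ug.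
exact: wdens_W1p (Wclosure_weak_gradient (open_measurable_rV oD) bD Ssm ug) mu_ mg intug.
Qed.

(** Convergence to 0 of the integral of the density is convergence to 0 of the
    norm of W^{1,p}, where each part carries the exponent 1/p. *)
Lemma cvg_Wnorm0 (I : Type) (F : set_system I) {FF : Filter F} (a b : I -> R) :
  (forall i, 0 <= a i) -> (forall i, 0 <= b i) ->
  (fun i => a i + b i) @ F --> 0 <->
  (fun i => (a i `^ p^-1 + b i `^ p^-1)%:E) @ F --> 0%E.
Proof.
move=> a0 b0; have pV0 : 0 < p^-1 by rewrite invr_gt0.
split => [cab|/fine_cvgP[_ cab]].
  apply: cvg_EFin; first exact: nearW.
  rewrite -(addr0 0); apply: cvgD; apply: cvg_powRV0 => //.
    by apply: (squeeze0 (C := 1) _ cab); apply: nearW => i; rewrite a0/= mul1r lerDl b0.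
  by apply: (squeeze0 (C := 1) _ cab); apply: nearW => i; rewrite b0/= mul1r lerDr a0.
have back (c : I -> R) : (forall i, 0 <= c i) -> (forall i, c i `^ p^-1 <= a i `^ p^-1 + b i `^ p^-1) ->
    c @ F --> 0.
  move=> c0 cle; have cV : (fun i => c i `^ p^-1) @ F --> 0.
    by apply: (squeeze0 (C := 1) _ cab); apply: nearW => i; rewrite powR_ge0/= mul1r.
  have -> : c = fun i => (c i `^ p^-1) `^ p.
    by apply/funext => i; rewrite -powRrM mulVf ?gt_eqF// powRr1.
  by apply: cvg_powRV0 => // i; exact: powR_ge0.
rewrite -(addr0 0); apply: cvgD; apply: back => // i; first by rewrite lerDl powR_ge0.
by rewrite lerDr powR_ge0.
Qed.

Lemma W1p0_Wclosure D u : open D -> bounded_set D -> W1p0 p D u ->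
  Wclosure (test_function D) D u (grad D u).
Proof.
move=> oD bD [phi [tphi [_ uW cphi]]]; have mD := open_measurable_rV oD.
have [ug mu_ mg intug] := W1p_rint oD bD uW.
split; [exact: mu_|exact: mg|exact: intug|exists phi; split; first exact: tphi].
have sphi k : smooth (phi k) := (tphi k).1.
have intw k := rint_wdist mD bD mu_ mg intug (sphi k).
have mw k : measurable_fun D (fun x => phi k x - u x).
  by apply: measurable_funB => //; exact: smooth_measurable.
have mgw k : measurable_fun D (fun x => nabla (phi k) x - grad D u x).
  by apply: rV_measurableB => //; exact: measurable_nabla.
have wk k := wdens_W1p oD bD (weak_gradientB mD (smooth_weak_gradient mD (sphi k)) ug)
  (mw k) (mgw k) (intw k).
have -> : (fun k => wdist D u (grad D u) (phi k)) =
    fun k => \int[mu]_(x in D) `|phi k x - u x| `^ p + \int[mu]_(x in D) enorm (nabla (phi k) x - grad D u x) `^ p.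
  apply/funext => k; have [i1 i2] := rint_wdens mD (mw k) (mgw k) (intw k).
  exact: (Rintegral_wdens mD i1 i2).
apply/cvg_Wnorm0.
- by move=> k; apply: Rintegral_ge0 => x _; exact: powR_ge0.
- by move=> k; apply: Rintegral_ge0 => x _; exact: powR_ge0.
move: cphi; congr (_ @ \oo --> 0%E); apply/funext => k.
by rewrite (wk k).2.
Qed.

Lemma Wclosure_W1p0 D u g : open D -> bounded_set D -> Wclosure (test_function D) D u g -> W1p0 p D u.
Proof.
move=> oD bD ug; have [mu_ mg intug [phi [tphi cphi]]] := ug.
have mD := open_measurable_rV oD.
have sphi k : smooth (phi k) := (tphi k).1.
have tsm : test_function D `<=` smooth by move=> ? [].
exists phi; split; first exact: tphi.
have intw k := rint_wdist mD bD mu_ mg intug (sphi k).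
have mw k : measurable_fun D (fun x => phi k x - u x).
  by apply: measurable_funB => //; exact: smooth_measurable.
have mgw k : measurable_fun D (fun x => nabla (phi k) x - g x).
  by apply: rV_measurableB => //; exact: measurable_nabla.
have wug := Wclosure_weak_gradient mD bD tsm ug.
have wk k := wdens_W1p oD bD (weak_gradientB mD (smooth_weak_gradient mD (sphi k)) wug)
  (mw k) (mgw k) (intw k).
split.
- apply: nearW => k; have := @Wclosure_self smooth D (phi k) mD bD (sphi k) (sphi k).
  by move=> /(Wclosure_W1p oD bD (fun _ => id))[].
- by have [] := Wclosure_W1p oD bD tsm ug.
have -> : (fun k => Wnorm p D (fun x => phi k x - u x)) = fun k =>
    ((\int[mu]_(x in D) `|phi k x - u x| `^ p) `^ p^-1 +
     (\int[mu]_(x in D) enorm (nabla (phi k) x - g x) `^ p) `^ p^-1)%:E.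
  by apply/funext => k; rewrite (wk k).2.
apply/cvg_Wnorm0.
- by move=> k; apply: Rintegral_ge0 => x _; exact: powR_ge0.
- by move=> k; apply: Rintegral_ge0 => x _; exact: powR_ge0.
move: cphi; congr (_ @ \oo --> 0); apply/funext => k.
have [i1 i2] := rint_wdens mD (mw k) (mgw k) (intw k).
exact: (Rintegral_wdens mD i1 i2).
Qed.

End sobolev_approximation.

(** * Integration over cylinders *)

Section cylinder_geometry.
Context {R : realType} {r m : nat}.
Implicit Types (W : set 'rV[R]_r) (V : set 'rV[R]_m).
Local Notation mu := (@lebesgue_rV R (r + m)).
Local Notation mu1 := (@lebesgue_rV R r).
Local Notation mu2 := (@lebesgue_rV R m).

Lemma open_cylinder W V : open W -> open V -> open (cylinder W V).
Proof.
move=> oW oV; rewrite (_ : cylinder W V = @lsubmx R 1 r m @^-1` W `&` @rsubmx R 1 r m @^-1` V)//.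
apply: openI; apply: open_comp => // x _; [exact: continuous_lsubmx|exact: continuous_rsubmx].
Qed.

Lemma bounded_cylinder W V : bounded_set W -> bounded_set V -> bounded_set (cylinder W V).
Proof.
move=> /bounded_le[M M0 WM] /bounded_le[N N0 VN].
exists (r%:R * M + m%:R * N); split; first exact: num_real.
move=> K MK x [Wx Vx]; apply: ltW; apply: le_lt_trans MK.
apply: le_trans (norm_le_enorm x) _; apply: le_trans (enorm_le_lrsub x) _; apply: lerD.
  by apply: le_trans (enorm_le_norm _) _; rewrite ler_wpM2l//; exact: WM.
by apply: le_trans (enorm_le_norm _) _; rewrite ler_wpM2l//; exact: VN.
Qed.

Lemma measurable_lsubmx D : measurable_fun D (@lsubmx R 1 r m).
Proof.
apply: measurable_funS measurableT (@subsetT _ D) _.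
by apply: measurable_fun_rVP => i; under eq_fun do rewrite mxE; exact: measurable_coord.
Qed.

Lemma measurable_rsubmx D : measurable_fun D (@rsubmx R 1 r m).
Proof.
apply: measurable_funS measurableT (@subsetT _ D) _.
by apply: measurable_fun_rVP => i; under eq_fun do rewrite mxE; exact: measurable_coord.
Qed.

Lemma measurable_cylinder W V : measurable W -> measurable V -> measurable (cylinder W V).
Proof.
move=> mW mV; apply: measurableI.
  by rewrite -[X in measurable X]setTI; exact: (measurable_lsubmx measurableT).
by rewrite -[X in measurable X]setTI; exact: (measurable_rsubmx measurableT).
Qed.

Lemma measurable_from_rsub d (T : measurableType d) W V (h : 'rV[R]_m -> T) : measurable V ->
  measurable_fun V h -> measurable_fun (cylinder W V) (from_rsub h).
Proof.
move=> mV mh; apply: (measurable_comp mV _ mh (@measurable_rsubmx _)).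
by move=> _ [x [_ Vx] <-].
Qed.

Lemma measurable_from_lsub d (T : measurableType d) W V (h : 'rV[R]_r -> T) : measurable W ->
  measurable_fun W h -> measurable_fun (cylinder W V) (fun x => h (lsubmx x)).
Proof.
move=> mW mh; apply: (measurable_comp mW _ mh (@measurable_lsubmx _)).
by move=> _ [x [Wx _] <-].
Qed.

Lemma cylinder_row W V (x : 'rV[R]_r) (y : 'rV[R]_m) :
  cylinder W V (row_mx x y) = (W x /\ V y).
Proof. by rewrite /cylinder/= row_mxKl row_mxKr. Qed.

Lemma patch_cylinder_row (f : 'rV[R]_(r + m) -> \bar R) W V x y :
  (f \_ (cylinder W V)) (row_mx x y) = if x \in W then ((fun z => f (row_mx x z)) \_ V) y else 0%E.
Proof.
rewrite /patch; case: ifPn => [/set_mem|].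
  by rewrite cylinder_row => -[Wx Vy]; rewrite !mem_set.
rewrite notin_setE cylinder_row => h; case: ifPn => // /set_mem Wx; case: ifPn => // /set_mem Vy.
by exfalso; apply: h.
Qed.

(** Tonelli's theorem: the inner integral over x'' is the same for all x' in W. *)
Lemma integral_from_rsub W V (h : 'rV[R]_m -> R) : measurable W -> measurable V ->
  measurable_fun V h -> (forall y, V y -> 0 <= h y) ->
  (\int[mu]_(x in cylinder W V) (from_rsub h x)%:E = (\int[mu2]_(y in V) (h y)%:E) * mu1 W)%E.
Proof.
move=> mW mV mh h0; have mC := measurable_cylinder mW mV.
rewrite integral_mkcond tonelli_rV; first last.
- by move=> x; rewrite /patch; case: ifPn => // /set_mem[_ Vx]; rewrite lee_fin h0.
- apply/(measurable_restrictT _ mC); apply/measurable_EFinP; exact: measurable_from_rsub.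
rewrite -(integral_cst mu1 mW) [RHS]integral_mkcond; apply: eq_integral => x _.
rewrite [RHS]/patch; under eq_integral do rewrite patch_cylinder_row.
case: ifPn => _; last by rewrite integral0.
rewrite [RHS]integral_mkcond; apply: eq_integral => y _.
by rewrite /patch; case: ifPn => // _; rewrite /from_rsub row_mxKr.
Qed.

Lemma rint_from_rsub W V (h : 'rV[R]_m -> R) : measurable W -> (mu1 W < +oo)%E -> measurable V ->
  (forall y, V y -> 0 <= h y) ->
  mu2.-integrable V (EFin \o h) -> mu.-integrable (cylinder W V) (EFin \o from_rsub h) /\
   \int[mu]_(x in cylinder W V) from_rsub h x = fine (mu1 W) * \int[mu2]_(y in V) h y.
Proof.
move=> mW fW mV h0 inth; have mh := rint_measurable inth.
have E := integral_from_rsub mW mV mh h0.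
have fW' : mu1 W \is a fin_num by rewrite ge0_fin_numE.
split; last first.
  by rewrite /Rintegral [X in fine X]E -(EFin_Rintegral mV inth) fineM// mulrC.
apply/integrableP; split; first by apply/measurable_EFinP; exact: measurable_from_rsub.
rewrite (_ : (\int[mu]_(x in _) _)%E = \int[mu]_(x in cylinder W V) (from_rsub h x)%:E)%E.
  by rewrite E -(EFin_Rintegral mV inth) -(fineK fW') -EFinM ltry.
by apply: eq_integral => x /set_mem[_ Vx]; rewrite /= ger0_norm// h0.
Qed.

End cylinder_geometry.
(** * Functions on cylinders and Poincare's inequality *)

Section cylinder_functions.
Context {R : realType} {r m : nat}.
Implicit Types (W : set 'rV[R]_r) (V : set 'rV[R]_m).
Local Notation mu := (@lebesgue_rV R (r + m)).
Local Notation mu1 := (@lebesgue_rV R r).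
Local Notation mu2 := (@lebesgue_rV R m).
Local Notation rint D f := (mu.-integrable D (EFin \o f)).
Variable p : R.
Hypothesis p1 : 1 < p.
Variable i0 : 'I_m.

Let p0 : 0 < p. Proof. exact: lt_trans p1. Qed.

(** This contains the test functions of the cylinders over V as well as the
    functions of x'' lifted from test functions of V; Poincare's inequality in x''
    holds for both, and thus for their differences. *)
Definition lateral V : set ('rV[R]_(r + m) -> R) :=
  [set phi | smooth phi /\ forall x, ~ V (rsubmx x) -> phi x = 0].

Lemma smooth_from_rsub (psi : 'rV[R]_m -> R) : smooth psi -> smooth (@from_rsub R r m _ psi).
Proof. exact: (smooth_coordinate_map (coordinate_map_rsub r i0)). Qed.

Lemma nabla_from_rsub (psi : 'rV[R]_m -> R) (x : 'rV[R]_(r + m)) : smooth psi ->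
  nabla (from_rsub psi) x = row_mx 0 (nabla psi (rsubmx x)).
Proof.
move=> spsi; apply/rowP => j; rewrite mxE.
apply: (etrans (partial_coordinate_map j x (coordinate_map_rsub r i0) spsi)).
rewrite /rsub_index; case: (split_ordP j) => k ->; rewrite ?(row_mxEl, row_mxEr) !mxE ?mul0r ?mul1r//.
Qed.

Lemma test_function_lateral W V phi : test_function (cylinder W V) phi -> lateral V phi.
Proof.
move=> tphi; split; first exact: tphi.1.
by move=> x Vx; apply: (test_function_out tphi) => -[].
Qed.

Lemma from_rsub_lateral V (psi : 'rV[R]_m -> R) : test_function V psi -> lateral V (from_rsub psi).
Proof.
move=> tpsi; split; first exact: (smooth_from_rsub tpsi.1).
by move=> x Vx; exact: (test_function_out tpsi).
Qed.

Lemma smooth_slice phi (x : 'rV[R]_r) : smooth phi -> smooth (fun y : 'rV[R]_m => phi (row_mx x y)).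
Proof. exact: (smooth_coordinate_map (coordinate_map_slice m x)). Qed.

Lemma nabla_slice phi (x : 'rV[R]_r) (y : 'rV[R]_m) : smooth phi ->
  nabla (fun y : 'rV[R]_m => phi (row_mx x y)) y = rsubmx (nabla phi (row_mx x y)).
Proof.
move=> sphi; apply/rowP => j; rewrite !mxE.
apply: (etrans (partial_coordinate_map j y (coordinate_map_slice m x) sphi)).
by rewrite mul1r.
Qed.

Lemma test_function_slice W V phi (x : 'rV[R]_r) : test_function (cylinder W V) phi ->
  test_function V (fun y => phi (row_mx x y)).
Proof.
move=> [sphi [K [cK KD phi0]]]; split; first exact: smooth_slice.
exists (@rsubmx R 1 r m @` K); split.
- apply: continuous_compact => //; apply: continuous_subspaceT; exact: continuous_rsubmx.
- by move=> _ [z /KD[_ ?] <-].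
- by move=> y Ky; apply: phi0 => Kxy; apply: Ky; exists (row_mx x y) => //; rewrite row_mxKr.
Qed.

Lemma measurable_row0 D (g : 'rV[R]_(r + m) -> 'rV[R]_m) : measurable D -> measurable_fun D g ->
  measurable_fun D (fun x => row_mx (0 : 'rV[R]_r) (g x)).
Proof.
move=> mD mg; apply: measurable_rVP => // j; case: (split_ordP j) => k ->.
  by under eq_fun do rewrite row_mxEl mxE; exact: measurable_cst.
by under eq_fun do rewrite row_mxEr; exact: measurable_rV_coord.
Qed.

Lemma rint_enorm_rsubmx D (g : 'rV[R]_(r + m) -> 'rV[R]_(r + m)) : measurable D ->
  measurable_fun D g -> rint D (fun x => enorm (g x) `^ p) -> rint D (fun x => enorm (rsubmx (g x)) `^ p).
Proof.
move=> mD mg jg.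
have mr : measurable_fun D (fun x => rsubmx (g x)) := measurableT_comp (@measurable_rsubmx _ _ _ _) mg.
apply: (rint_le mD (measurableT_comp (measurable_powR p) (measurable_enorm mr)) jg) => x _.
rewrite (ger0_norm (powR_ge0 _ _)).
by apply: ler_powR_base; [exact: ltW|exact: enorm_ge0|exact: enorm_rsub_le].
Qed.

(** Lifting to the cylinder multiplies p-th powers of norms by the measure of W. *)
Lemma Wclosure_from_rsub S W V u g : measurable W -> bounded_set W -> open V -> bounded_set V ->
  S `<=` smooth -> Wclosure p S V u g ->
  Wclosure p [set (@from_rsub R r m _ psi) | psi in S] (cylinder W V) (from_rsub u)
    (fun x => row_mx 0 (from_rsub g x)).
Proof.
move=> mW bW oV bV Ssm [mu_ mg intu [phi [Sphi cphi]]].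
have mV := open_measurable_rV oV; have fW := bounded_lebesgue_lty mW bW.
have mD := measurable_cylinder mW mV.
have mgr := measurable_from_rsub (W := W) mV mg.
split.
- exact: measurable_from_rsub.
- exact: measurable_row0.
- under eq_fun do rewrite /wdens enorm_row0.
  exact: (rint_from_rsub mW fW mV (fun y _ => wdens_ge0 p _ _) intu).1.
exists (fun k => from_rsub (phi k)); split; first by move=> k; exists (phi k).
have E k : wdist p (cylinder W V) (from_rsub u) (fun x => row_mx 0 (from_rsub g x)) (from_rsub (phi k)) =
    fine (mu1 W) * wdist p V u g (phi k).
  have i1 := rint_wdist p1 mV bV mu_ mg intu (Ssm _ (Sphi k)).
  rewrite -(rint_from_rsub mW fW mV (fun y _ => wdens_ge0 p _ _) i1).2.
  apply: eq_Rintegral => x _; rewrite nabla_from_rsub; last exact: Ssm.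
  by rewrite opp_row_mx add_row_mx subr0 /wdens enorm_row0.
under eq_fun do rewrite E.
rewrite -(mulr0 (fine (mu1 W))); apply: cvgM cphi; exact: cvg_cst.
Qed.

Lemma normr_mul_powR2 (s : R) : `|s * `|s| `^ (p - 2)| = `|s| `^ (p - 1).
Proof.
have pm1 : 0 < p - 1 by rewrite subr_gt0.
rewrite normrM (ger0_norm (powR_ge0 _ _)); have [->|s0] := eqVneq s 0.
  by rewrite normr0 mul0r powR0// gt_eqF.
rewrite -{1}[`|s|]powRr1// -powRD ?normr_eq0 ?(negPf s0) ?implybT//.
by congr (_ `^ _); lra.
Qed.

(** The inequality behind Poincare's: with y the coordinate x_i and z the partial
    derivative of s, the factor of 2 is the i-th derivative of x_i |s|^p. *)
Lemma poincare_pointwise (M : R) : 0 < M -> exists2 C : R, 0 <= C & forall s y z, `|y| <= M ->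
  `|s| `^ p <= 2 * (`|s| `^ p + y * (p * (s * `|s| `^ (p - 2)) * z)) + C * `|z| `^ p.
Proof.
move=> M0; have pm1 : 0 < p - 1 by rewrite subr_gt0.
have q0 : 0 < p / (p - 1) by rewrite divr_gt0.
have pq : (p / (p - 1))^-1 + p^-1 = 1 by field; rewrite !gt_eqF.
pose e := (2 * (M * p))^-1; have Mp : 0 < M * p by exact: mulr_gt0.
have e0 : 0 < e by rewrite invr_gt0 mulr_gt0.
have [C C0 young] := young_eps q0 p0 pq e0.
exists (2 * (M * p) * C); first by rewrite !mulr_ge0// ?(ltW M0) ?(ltW p0).
move=> s y z yM.
have -> : `|s| `^ p = (`|s| `^ (p - 1)) `^ (p / (p - 1)).
  by rewrite -powRrM mulrCA divff ?mulr1// gt_eqF.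
have h := young _ _ (powR_ge0 `|s| (p - 1)) (normr_ge0 z).
have E := normr_mul_powR2 s.
move: (`|s| `^ (p - 1)) E h => t E; set T := t `^ _; set Z := `|z| `^ p => h.
have : `|y * (p * (s * `|s| `^ (p - 2)) * z)| <= M * p * (t * `|z|).
  rewrite normrM normrM normrM E (gtr0_norm p0).
  have -> : M * p * (t * `|z|) = M * (p * t * `|z|) by ring.
  by rewrite ler_wpM2r// !mulr_ge0// ?(ltW p0)// -E.
have h2 : M * p * (t * `|z|) <= M * p * (e * T + C * Z) by rewrite ler_wpM2l// ltW.
have eE : M * p * (e * T) = T / 2 by rewrite /e; field; rewrite !gt_eqF.
rewrite ler_norml => /andP[h3 _]; rewrite mulrDr eE in h2.
have : 2 * (M * p) * C * Z = 2 * (M * p * (C * Z)) by ring.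
move: (M * p * (C * Z)) (M * p * (t * _)) h2 h3 => A B; clear -A; move: (y * _) (_ * Z) => D G; lra.
Qed.

Lemma is_derive_poincare (b : R) phi (i : 'I_(r + m)) (x : 'rV[R]_(r + m)) : smooth phi ->
  is_derive (0 : R) 1 (fun t : R => b * ((t *: delta_mx 0 i + x) 0 i * `|phi (t *: delta_mx 0 i + x)| `^ p))
    (b * (`|phi x| `^ p + x 0 i * (p * (phi x * `|phi x| `^ (p - 2)) * partial i phi x))).
Proof.
move=> sphi; have /is_derive_line0 dphi := smooth_is_derive i x sphi.
have d1 : is_derive (0 : R) 1 (fun t : R => `|phi (t *: delta_mx 0 i + x)| `^ p)
    (p * (phi x * `|phi x| `^ (p - 2)) * partial i phi x).
  apply: (@is_derive1_comp _ (fun t : R => `|t| `^ p) (fun t : R => phi (t *: delta_mx 0 i + x)) 0 _ _ _ dphi).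
  by rewrite scale0r add0r; exact: is_derive_norm_powR.
have d2 : is_derive (0 : R) 1 (fun t : R => (t *: delta_mx 0 i + x) 0 i) 1.
  rewrite (_ : (fun t : R => _) = (fun t : R => t + x 0 i)); last first.
    by apply/funext => t; rewrite !mxE !eqxx mulr1.
  by rewrite -[X in is_derive _ _ _ X]addr0; apply: is_deriveD.
have d12 := is_deriveM d2 d1.
have d0 := is_deriveM (is_derive_cst b (0 : R) (1 : R)) d12.
move: d0; congr (is_derive _ _ _ _).
rewrite /= !scale0r !add0r.
rewrite -![_ *: _]/(_ * _).
ring.
Qed.

Lemma lsubmx_shift (t : R) (x : 'rV[R]_(r + m)) :
  lsubmx (t *: delta_mx 0 (rshift r i0) + x) = lsubmx x.
Proof. by apply/rowP => j; rewrite !mxE eq_lrshift mulr0 add0r. Qed.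

(** The weight is constant along a coordinate x_i of x'', so that the derivative
    of a(x') x_i |phi|^p has integral 0; C depends on p and on the bound of
    |x_i| over V only. *)
Lemma poincare_smooth V : open V -> bounded_set V -> exists2 C : R, 0 <= C &
  forall W (a : 'rV[R]_r -> R) (c : R) phi, measurable W -> bounded_set W ->
  measurable_fun W a -> (forall x, W x -> 0 <= a x <= c) -> lateral V phi ->
  \int[mu]_(x in cylinder W V) (a (lsubmx x) * `|phi x| `^ p) <=
  C * \int[mu]_(x in cylinder W V) (a (lsubmx x) * enorm (rsubmx (nabla phi x)) `^ p).
Proof.
move=> oV bV; have [N N0 VN] := bounded_le bV.
have [C C0 pw] := poincare_pointwise N0; exists C => //.
move=> W a c phi mW bW ma a0 [sphi phi0]; have mV := open_measurable_rV oV.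
set D := cylinder W V; have mD : measurable D by exact: measurable_cylinder.
have bD : bounded_set D by exact: bounded_cylinder.
have [M M0 DM] := bounded_le bD.
pose i := rshift r i0; pose b : 'rV[R]_r -> R := a \_ W.
have [W0|/set0P[x0 Wx0]] := eqVneq W set0.
  rewrite /D W0; have -> : cylinder set0 V = set0 :> set 'rV[R]_(r + m) by apply/seteqP; split => x // -[].
  by rewrite !Rintegral_set0 mulr0.
have c0 : 0 <= c by have /andP[/le_trans] := a0 _ Wx0; apply.
have b0 x : 0 <= b x <= c.
  by rewrite /b /patch; case: ifPn => [/set_mem/a0//|_]; rewrite lexx.
pose k x := `|phi x| `^ p + x 0 i * (p * (phi x * `|phi x| `^ (p - 2)) * partial i phi x).
pose h (x : 'rV[R]_(r + m)) := b (lsubmx x) * (x 0 i * `|phi x| `^ p).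
pose dh x := b (lsubmx x) * k x.
have mb : measurable_fun [set: 'rV[R]_(r + m)] (fun x => b (lsubmx x)).
  have mb' : measurable_fun [set: 'rV[R]_r] b by exact/(measurable_restrictT _ mW).
  exact: (measurableT_comp mb' (@measurable_lsubmx _ _ _ _)).
have mphi := smooth_measurable (D := setT) sphi.
have sdphi := smooth_partial i sphi.
have mdphi := smooth_measurable (D := setT) sdphi.
have mpp : measurable_fun [set: 'rV[R]_(r + m)] (fun x => `|phi x| `^ p) by exact: measurable_norm_powR.
have mi : measurable_fun [set: 'rV[R]_(r + m)] (fun x => x 0 i) by exact: measurable_coord.
have mh : measurable_fun [set: 'rV[R]_(r + m)] h.
  exact: (measurable_funM mb (measurable_funM mi mpp)).
have mk : measurable_fun [set: 'rV[R]_(r + m)] k.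
  apply: (measurable_funD mpp); apply: (measurable_funM mi); apply: measurable_funM mdphi.
  apply: measurable_funM; first exact: measurable_cst.
  exact: (measurable_funM mphi (measurable_norm_powR (p - 2) mphi)).
have mdh : measurable_fun [set: 'rV[R]_(r + m)] dh by exact: (measurable_funM mb mk).
have out x : ~ D x -> h x = 0 /\ dh x = 0.
  move=> nD; rewrite /h /dh /k.
  have [Vx|/phi0 ->] := pselect (V (rsubmx x)); last first.
    by rewrite normr0 powR0 ?(gt_eqF p0)// !(mulr0, mul0r, addr0).
  by rewrite /b /patch memNset ?mul0r// => Wx; apply: nD.
have dhE x : is_derive x (delta_mx 0 i) h (dh x).
  apply/is_derive_line0; have := is_derive_poincare (b (lsubmx x)) i x sphi.
  congr (is_derive _ _ _ _); apply/funext => t; rewrite /h lsubmx_shift//.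
have [C1 C10 phiC] := continuous_bounded_on bD (smooth_continuous sphi).
have [C2 C20 dphiC] := continuous_bounded_on bD (smooth_continuous sdphi).
have xiM x : D x -> `|x 0 i| <= M by move=> /DM; apply: le_trans; exact: coord_le_norm.
have pC x : D x -> `|phi x| `^ p <= C1 `^ p by move=> Dx; apply: ler_powR_base => //; [exact: ltW|exact: phiC].
have pC' x : D x -> `|phi x| `^ (p - 1) <= C1 `^ (p - 1).
  by move=> Dx; apply: ler_powR_base => //; [rewrite subr_ge0 ltW|exact: phiC].
pose H := c * (M * C1 `^ p); pose H' := c * (C1 `^ p + M * (p * C1 `^ (p - 1) * C2)).
have hH x : `|h x| <= H.
  have [Dx|/out[-> _]] := pselect (D x); last first.
    by rewrite normr0 !mulr_ge0// ?powR_ge0// ltW.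
  have /andP[b1 b2] := b0 (lsubmx x).
  rewrite /h !normrM (ger0_norm b1) (ger0_norm (powR_ge0 _ _)).
  apply: ler_pM => //.
  by apply: ler_pM => //; [exact: xiM|exact: pC].
have dhH x : `|dh x| <= H'.
  have [Dx|/out[_ ->]] := pselect (D x); last first.
    by rewrite normr0 !mulr_ge0// addr_ge0// ?powR_ge0// !mulr_ge0// ?powR_ge0// ltW.
  have /andP[b1 b2] := b0 (lsubmx x).
  rewrite /dh /k normrM (ger0_norm b1); apply: ler_pM => //.
  apply: le_trans (ler_normD _ _) _; apply: lerD.
    by rewrite (ger0_norm (powR_ge0 _ _)) pC.
  rewrite !normrM -normrM normr_mul_powR2 (gtr0_norm p0).
  apply: ler_pM => //; [by rewrite !mulr_ge0// ?powR_ge0// ltW|exact: xiM|].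
  apply: ler_pM => //; [by rewrite mulr_ge0// ?powR_ge0// ltW| |exact: dphiC].
  by rewrite ler_wpM2l ?(ltW p0)// pC'.
have dh0 : \int[mu]_(x in D) dh x = 0.
  rewrite (Rintegral_restrict dh (@subsetT _ D)).
  have -> : dh \_ D = dh.
    by apply/funext => x; rewrite /patch; case: ifPn => //; rewrite notin_setE => /out[_ ->].
  apply: (integral_partial0 mh mdh dhE (M := M) (C := Num.max H H')).
  - by move=> x Mx; apply: (proj1 (out x _)) => /DM; rewrite leNgt Mx.
  - by move=> x; rewrite le_max hH.
  - by move=> x; rewrite le_max dhH orbT.
have fD : (mu D < +oo)%E by exact: bounded_lebesgue_lty.
have idh : rint D dh.
  have mdhD : measurable_fun D dh by apply: measurable_funS mdh.
  exact: (rint_le mD mdhD (rint_cst H' mD fD) (fun x _ => dhH x)).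
have maD : measurable_fun D (fun x => a (lsubmx x)) by exact: measurable_from_lsub.
have aD x : D x -> `|a (lsubmx x)| <= c by move=> [Wx _]; have /andP[a1 a2] := a0 _ Wx; rewrite ger0_norm.
have iphi := rint_wdens_smooth p1 mD bD sphi.
have [i1 i2] := rint_wdens mD (smooth_measurable sphi) (measurable_nabla mD sphi) iphi.
have j1 := rint_mulb mD i1 maD aD.
have i3 := rint_enorm_rsubmx mD (measurable_nabla mD sphi) i2.
have j3 := rint_mulb mD i3 maD aD.
rewrite -(RintegralZl _ mD j3) -[leRHS]add0r -[X in X + _](mulr0 2) -{1}dh0.
rewrite -(RintegralZl _ mD idh) -(RintegralD mD (rintZ 2 mD idh) (rintZ C mD j3)).
apply: (le_Rintegral mD j1 (rintD mD (rintZ 2 mD idh) (rintZ C mD j3))) => x Dx /=.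
have [Wx Vx] := Dx; have /andP[a1 _] := a0 _ Wx.
have ba : b (lsubmx x) = a (lsubmx x) by rewrite /b /patch mem_set.
rewrite /dh ba.
have -> : 2 * (a (lsubmx x) * k x) + C * (a (lsubmx x) * enorm (rsubmx (nabla phi x)) `^ p) =
  a (lsubmx x) * (2 * k x + C * enorm (rsubmx (nabla phi x)) `^ p) by ring.
apply: (ler_wpM2l a1).
have xi : `|x 0 i| <= N.
  have := le_trans (coord_le_norm (rsubmx x) i0) (VN _ Vx); by rewrite mxE.
apply: le_trans (pw (phi x) _ (partial i phi x) xi) _.
apply: lerD => //; apply: (ler_wpM2l C0); apply: ler_powR_base; [exact: ltW|exact: normr_ge0|].
by have := coord_le_enorm (rsubmx (nabla phi x)) i0; rewrite !mxE.
Qed.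

Lemma le_cvg0 (x A B : R) (d : nat -> R) : d @ \oo --> 0 -> (forall k, x <= A + B * d k) -> x <= A.
Proof.
move=> d0 h.
have c : (fun k => A + B * d k) @ \oo --> A.
  rewrite -[X in _ --> X]addr0 -[X in _ + X](mulr0 B).
  by apply: cvgD; [exact: cvg_cst|apply: cvgM => //; exact: cvg_cst].
exact: (cvgr_to_ge c (nearW _ h)).
Qed.

(** With the indicator function of a part of W for weight, this bounds w over the
    cylinder on that part by its gradient there, although w need not vanish on
    the rest of its boundary. *)
Lemma poincare V : open V -> bounded_set V -> exists2 C : R, 0 <= C &
  forall W (a : 'rV[R]_r -> R) (c : R) w g, measurable W -> bounded_set W ->
  measurable_fun W a -> (forall x, W x -> 0 <= a x <= c) ->
  Wclosure p (lateral V) (cylinder W V) w g ->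
  \int[mu]_(x in cylinder W V) (a (lsubmx x) * `|w x| `^ p) <=
  C * \int[mu]_(x in cylinder W V) (a (lsubmx x) * enorm (rsubmx (g x)) `^ p).
Proof.
move=> oV bV; have [C C0 poinc] := poincare_smooth oV bV.
pose T := 2 `^ p : R; have T0 : 0 <= T by exact: powR_ge0.
have chain (X A1 A2 A3 A4 A5 c t k : R) : 0 <= t -> 0 <= k -> X <= t * A1 + t * A3 ->
    A2 <= t * A4 + t * A3 -> A3 <= c * A5 -> A1 <= k * A2 ->
    X <= t * k * t * A4 + t * (k * t + 1) * c * A5.
  move=> t0 k0 s1 s2 s3 s4; have t1 : t * A1 <= t * (k * A2) by exact: ler_wpM2l.
  have t2 : t * (k * A2) <= t * (k * (t * A4 + t * A3)) by do 2 apply: ler_wpM2l => //.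
  have t3 : t * (k * t + 1) * A3 <= t * (k * t + 1) * (c * A5).
    by apply: ler_wpM2l => //; rewrite mulr_ge0// addr_ge0// mulr_ge0.
  by lra.
exists (T * C * T); first by rewrite !mulr_ge0.
move=> W a c w g mW bW ma a0 [mw mg intw [phi [lphi cphi]]].
have mV := open_measurable_rV oV; set D := cylinder W V.
have mD : measurable D by exact: measurable_cylinder.
have bD : bounded_set D by exact: bounded_cylinder.
have maD : measurable_fun D (fun x => a (lsubmx x)) by exact: measurable_from_lsub.
have aD x : D x -> `|a (lsubmx x)| <= c by move=> [Wx _]; have /andP[a1 a2] := a0 _ Wx; rewrite ger0_norm.
have [iw ig] := rint_wdens mD mw mg intw.
have jw := rint_mulb mD iw maD aD.
have jg := rint_mulb mD (rint_enorm_rsubmx mD mg ig) maD aD.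
apply: (le_cvg0 (B := T * (C * T + 1) * c) cphi) => k.
have sphi := (lphi k).1; have intd := rint_wdist p1 mD bD mw mg intw sphi.
have iphi := rint_wdens_smooth p1 mD bD sphi.
have mphi := smooth_measurable (D := D) sphi; have mnphi := measurable_nabla mD sphi.
have [i1 i2] := rint_wdens mD mphi mnphi iphi.
have j1 := rint_mulb mD i1 maD aD; have j2 := rint_mulb mD (rint_enorm_rsubmx mD mnphi i2) maD aD.
have j3 := rint_mulb mD intd maD aD.
have s1 : \int[mu]_(x in D) (a (lsubmx x) * `|w x| `^ p) <=
    T * \int[mu]_(x in D) (a (lsubmx x) * `|phi k x| `^ p) + T * \int[mu]_(x in D)
      (a (lsubmx x) * wdens p (phi k x - w x) (nabla (phi k) x - g x)).
  rewrite -(RintegralZl _ mD j1) -(RintegralZl _ mD j3).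
  rewrite -(RintegralD mD (rintZ T mD j1) (rintZ T mD j3)).
  apply: (le_Rintegral mD jw (rintD mD (rintZ T mD j1) (rintZ T mD j3))) => x Dx /=.
  have [Wx Vx] := Dx; have /andP[a1 _] := a0 _ Wx.
  rewrite mulrCA [X in _ + X]mulrCA -mulrDr; apply: (ler_wpM2l a1); rewrite -mulrDr.
  have -> : w x = phi k x + - (phi k x - w x) by ring.
  apply: le_trans (norm_powRD_le _ _ (ltW p0)) _; rewrite normrN; apply: (ler_wpM2l T0); apply: lerD => //.
  by rewrite /wdens opprD addrA subrr add0r opprK lerDl powR_ge0.
have s2 : \int[mu]_(x in D) (a (lsubmx x) * enorm (rsubmx (nabla (phi k) x)) `^ p) <=
    T * \int[mu]_(x in D) (a (lsubmx x) * enorm (rsubmx (g x)) `^ p) + T * \int[mu]_(x in D)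
      (a (lsubmx x) * wdens p (phi k x - w x) (nabla (phi k) x - g x)).
  rewrite -(RintegralZl _ mD jg) -(RintegralZl _ mD j3).
  rewrite -(RintegralD mD (rintZ T mD jg) (rintZ T mD j3)).
  apply: (le_Rintegral mD j2 (rintD mD (rintZ T mD jg) (rintZ T mD j3))) => x Dx /=.
  have [Wx Vx] := Dx; have /andP[a1 _] := a0 _ Wx.
  rewrite mulrCA [X in _ + X]mulrCA -mulrDr; apply: (ler_wpM2l a1); rewrite -mulrDr.
  have -> : rsubmx (nabla (phi k) x) = rsubmx (g x) + rsubmx (nabla (phi k) x - g x).
    by apply/rowP => j; rewrite !mxE; ring.
  apply: le_trans (enorm_powRD _ _ (ltW p0)) _; apply: (ler_wpM2l T0); apply: lerD => //.
  apply: le_trans (_ : enorm (nabla (phi k) x - g x) `^ p <= _); last by rewrite lerDr powR_ge0.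
  by apply: ler_powR_base; [exact: ltW|exact: enorm_ge0|exact: enorm_rsub_le].
have s3 : \int[mu]_(x in D) (a (lsubmx x) * wdens p (phi k x - w x) (nabla (phi k) x - g x)) <=
    c * wdist p D w g (phi k).
  rewrite /wdist -(RintegralZl _ mD intd); apply: (le_Rintegral mD j3 (rintZ c mD intd)) => x Dx /=.
  have [Wx Vx] := Dx; have /andP[a1 ac] := a0 _ Wx.
  by apply: ler_wpM2r ac; exact: wdens_ge0.
have s4 := poinc W a c (phi k) mW bW ma a0 (lphi k); rewrite -/D in s4.
refine (chain _ _ _ _ _ _ _ _ _ T0 C0 s1 s2 s3 s4).
Qed.
End cylinder_functions.

(** * Energies and minimizers *)

Section energies.
Context {R : realType} {n l : nat}.
Local Notation mu := (@lebesgue_rV R n).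
Local Notation rint D f := (mu.-integrable D (EFin \o f)).
Variables p p' : R.
Hypotheses (p1 : 1 < p) (pp' : p^-1 + p'^-1 = 1).
Implicit Types (D : set 'rV[R]_n) (f w : 'rV[R]_n -> R) (h : 'rV[R]_n -> 'rV[R]_l).

Let p0 : 0 < p. Proof. exact: lt_trans p1. Qed.

Lemma conjugate_gt1 : 1 < p'.
Proof.
have pV0 : 0 < p^-1 by rewrite invr_gt0.
have pV1 : p^-1 < 1 by rewrite invf_lt1.
have qE : p'^-1 = 1 - p^-1 by rewrite -pp' addrC addKr.
have qV0 : 0 < p'^-1 by rewrite qE subr_gt0.
by rewrite -[p']invrK invf_gt1// qE ltrBlDr ltrDl.
Qed.

Lemma rint_conjugate_mul D f w : measurable D -> measurable_fun D f -> measurable_fun D w ->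
  rint D (fun x => `|f x| `^ p') -> rint D (fun x => `|w x| `^ p) -> rint D (fun x => f x * w x).
Proof.
move=> mD mf mw jf jw.
have p'0 : 0 < p' := lt_trans ltr01 conjugate_gt1.
have [C C0 young] := young_eps p0 p'0 pp' ltr01.
apply: (rint_le mD (measurable_funM mf mw) (rintD mD (rintZ 1 mD jw) (rintZ C mD jf))) => x Dx.
by rewrite normrM mulrC; exact: young.
Qed.

Variables (lambda Lambda : R) (F : 'rV[R]_l -> R).
Hypotheses (lambda0 : 0 < lambda) (Lambda0 : 0 < Lambda).
Hypothesis F_convex : forall x y (t : R), 0 <= t <= 1 ->
  F (t *: x + (1 - t) *: y) <= t * F x + (1 - t) * F y.
Hypothesis F_lower : forall x, lambda * enorm x `^ p <= F x.
Hypothesis F_upper : forall x, F x <= Lambda * (enorm x `^ p + 1).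

Lemma measurable_convex_growth D h : measurable_fun D h -> measurable_fun D (fun x => F (h x)).
Proof.
have cF := @convex_growth_continuous _ _ _ _ _ _ p1 lambda0 Lambda0 F_convex F_lower F_upper.
exact: (measurableT_comp (continuous_measurable_rV (D := setT) cF)).
Qed.

Lemma rint_convex_growth D h : measurable D -> (mu D < +oo)%E -> measurable_fun D h ->
  rint D (fun x => enorm (h x) `^ p) -> rint D (fun x => F (h x)).
Proof.
move=> mD fD mh jh.
apply: (rint_le mD (measurable_convex_growth mh) (rintZ Lambda mD (rintD mD jh (rint_cst 1 mD fD)))) => x Dx.
rewrite ger0_norm ?F_upper//; apply: le_trans (F_lower _).
by rewrite mulr_ge0 ?powR_ge0// ltW.
Qed.

Lemma rint_energy D f w h : measurable D -> (mu D < +oo)%E ->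
  measurable_fun D f -> rint D (fun x => `|f x| `^ p') -> measurable_fun D w -> measurable_fun D h ->
  rint D (fun x => `|w x| `^ p) -> rint D (fun x => enorm (h x) `^ p) ->
  rint D (fun x => F (h x) - f x * w x).
Proof.
move=> mD fD mf jf mw mh jw jh.
exact: (rintB mD (rint_convex_growth mD fD mh jh) (rint_conjugate_mul mD mf mw jf jw)).
Qed.

(** Upper semicontinuity of the energy density, in a quantitative form that can be
    integrated: t is small and the distances tend to 0. *)
Lemma energy_increment (t : R) : 0 < t <= 1 -> exists2 C : R, 0 <= C & forall (c a b : R) y z,
  F z - c * b <= (F y - c * a) + (t * (Lambda * 2 `^ p * (enorm y `^ p + 1) + `|c| `^ p') +
     C * (`|b - a| `^ p + enorm (z - y) `^ p)).
Proof.
move=> /andP[t0 t1]; have p'0 : 0 < p' := lt_trans ltr01 conjugate_gt1.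
have p'p : p'^-1 + p^-1 = 1 by rewrite addrC.
have [C C0 young] := young_eps p'0 p0 p'p t0.
pose K := Lambda * 2 `^ p; have K0 : 0 <= K by rewrite mulr_ge0 ?powR_ge0// ltW.
exists (K * t `^ (1 - p) + C); first by rewrite addr_ge0// mulr_ge0// powR_ge0.
move=> c a b y z; have t01 : 0 < t <= 1 by rewrite t0 t1.
have h1 := convex_increment p1 lambda0 Lambda0 F_convex F_lower F_upper y z t01.
have h2 := young _ _ (normr_ge0 c) (normr_ge0 (b - a)).
have h3 : - (c * (b - a)) <= `|c| * `|b - a|.
  by rewrite -normrM -normrN; exact: ler_norm.
have Z0 : 0 <= enorm (z - y) `^ p by exact: powR_ge0.
have W0 : 0 <= `|b - a| `^ p by exact: powR_ge0.
have T0 : 0 <= t `^ (1 - p) by exact: powR_ge0.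
move: h1 h2 h3 Z0 W0 T0; rewrite -/K.
move: (enorm (z - y) `^ p) (`|b - a| `^ p) (t `^ (1 - p)) (enorm y `^ p) (`|c| `^ p') (`|c| * `|b - a|) => Z W T Y Q P.
move: (F z) (F y) => Fz Fy h1 h2 h3 Z0 W0 T0.
have := mulr_ge0 C0 Z0; have := mulr_ge0 (mulr_ge0 K0 T0) W0.
clear -h1 h2 h3 => q1 q2; nra.
Qed.

End energies.

Section minimizers.
Context {R : realType} {n : nat}.
Local Notation mu := (@lebesgue_rV R n).
Local Notation rint D f := (mu.-integrable D (EFin \o f)).
Variables p lambda Lambda : R.
Hypothesis p1 : 1 < p.
Variable F : 'rV[R]_n -> R.
Hypotheses (lambda0 : 0 < lambda) (Lambda0 : 0 < Lambda).
Hypothesis F_convex : forall x y (t : R), 0 <= t <= 1 ->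
  F (t *: x + (1 - t) *: y) <= t * F x + (1 - t) * F y.
Hypothesis F_lower : forall x, lambda * enorm x `^ p <= F x.
Hypothesis F_upper : forall x, F x <= Lambda * (enorm x `^ p + 1).

Implicit Types (D : set 'rV[R]_n) (f u v : 'rV[R]_n -> R) (h : 'rV[R]_n -> 'rV[R]_n).

Lemma minimizer_le D f u v h : open D -> bounded_set D -> measurable_fun D f ->
  is_minimizer p D F f u -> Wclosure p (test_function D) D v h ->
  \int[mu]_(x in D) (F (grad D u x) - f x * u x) <= \int[mu]_(x in D) (F (h x) - f x * v x).
Proof.
move=> oD bD mf [_ umin] vh; have mD := open_measurable_rV oD.
apply: le_trans (umin v (Wclosure_W1p0 p1 oD bD vh)) _.
have [mv mh _ _] := vh; have tsm : test_function D `<=` smooth by move=> ? [].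
have vg := Wclosure_weak_gradient p1 mD bD tsm vh.
have mF h' : measurable_fun D h' -> measurable_fun D (fun x => F (h' x) - f x * v x).
  move=> mh'; apply: measurable_funB; last exact: (measurable_funM mf mv).
  exact: (measurable_convex_growth p1 lambda0 Lambda0 F_convex F_lower F_upper).
rewrite /energy (Rintegral_ae mD (mF _ (grad_measurable mD vg)) (mF _ mh))//.
by apply: filterS (grad_ae oD vg) => x /= E Dx; rewrite E.
Qed.

Lemma test_functionD D (a b : R) (phi psi : 'rV[R]_n -> R) :
  test_function D phi -> test_function D psi -> test_function D (fun x => a * phi x + b * psi x).
Proof.
move=> [sphi [K [cK KD phi0]]] [spsi [L [cL LD psi0]]]; split.
  exact: (smoothD (smoothM (smooth_cst a) sphi) (smoothM (smooth_cst b) spsi)).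
exists (K `|` L); split; first exact: compactU.
  by move=> x [/KD|/LD].
move=> x KL; rewrite phi0 ?psi0 ?mulr0 ?addr0// => ?; apply: KL; [by right|by left].
Qed.

End minimizers.

(** * Minimality on the slices of a cylinder *)

Section slicing.
Context {R : realType} {r m : nat}.
Implicit Types (W : set 'rV[R]_r).
Local Notation mu := (@lebesgue_rV R (r + m)).
Local Notation mu1 := (@lebesgue_rV R r).
Local Notation mu2 := (@lebesgue_rV R m).
Local Notation rint D f := (mu.-integrable D (EFin \o f)).
Variables p p' lambda Lambda : R.
Hypotheses (p1 : 1 < p) (pp' : p^-1 + p'^-1 = 1).
Variable F : 'rV[R]_m -> R.
Hypotheses (lambda0 : 0 < lambda) (Lambda0 : 0 < Lambda).
Hypothesis F_convex : forall x y (t : R), 0 <= t <= 1 ->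
  F (t *: x + (1 - t) *: y) <= t * F x + (1 - t) * F y.
Hypothesis F_lower : forall x, lambda * enorm x `^ p <= F x.
Hypothesis F_upper : forall x, F x <= Lambda * (enorm x `^ p + 1).
Variable V : set 'rV[R]_m.
Hypotheses (oV : open V) (bV : bounded_set V).
Variables f u0 : 'rV[R]_m -> R.
Hypotheses (mf : measurable_fun V f) (jf : mu2.-integrable V (EFin \o (fun y => `|f y| `^ p'))).
Hypothesis u0_min : is_minimizer p V F f u0.

Let p0 : 0 < p. Proof. exact: lt_trans p1. Qed.
Let g0 := grad V u0.
Let mV : measurable V. Proof. exact: open_measurable_rV. Qed.
Let fV : (mu2 V < +oo)%E. Proof. exact: bounded_lebesgue_lty. Qed.
Let u0W : Wclosure p (test_function V) V u0 g0.
Proof. exact: (W1p0_Wclosure p1 oV bV u0_min.1). Qed.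
Let tsm : test_function V `<=` smooth. Proof. by move=> ? []. Qed.

Definition excess (y : 'rV[R]_m) (a : R) (z : 'rV[R]_m) : R :=
  (F z - f y * a) - (F (g0 y) - f y * u0 y).

Let mix (theta : R) (x : 'rV[R]_(r + m)) (a : R) (z : 'rV[R]_(r + m)) : R :=
  excess (rsubmx x) (theta * a + (1 - theta) * u0 (rsubmx x))
    (theta *: rsubmx z + (1 - theta) *: g0 (rsubmx x)).

Lemma rint_mix W theta w g : open W -> bounded_set W -> measurable_fun (cylinder W V) w ->
  measurable_fun (cylinder W V) g -> rint (cylinder W V) (fun x => wdens p (w x) (g x)) ->
  [/\ rint (cylinder W V) (fun x => mix theta x (w x) (g x)),
    rint (cylinder W V) (fun x => enorm (theta *: rsubmx (g x) + (1 - theta) *: g0 (rsubmx x)) `^ p) &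
    rint (cylinder W V) (fun x => `|f (rsubmx x)| `^ p')].
Proof.
move=> oW bW mw mg jwg; have mW := open_measurable_rV oW; have fW := bounded_lebesgue_lty mW bW.
set D := cylinder W V; have mD : measurable D by exact: measurable_cylinder.
have fD : (mu D < +oo)%E by apply: bounded_lebesgue_lty => //; exact: bounded_cylinder.
have [mu0 mg0 ju0 _] := u0W; have [iu0 ig0] := rint_wdens mV mu0 mg0 ju0.
have [jw jg] := rint_wdens mD mw mg jwg.
have mfD : measurable_fun D (from_rsub f) by exact: measurable_from_rsub.
have mu0D : measurable_fun D (from_rsub u0) by exact: measurable_from_rsub.
have mg0D : measurable_fun D (from_rsub g0) by exact: measurable_from_rsub.
have jfD : rint D (fun x => `|from_rsub f x| `^ p').
  exact: (rint_from_rsub (r := r) mW fW mV (fun y _ => powR_ge0 _ _) jf).1.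
have ju0D : rint D (fun x => `|from_rsub u0 x| `^ p).
  exact: (rint_from_rsub (r := r) mW fW mV (fun y _ => powR_ge0 _ _) iu0).1.
have jg0D : rint D (fun x => enorm (from_rsub g0 x) `^ p).
  exact: (rint_from_rsub (r := r) mW fW mV (fun y _ => powR_ge0 _ _) ig0).1.
have mgr : measurable_fun D (fun x => rsubmx (g x)).
  exact: (measurableT_comp (@measurable_rsubmx _ _ _ _) mg).
have mm : measurable_fun D (fun x => theta *: rsubmx (g x) + (1 - theta) *: from_rsub g0 x).
  apply: measurable_rVP => // j; under eq_fun do rewrite mxE [X in X + _]mxE [X in _ + X]mxE.
  apply: measurable_funD; apply: measurable_funM; try exact: measurable_cst.
    exact: measurable_rV_coord.
  exact: measurable_rV_coord.
have mma : measurable_fun D (fun x => theta * w x + (1 - theta) * from_rsub u0 x).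
  by apply: measurable_funD; apply: measurable_funM => //; exact: measurable_cst.
pose T := 2 `^ p : R; have T0 : 0 <= T by exact: powR_ge0.
have jm : rint D (fun x => enorm (theta *: rsubmx (g x) + (1 - theta) *: from_rsub g0 x) `^ p).
  apply: (rint_le mD (measurableT_comp (measurable_powR p) (measurable_enorm mm))
   (rintD mD (rintZ (T * `|theta| `^ p) mD jg) (rintZ (T * `|1 - theta| `^ p) mD jg0D))) => x Dx.
  rewrite (ger0_norm (powR_ge0 _ _)); apply: le_trans (enorm_powRD _ _ (ltW p0)) _.
  rewrite !enormZ !powRM ?enorm_ge0// mulrDr !mulrA; apply: lerD => //.
  apply: ler_wpM2l; first by rewrite mulr_ge0// powR_ge0.
  by apply: ler_powR_base; [exact: ltW|exact: enorm_ge0|exact: enorm_rsub_le].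
have jma : rint D (fun x => `|theta * w x + (1 - theta) * from_rsub u0 x| `^ p).
  apply: (rint_le mD (measurable_norm_powR p mma)
   (rintD mD (rintZ (T * `|theta| `^ p) mD jw) (rintZ (T * `|1 - theta| `^ p) mD ju0D))) => x Dx.
  rewrite (ger0_norm (powR_ge0 _ _)); apply: le_trans (norm_powRD_le _ _ (ltW p0)) _.
  by rewrite !normrM !powRM// mulrDr !mulrA.
split; [|exact: jm|exact: jfD].
exact: (rintB mD (rint_energy p1 pp' lambda0 Lambda0 F_convex F_lower F_upper mD fD mfD jfD mma mm jma jm)
  (rint_energy p1 pp' lambda0 Lambda0 F_convex F_lower F_upper mD fD mfD jfD mu0D mg0D ju0D jg0D)).
Qed.

(** On each slice theta phi + (1 - theta) u_0 is a competitor of u_0. *)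
Lemma slice_ge0 W theta phi (x : 'rV[R]_r) : test_function (cylinder W V) phi ->
  mu2.-integrable V (EFin \o (fun y => mix theta (row_mx x y) (phi (row_mx x y)) (nabla phi (row_mx x y)))) /\
  0 <= \int[mu2]_(y in V) mix theta (row_mx x y) (phi (row_mx x y)) (nabla phi (row_mx x y)).
Proof.
move=> tphi; pose psi y := phi (row_mx x y).
have tpsi : test_function V psi by exact: test_function_slice tphi.
have psiW := Wclosure_self p1 mV bV tpsi.1 tpsi.
have vW := Wclosure_lin p1 (S'' := test_function V) (a := theta) (b := 1 - theta) mV bV tsm tsm
  (fun phi psi tphi tpsi => test_functionD theta (1 - theta) tphi tpsi) psiW u0W.
have le := minimizer_le p1 lambda0 Lambda0 F_convex F_lower F_upper oV bV mf u0_min vW.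
have [mu0 mg0 ju0 _] := u0W; have [iu0 ig0] := rint_wdens mV mu0 mg0 ju0.
have [mv mh jv _] := vW; have [iv ih] := rint_wdens mV mv mh jv.
have i1 := rint_energy p1 pp' lambda0 Lambda0 F_convex F_lower F_upper mV fV mf jf mv mh iv ih.
have i2 := rint_energy p1 pp' lambda0 Lambda0 F_convex F_lower F_upper mV fV mf jf mu0 mg0 iu0 ig0.
have E : (fun y => mix theta (row_mx x y) (phi (row_mx x y)) (nabla phi (row_mx x y))) =
    fun y => (F (theta *: nabla psi y + (1 - theta) *: g0 y) - f y * (theta * psi y + (1 - theta) * u0 y)) -
     (F (g0 y) - f y * u0 y).
  apply/funext => y; rewrite /mix /excess row_mxKr (nabla_slice x y tphi.1)//.
rewrite E; split; first exact: (rintB mV i1 i2).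
by rewrite (RintegralB mV i1 i2) subr_ge0.
Qed.

(** Fubini's theorem: the weight is constant on the slices. *)
Lemma mix_ge0_test W (theta : R) (a : 'rV[R]_r -> R) (c : R) phi : open W -> bounded_set W -> measurable_fun W a ->
  (forall x, W x -> 0 <= a x <= c) -> test_function (cylinder W V) phi ->
  0 <= \int[mu]_(x in cylinder W V) (a (lsubmx x) * mix theta x (phi x) (nabla phi x)).
Proof.
move=> oW bW ma a0 tphi; have mW := open_measurable_rV oW.
set D := cylinder W V; have mD : measurable D by exact: measurable_cylinder.
have bD : bounded_set D by exact: bounded_cylinder.
have maD : measurable_fun D (fun x => a (lsubmx x)) by exact: measurable_from_lsub.
have aD x : D x -> `|a (lsubmx x)| <= c by move=> [Wx _]; have /andP[a1 a2] := a0 _ Wx; rewrite ger0_norm.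
have [jm _ _] := rint_mix theta oW bW (smooth_measurable tphi.1) (measurable_nabla mD tphi.1)
  (rint_wdens_smooth p1 mD bD tphi.1).
have jK := rint_mulb mD jm maD aD.
set K := fun x => a (lsubmx x) * _ in jK *.
have jKT : rint setT (K \_ D) by rewrite -restrict_EFin; exact/(integrable_mkcond _ mD).
apply: fine_ge0; rewrite integral_mkcond restrict_EFin [leRHS](fubini_rV jKT).
apply: integral_ge0 => x _.
have E y : ((K \_ D) (row_mx x y))%:E =
   if x \in W then ((fun z => (K (row_mx x z))%:E) \_ V) y else 0%E.
  by rewrite -[LHS]/((EFin \o (K \_ D)) _) -restrict_EFin patch_cylinder_row.
under eq_integral do rewrite E.
case: (boolP (x \in W)) => [/set_mem Wx|_]; last by rewrite integral0.
rewrite -integral_mkcond.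
have [i1 ge0] := slice_ge0 theta x tphi.
have KE : (fun y => K (row_mx x y)) = fun y => a x * mix theta (row_mx x y) (phi (row_mx x y)) (nabla phi (row_mx x y)).
  by apply/funext => y; rewrite /K row_mxKl.
rewrite -[X in integral _ _ X]/(EFin \o (fun y => K (row_mx x y))) KE.
rewrite -(EFin_Rintegral mV (rintZ (a x) mV i1)) lee_fin (RintegralZl _ mV i1) mulr_ge0//.
by have /andP[] := a0 _ Wx.
Qed.

(** By [energy_increment] the limit loses at most a multiple of t, and t is
    arbitrary. *)
Lemma mix_ge0 W (theta : R) (a : 'rV[R]_r -> R) (c : R) w g : open W -> bounded_set W ->
  measurable_fun W a -> (forall x, W x -> 0 <= a x <= c) -> 0 <= theta <= 1 ->
  Wclosure p (test_function (cylinder W V)) (cylinder W V) w g ->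
  0 <= \int[mu]_(x in cylinder W V) (a (lsubmx x) * mix theta x (w x) (g x)).
Proof.
move=> oW bW ma a0 /andP[th0 th1] [mw mg jwg [phi [tphi cphi]]]; have mW := open_measurable_rV oW.
have [W0|/set0P[x0 Wx0]] := eqVneq W set0.
  rewrite W0; have -> : cylinder set0 V = set0 :> set 'rV[R]_(r + m) by apply/seteqP; split => x // -[].
  by rewrite Rintegral_set0.
have c0 : 0 <= c by have /andP[/le_trans] := a0 _ Wx0; apply.
set D := cylinder W V in mw mg jwg tphi cphi *; have mD : measurable D by exact: measurable_cylinder.
have bD : bounded_set D by exact: bounded_cylinder.
have fD : (mu D < +oo)%E by exact: bounded_lebesgue_lty.
have maD : measurable_fun D (fun x => a (lsubmx x)) by exact: measurable_from_lsub.
have aD x : D x -> `|a (lsubmx x)| <= c by move=> [Wx _]; have /andP[a1 a2] := a0 _ Wx; rewrite ger0_norm.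
have [jm jy jf'] := rint_mix theta oW bW mw mg jwg.
have jK := rint_mulb mD jm maD aD.
pose B x := Lambda * 2 `^ p * (enorm (theta *: rsubmx (g x) + (1 - theta) *: g0 (rsubmx x)) `^ p + 1) +
  `|f (rsubmx x)| `^ p'.
have jB : rint D B.
  exact: (rintD mD (rintZ (Lambda * 2 `^ p) mD (rintD mD jy (rint_cst 1 mD fD))) jf').
have step (t : R) : 0 < t <= 1 -> 0 <= \int[mu]_(x in D) (a (lsubmx x) * mix theta x (w x) (g x)) +
    t * (c * \int[mu]_(x in D) B x).
  move=> t01; have [C C0 incr] := energy_increment p1 pp' lambda0 Lambda0 F_convex F_lower F_upper t01.
  apply: (le_cvg0 (B := c * C) cphi) => k.
  have sphi := (tphi k).1; have intd := rint_wdist p1 mD bD mw mg jwg sphi.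
  have h := mix_ge0_test theta oW bW ma a0 (tphi k); rewrite -/D in h; apply: le_trans h _.
  have [jmk _ _] := rint_mix theta oW bW (smooth_measurable sphi) (measurable_nabla mD sphi)
    (rint_wdens_smooth p1 mD bD sphi).
  have jKk := rint_mulb mD jmk maD aD.
  rewrite mulrA /wdist -(RintegralZl _ mD jB) -(RintegralZl _ mD intd).
  rewrite -(RintegralD mD jK (rintZ _ mD jB)) -(RintegralD mD (rintD mD jK (rintZ _ mD jB)) (rintZ _ mD intd)).
  apply: (le_Rintegral mD jKk (rintD mD (rintD mD jK (rintZ _ mD jB)) (rintZ _ mD intd))) => x Dx /=.
  have [Wx Vx] := Dx; have /andP[a1 ac] := a0 _ Wx.
  have := incr (f (rsubmx x)) (theta * w x + (1 - theta) * u0 (rsubmx x)) (theta * phi k x + (1 - theta) * u0 (rsubmx x))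
    (theta *: rsubmx (g x) + (1 - theta) *: g0 (rsubmx x)) (theta *: rsubmx (nabla (phi k) x) + (1 - theta) *: g0 (rsubmx x)).
  rewrite /mix /excess.
  have -> : theta * phi k x + (1 - theta) * u0 (rsubmx x) - (theta * w x + (1 - theta) * u0 (rsubmx x)) =
    theta * (phi k x - w x) by ring.
  have -> : theta *: rsubmx (nabla (phi k) x) + (1 - theta) *: g0 (rsubmx x) -
    (theta *: rsubmx (g x) + (1 - theta) *: g0 (rsubmx x)) = theta *: rsubmx (nabla (phi k) x - g x).
    by apply/rowP => j; rewrite !mxE; ring.
  have le1 : `|theta * (phi k x - w x)| `^ p + enorm (theta *: rsubmx (nabla (phi k) x - g x)) `^ p <=
      wdens p (phi k x - w x) (nabla (phi k) x - g x).
    rewrite normrM enormZ (ger0_norm th0); apply: lerD; apply: ler_powR_base; rewrite ?(ltW p0)// ?mulr_ge0 ?enorm_ge0//.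
      by rewrite ler_piMl.
    apply: le_trans (enorm_rsub_le _); by rewrite ler_piMl ?enorm_ge0.
  move: (_ `^ p + _ `^ p) (wdens _ _ _) le1 (wdens_ge0 p (phi k x - w x) (nabla (phi k) x - g x)) => d1 d2 d12 d20.
  have B0 : 0 <= B x by rewrite addr_ge0 ?powR_ge0// !mulr_ge0 ?addr_ge0 ?powR_ge0 ?(ltW Lambda0).
  rewrite -/(B x); move: (B x) (a _) B0 a1 ac => b A b0 A0 Ac incr'.
  have t0 : 0 <= t by case/andP: t01 => /ltW.
  have q1 : t * b + C * d1 <= t * b + C * d2 by rewrite lerD2l ler_wpM2l.
  have q2 : A * (t * b + C * d2) <= c * (t * b + C * d2).
    by apply: ler_wpM2r Ac; rewrite addr_ge0// mulr_ge0.
  move: (F _ - _) (F _ - _) (F (g0 _) - _) incr' => e2 e1 e3 incr'.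
  have q3 : A * (e1 - e3) <= A * (e2 - e3 + (t * b + C * d2)).
    by apply: (ler_wpM2l A0); lra.
  by rewrite mulrDr in q3; lra.
have B0 : 0 <= c * \int[mu]_(x in D) B x.
  apply: mulr_ge0 => //; apply: Rintegral_ge0 => x _.
  by rewrite addr_ge0 ?powR_ge0// !mulr_ge0 ?addr_ge0 ?powR_ge0 ?(ltW Lambda0).
move: (\int[mu]_(x in D) _) (c * _) step B0 => X b step b0.
apply/ler_addgt0Pr => e e0.
pose t := Num.min 1 (e / (b + 1)).
have b1 : 0 < b + 1 by rewrite ltr_wpDl.
have t0 : 0 < t by rewrite lt_min ltr01 divr_gt0.
have t1 : t <= 1 by rewrite ge_min lexx.
have te : t * b <= e.
  apply: (@le_trans _ _ (e / (b + 1) * b)); first by rewrite ler_wpM2r// ge_min lexx orbT.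
  by rewrite -mulrA ler_piMr ?(ltW e0)// mulrC ler_pdivrMr// mul1r lerDl.
by apply: le_trans (step t _) _; [rewrite t0 t1|rewrite lerD2l].
Qed.

(** The gap is theta times the excess of w minus the excess of the convex
    combination theta w + (1 - theta) u_0, whose weighted integral is
    nonnegative by the minimality of u_0 on the slices. *)
Lemma gap_le_excess W (theta : R) (a : 'rV[R]_r -> R) (c : R) w g : open W -> bounded_set W ->
  measurable_fun W a -> (forall x, W x -> 0 <= a x <= c) -> 0 <= theta <= 1 ->
  Wclosure p (test_function (cylinder W V)) (cylinder W V) w g ->
  [/\ rint (cylinder W V) (fun x => gap F theta (rsubmx (g x)) (g0 (rsubmx x))),
    rint (cylinder W V) (fun x => excess (rsubmx x) (w x) (rsubmx (g x))) &
  \int[mu]_(x in cylinder W V) (a (lsubmx x) * gap F theta (rsubmx (g x)) (g0 (rsubmx x))) <=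
  theta * \int[mu]_(x in cylinder W V) (a (lsubmx x) * excess (rsubmx x) (w x) (rsubmx (g x)))].
Proof.
move=> oW bW ma a0 th01 wW; have mW := open_measurable_rV oW.
have [mw mg jwg _] := wW; set D := cylinder W V in mw mg jwg wW *.
have mD : measurable D by exact: measurable_cylinder.
have [jm _ _] := rint_mix theta oW bW mw mg jwg.
have [jx _ _] := rint_mix 1 oW bW mw mg jwg.
have E1 : (fun x => mix 1 x (w x) (g x)) = fun x => excess (rsubmx x) (w x) (rsubmx (g x)).
  by apply/funext => x; rewrite /mix subrr !mul1r !scale1r !mul0r !scale0r !addr0.
rewrite E1 in jx.
have E2 : (fun x => gap F theta (rsubmx (g x)) (g0 (rsubmx x))) = fun x =>
    theta * excess (rsubmx x) (w x) (rsubmx (g x)) - mix theta x (w x) (g x).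
  by apply/funext => x; rewrite /gap /mix /excess; ring.
have jg : rint D (fun x => gap F theta (rsubmx (g x)) (g0 (rsubmx x))).
  by rewrite E2; exact: (rintB mD (rintZ _ mD jx) jm).
split; [exact: jg|exact: jx|].
have maD : measurable_fun D (fun x => a (lsubmx x)) by exact: measurable_from_lsub.
have aD x : D x -> `|a (lsubmx x)| <= c by move=> [Wx _]; have /andP[a1 a2] := a0 _ Wx; rewrite ger0_norm.
have jam := rint_mulb mD jm maD aD; have jax := rint_mulb mD jx maD aD.
rewrite -subr_ge0 -(RintegralZl _ mD jax) -(RintegralB mD (rintZ _ mD jax) (rint_mulb mD jg maD aD)).
have := mix_ge0 oW bW ma a0 th01 wW; rewrite -/D; congr (0 <= _).
apply: eq_Rintegral => x _; have := congr1 (fun h => h x) E2 => /= ->; ring.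
Qed.

End slicing.

(** * The remainder of the cut-off *)

Section remainder.
Context {R : realType}.
Variables (p k r : R).
Hypotheses (p1 : 1 < p) (k0p : 0 <= k < p) (r_small_0 : k = 0 -> r < p)
  (r_small_k : 0 < k -> r < k * p / (p - k)).

Let p0 : 0 < p. Proof. exact: lt_trans p1. Qed.

Let powR_le1 (c a : R) : 0 < c <= 1 -> 0 <= a -> c `^ a <= 1.
Proof.
move=> /andP[c0 c1] a0; have -> : 1 = 1 `^ a :> R by rewrite powR1.
by apply: ler_powR_base => //; exact: ltW.
Qed.

(** If A / chi is small then chi^q x^p is a small multiple of chi^q w^p. If not,
    chi is at most a multiple of A, and the factors of chi in excess of p become
    factors of A. Young's inequality splits the product z^(p-k) x^k. The resulting
    powers of A are at least p when k = 0 and k p / (p - k) when k > 0, which are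
    the exponents to be compared with r. *)
Lemma remainder_bound : exists (q : nat) (s : R), [/\ (1 < q)%N, r < s, 0 < s &
  forall eps, 0 < eps \/ k = 0 /\ eps = 0 -> exists2 C : R, 0 <= C &
  forall A chi x w z : R, 0 <= A <= 1 -> 0 < chi <= 1 -> 0 <= x -> chi * x <= A * w -> 0 <= w -> 0 <= z ->
  chi ^+ q * (x `^ p + k * z `^ (p - k) * x `^ k) <=
    eps * (chi ^+ q * w `^ p) + C * (A `^ s * (w `^ p + z `^ p))].
Proof.
have /andP[k0 kp] := k0p.
pose s := if k == 0 then p else k * p / (p - k).
(* q >= p + s keeps every exponent of chi below nonnegative *)
pose q := (Num.truncn (p + s)).+2.
have s0 : 0 < s.
  rewrite /s; case: eqP => // /eqP kn0; rewrite divr_gt0 ?mulr_gt0 ?subr_gt0//.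
  by rewrite lt0r kn0.
have psq : p + s <= q%:R.
  apply: ltW; apply: lt_trans (truncnS_gt (p + s)) _; by rewrite ltr_nat.
exists q, s; split => //.
  by rewrite /s; case: eqP => [/r_small_0//|/eqP kn0]; apply: r_small_k; rewrite lt0r kn0.
move=> eps eps0.
have base (A chi x w : R) : 0 <= A <= 1 -> 0 < chi <= 1 -> 0 <= x -> chi * x <= A * w -> 0 <= w ->
    forall a, 0 <= a -> x `^ a <= (A / chi) `^ a * w `^ a.
  move=> /andP[A0 A1] /andP[c0 c1] x0 xw w0 a a0.
  have Ac : 0 <= A / chi by rewrite divr_ge0// ltW.
  rewrite -powRM//; apply: ler_powR_base => //.
  by rewrite mulrAC ler_pdivlMr// mulrC.
have [kE|kn0] := eqVneq k 0.
  have eps_ge0 : 0 <= eps by case: eps0 => [/ltW//|[_ ->]].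
  exists 1 => // A chi x w z A01 c01 x0 xw w0 z0.
  rewrite kE mul0r mul0r addr0 mul1r; have /andP[A0 A1] := A01; have /andP[c0 c1] := c01.
  have sE : s = p by rewrite /s kE eqxx.
  apply: ler_wpDl.
    by apply: mulr_ge0 eps_ge0 _; apply: mulr_ge0; [exact: exprn_ge0 (ltW c0)|exact: powR_ge0].
  have X0 : 0 <= chi ^+ q by rewrite exprn_ge0// ltW.
  have h1 := base _ _ _ _ A01 c01 x0 xw w0 p (ltW p0).
  apply: le_trans (ler_wpM2l X0 h1) _.
  rewrite sE mulrA; apply: (@le_trans _ _ (A `^ p * w `^ p)); last first.
    by rewrite mulrDr lerDl mulr_ge0// powR_ge0.
  apply: ler_wpM2r; first exact: powR_ge0.
  rewrite powRM ?invr_ge0 ?(ltW c0)// mulrCA ler_piMr ?powR_ge0//.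
  rewrite -powR_inv1 ?(ltW c0)// -powRrM mulN1r -powR_mulrn ?(ltW c0)// -powRD ?(gt_eqF c0) ?implybT//.
  by apply: powR_le1 => //; rewrite subr_ge0; apply: le_trans psq; rewrite lerDl ltW.
have {eps0} eps0 : 0 < eps by case: eps0 => // -[kE _]; rewrite kE eqxx in kn0.
have {kn0} k_gt0 : 0 < k by rewrite lt0r kn0.
have sE : s = k * p / (p - k) by rewrite /s (gt_eqF k_gt0).
have pk0 : 0 < p - k by rewrite subr_gt0.
have pq : (p / k)^-1 + (p / (p - k))^-1 = 1 by field; rewrite !gt_eqF.
have e1 : 0 < eps / (2 * k) by rewrite divr_gt0// mulr_gt0.
have [C C0 young] := young_eps (divr_gt0 p0 k_gt0) (divr_gt0 p0 pk0) pq e1.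
have e2 : 0 < eps / 2 by rewrite divr_gt0.
have [d d0 dP] := powR_small p0 e2.
exists ((d^-1) `^ (q%:R - p) + k * C); first by rewrite addr_ge0 ?powR_ge0// mulr_ge0.
move=> A chi x w z A01 c01 x0 xw w0 z0; have /andP[A0 A1] := A01; have /andP[c0 c1] := c01.
have Ac0 : 0 <= A / chi by rewrite divr_ge0// ltW.
have X0 : 0 <= chi ^+ q by rewrite exprn_ge0// ltW.
have h1 := base _ _ _ _ A01 c01 x0 xw w0 p (ltW p0).
have h2 := base _ _ _ _ A01 c01 x0 xw w0 k k0.
have W0 : 0 <= w `^ p by exact: powR_ge0.
have Z0 : 0 <= z `^ p by exact: powR_ge0.
have S0 : 0 <= A `^ s by exact: powR_ge0.
have chiE (a : R) : chi ^+ q * (A / chi) `^ a = A `^ a * chi `^ (q%:R - a).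
  rewrite powRM ?invr_ge0 ?(ltW c0)// mulrCA; congr (_ * _).
  by rewrite -powR_inv1 ?(ltW c0)// -powRrM mulN1r -powR_mulrn ?(ltW c0)// -powRD ?(gt_eqF c0) ?implybT.
have chi1 (a : R) : 0 <= a -> chi `^ a <= 1.
  by move=> a0; exact: powR_le1.
have t1 : chi ^+ q * x `^ p <= eps / 2 * (chi ^+ q * w `^ p) + (d^-1) `^ (q%:R - p) * (A `^ s * w `^ p).
  apply: le_trans (ler_wpM2l X0 h1) _.
  have [small|big] := leP (A / chi) d.
    apply: ler_wpDr; first by rewrite !mulr_ge0// powR_ge0.
    by rewrite [leRHS]mulrCA; apply: (ler_wpM2l X0); apply: (ler_wpM2r W0); exact: dP.
  apply: ler_wpDl; first by apply: mulr_ge0 (ltW e2) _; exact: mulr_ge0.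
  rewrite [leLHS]mulrA chiE [leRHS]mulrA; apply: (ler_wpM2r W0).
  have qp0 : 0 <= q%:R - p by rewrite subr_ge0; apply: le_trans psq; rewrite lerDl ltW.
  have chiA : chi <= d^-1 * A by rewrite ltr_pdivlMr// in big; rewrite mulrC ler_pdivlMr// mulrC ltW.
  apply: (@le_trans _ _ (A `^ p * (d^-1 * A) `^ (q%:R - p))).
    by apply: ler_wpM2l; [exact: powR_ge0|apply: ler_powR_base => //; exact: ltW].
  rewrite powRM ?invr_ge0 ?(ltW d0)// mulrCA; apply: ler_wpM2l; first exact: powR_ge0.
  have An0 : 0 < A by have := lt_le_trans c0 chiA; rewrite pmulr_rgt0// invr_gt0.
  rewrite -powRD ?(gt_eqF An0) ?implybT// subrKC -[q%:R](subrK s) addrC powRD ?(gt_eqF An0) ?implybT//.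
  rewrite ler_piMr ?powR_ge0//; apply: powR_le1; first by rewrite An0.
  by rewrite subr_ge0; apply: le_trans psq; rewrite lerDr ltW.
have t2 : chi ^+ q * (k * z `^ (p - k) * x `^ k) <= eps / 2 * (chi ^+ q * w `^ p) + k * C * (A `^ s * z `^ p).
  have y := young (w `^ k) ((A / chi) `^ k * z `^ (p - k)) (powR_ge0 _ _) (mulr_ge0 (powR_ge0 _ _) (powR_ge0 _ _)).
  rewrite (powRM _ (powR_ge0 _ _) (powR_ge0 _ _)) -!powRrM in y.
  have E1 : k * (p / k) = p by rewrite mulrCA divff ?mulr1// gt_eqF.
  have E2 : (p - k) * (p / (p - k)) = p by rewrite mulrCA divff ?mulr1// gt_eqF.
  have E3 : k * (p / (p - k)) = s by rewrite sE mulrA.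
  rewrite E1 E2 E3 in y.
  apply: (@le_trans _ _ (chi ^+ q * (k * (eps / (2 * k) * w `^ p + C * ((A / chi) `^ s * z `^ p))))).
    apply: (ler_wpM2l X0); rewrite -mulrA; apply: (ler_wpM2l k0).
    apply: le_trans y; rewrite mulrA [leRHS]mulrC; apply: ler_wpM2l; first exact: powR_ge0.
    by rewrite mulrC.
  rewrite mulrA mulrDr; apply: lerD; first by rewrite le_eqVlt; apply/orP; left; apply/eqP; field; rewrite gt_eqF.
  have -> : chi ^+ q * k * (C * ((A / chi) `^ s * z `^ p)) = k * C * ((chi ^+ q * (A / chi) `^ s) * z `^ p) by ring.
  apply: ler_wpM2l; first exact: mulr_ge0.
  apply: (ler_wpM2r Z0); rewrite chiE ler_piMr// chi1// subr_ge0.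
  by apply: le_trans psq; rewrite lerDr ltW.
rewrite mulrDr; apply: le_trans (lerD t1 t2) _.
move: (d^-1 `^ _) (powR_ge0 (d^-1) (q%:R - p)) => e3 e30.
have q1 : 0 <= e3 * (A `^ s * z `^ p) by rewrite !mulr_ge0.
have q2 : 0 <= k * C * (A `^ s * w `^ p) by rewrite !mulr_ge0.
move: (A `^ s) (w `^ p) (z `^ p) (chi ^+ q) q1 q2 => a b c e q1 q2; lra.
Qed.

End remainder.

(** * Tensor products of test functions *)

Section tensor.
Context {R : realType} {r m : nat}.
Variables (i0 : 'I_r) (j0 : 'I_m).

Lemma partialX n (u : 'rV[R]_n -> R) q i x : smooth u ->
  partial i (fun x => u x ^+ q.+1) x = q.+1%:R * u x ^+ q * partial i u x.
Proof.
move=> su; elim: q => [|q IH].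
  by rewrite expr0 mulr1 mul1r; congr (partial i _ x); apply/funext => y; rewrite expr1.
rewrite (_ : (fun x => _) = (fun x => u x * u x ^+ q.+1)); last by apply/funext => y; rewrite exprS.
by rewrite (partialM _ _ su (smoothX _ su)) IH exprS -[q.+2%:R]natr1; ring.
Qed.

Lemma test_function_tensor (W : set 'rV[R]_r) (V : set 'rV[R]_m) a b :
  test_function W a -> test_function V b ->
  test_function (cylinder W V) (fun x => a (lsubmx x) * b (rsubmx x)).
Proof.
move=> [sa [K [cK KW a0]]] [sb [L [cL LV b0]]]; split.
  apply: smoothM; first exact: (smooth_coordinate_map (coordinate_map_lsub m i0) sa).
  exact: (smooth_coordinate_map (coordinate_map_rsub r j0) sb).
exists (cylinder K L); split.
- apply: bounded_closed_compact.
    by apply: bounded_cylinder; exact: compact_bounded.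
  rewrite (_ : cylinder K L = @lsubmx R 1 r m @^-1` K `&` @rsubmx R 1 r m @^-1` L)//.
  by apply: closedI; apply: closed_comp; try exact: compact_closed; move=> x _;
    [exact: continuous_lsubmx|exact: continuous_rsubmx].
- by move=> x [Kx Lx]; split; [exact: KW|exact: LV].
move=> x KLx; have [Kx|/a0->] := pselect (K (lsubmx x)); last by rewrite mul0r.
by rewrite b0 ?mulr0// => Lx; apply: KLx.
Qed.

Lemma nabla_lsub (a : 'rV[R]_r -> R) (x : 'rV[R]_(r + m)) : smooth a ->
  nabla (fun x : 'rV[R]_(r + m) => a (lsubmx x)) x = row_mx (nabla a (lsubmx x)) 0.
Proof.
move=> sa; apply/rowP => j; rewrite mxE.
apply: (etrans (partial_coordinate_map j x (coordinate_map_lsub m i0) sa)).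
rewrite /lsub_index; case: (split_ordP j) => l ->; rewrite ?(row_mxEl, row_mxEr) !mxE ?mul0r ?mul1r//.
Qed.

End tensor.

(** * Comparison with the limit problem by a cut-off *)

Section cut_off.
Context {R : realType} {r m : nat}.
Implicit Types (W : set 'rV[R]_r).
Local Notation mu := (@lebesgue_rV R (r + m)).
Local Notation mu1 := (@lebesgue_rV R r).
Local Notation mu2 := (@lebesgue_rV R m).
Local Notation rint D f := (mu.-integrable D (EFin \o f)).
Variables p p' k lambda Lambda : R.
Hypotheses (p1 : 1 < p) (pp' : p^-1 + p'^-1 = 1).
Variables (i0 : 'I_r) (j0 : 'I_m).
Variable F : 'rV[R]_(r + m) -> R.
Hypotheses (lambda0 : 0 < lambda) (Lambda0 : 0 < Lambda).
Hypothesis F_convex : forall x y (t : R), 0 <= t <= 1 ->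
  F (t *: x + (1 - t) *: y) <= t * F x + (1 - t) * F y.
Hypothesis F_lower : forall x, lambda * enorm x `^ p <= F x.
Hypothesis F_upper : forall x, F x <= Lambda * (enorm x `^ p + 1).
Hypothesis G_lower : forall xi, lambda * Gbound p k xi <= Gpart F xi.
Hypothesis G_upper : forall xi, Gpart F xi <= Lambda * Gbound p k xi.
Hypothesis k0 : 0 <= k.

Let p0 : 0 < p. Proof. exact: lt_trans p1. Qed.

Lemma Fsec_convex x y (t : R) : 0 <= t <= 1 ->
  Fsec F (t *: x + (1 - t) *: y) <= t * Fsec F x + (1 - t) * Fsec F y.
Proof.
move=> t01; apply: le_trans (F_convex (row_mx 0 x) (row_mx 0 y) t01).
by rewrite !scale_row_mx add_row_mx !scaler0 addr0.
Qed.

Lemma Fsec_lower z : lambda * enorm z `^ p <= Fsec F z.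
Proof. by rewrite -(enorm_row0 (r := r)); exact: F_lower. Qed.

Lemma Fsec_upper z : Fsec F z <= Lambda * (enorm z `^ p + 1).
Proof. by rewrite -(enorm_row0 (r := r)); exact: F_upper. Qed.

Lemma Gbound_ge0 (xi : 'rV[R]_(r + m)) : 0 <= Gbound p k xi.
Proof. by rewrite addr_ge0 ?powR_ge0// !mulr_ge0 ?powR_ge0. Qed.

Lemma Gpart_ge0 xi : 0 <= Gpart F xi.
Proof. by apply: le_trans (G_lower xi); rewrite mulr_ge0 ?Gbound_ge0// ltW. Qed.

Variables (q : nat) (s eps C : R).
Hypotheses (q1 : (1 < q)%N) (eps0 : 0 <= eps) (C0 : 0 <= C).
Hypothesis rem : forall A chi x w z : R,
  0 <= A <= 1 -> 0 < chi <= 1 -> 0 <= x -> chi * x <= A * w -> 0 <= w -> 0 <= z ->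
  chi ^+ q * (x `^ p + k * z `^ (p - k) * x `^ k) <=
    eps * (chi ^+ q * w `^ p) + C * (A `^ s * (w `^ p + z `^ p)).

(** Convexity at the gradient of (1 - chi^q) u + chi^q u_0, where w = u - u_0 and b
    is the gradient of chi: what remains is chi^q G at (-w q b / chi, zeta). *)
Lemma cut_off_convexity (A chi w : R) (xi : 'rV[R]_(r + m)) (zeta : 'rV[R]_m) (b : 'rV[R]_r) :
  0 <= A <= 1 -> 0 <= chi <= 1 -> q%:R * enorm b <= A ->
  chi ^+ q * (F xi - Fsec F zeta) <=
  F xi - F ((1 - chi ^+ q) *: xi + chi ^+ q *: row_mx 0 zeta - w *: row_mx ((q%:R * chi ^+ q.-1) *: b) 0) +
  Lambda * (eps * (chi ^+ q * `|w| `^ p) + C * (A `^ s * (`|w| `^ p + enorm zeta `^ p))).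
Proof.
move=> A01 /andP[chi0 chi1] bA.
have R0 : 0 <= Lambda * (eps * (chi ^+ q * `|w| `^ p) + C * (A `^ s * (`|w| `^ p + enorm zeta `^ p))).
  have X0 : 0 <= chi ^+ q by exact: exprn_ge0.
  by rewrite mulr_ge0 ?(ltW Lambda0)// addr_ge0// !mulr_ge0 ?addr_ge0 ?powR_ge0.
have [chiE|chin0] := eqVneq chi 0.
  rewrite chiE !expr0n; have [-> ->] : (q == 0%N = false) /\ (q.-1 == 0%N = false) by case: q q1 => [|[]].
  rewrite mul0r subr0 scale1r scale0r addr0 mulr0 scale0r row_mx0 scaler0 subr0 subrr add0r.
  by move: R0; rewrite chiE expr0n; case: q q1 => [|[]].
have {}chi0 : 0 < chi by rewrite lt0r chin0.
set rho := chi ^+ q; have rho0 : 0 < rho by exact: exprn_gt0.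
have rho1 : rho <= 1 by rewrite exprn_ile1// ltW.
pose y : 'rV[R]_r := - (chi^-1 * w * q%:R) *: b.
have hE : (1 - rho) *: xi + rho *: row_mx 0 zeta - w *: row_mx ((q%:R * chi ^+ q.-1) *: b) 0 =
    rho *: row_mx y zeta + (1 - rho) *: xi.
  rewrite -addrA [RHS]addrC; congr (_ + _).
  rewrite -scaleNr !scale_row_mx !scaler0 add_row_mx addr0 add0r; congr row_mx.
  rewrite /y !scalerA; congr (_ *: _).
  have -> : rho = chi * chi ^+ q.-1 by rewrite -exprS prednK// ltnW.
  by move: (chi ^+ q.-1) => c; field.
rewrite hE; have rho01 : 0 <= rho <= 1 by rewrite ltW.
have h1 := F_convex (row_mx y zeta) xi rho01.
have h2 := G_upper (row_mx y zeta).
rewrite /Gpart row_mxKr /Gbound row_mxKl row_mxKr in h2.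
have xw : chi * enorm y <= A * `|w|.
  rewrite /y enormZ normrN !normrM (gtr0_norm (_ : 0 < chi^-1)) ?invr_gt0// normr_nat.
  rewrite !mulrA divff ?gt_eqF// mul1r mulrC mulrA [_ * q%:R]mulrC.
  by rewrite mulrA; apply: ler_wpM2r.
have h3 := rem A01 (_ : 0 < chi <= 1) (enorm_ge0 y) xw (normr_ge0 w) (enorm_ge0 zeta).
have {}h3 := h3 ltac:(by rewrite chi0 chi1).
move: h3; rewrite -/rho.
set T := (_ `^ p + k * _ * _) in h2 *; set B := (_ + _ in X in _ <= X -> _) => h3.
have h4 : rho * F (row_mx y zeta) <= rho * Fsec F zeta + Lambda * B.
  apply: (@le_trans _ _ (rho * (Fsec F zeta + Lambda * T))).
    by apply: ler_wpM2l; [exact: ltW|lra].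
  by rewrite mulrDr lerD2l mulrCA ler_wpM2l// ltW.
have fin (a1 a2 a3 t x e : R) : x <= t * a1 + (1 - t) * a2 -> t * a1 <= t * a3 + e ->
  t * (a2 - a3) <= a2 - x + e by lra.
exact: fin h1 h4.
Qed.

Variable V : set 'rV[R]_m.
Hypotheses (oV : open V) (bV : bounded_set V).
Variables f u0 : 'rV[R]_m -> R.
Hypotheses (mf : measurable_fun V f) (jf : mu2.-integrable V (EFin \o (fun y => `|f y| `^ p'))).
Hypothesis u0_min : is_minimizer p V (Fsec F) f u0.

Let g0 := grad V u0.
Let mV : measurable V. Proof. exact: open_measurable_rV. Qed.
Let u0W : Wclosure p (test_function V) V u0 g0.
Proof. exact: (W1p0_Wclosure p1 oV bV u0_min.1). Qed.
Let tsm n (D : set 'rV[R]_n) : test_function D `<=` smooth. Proof. by move=> ? []. Qed.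
Let U : 'rV[R]_(r + m) -> R := from_rsub u0.
Let H (x : 'rV[R]_(r + m)) : 'rV[R]_(r + m) := row_mx 0 (from_rsub g0 x).

Let lifts : set ('rV[R]_(r + m) -> R) := [set (@from_rsub R r m _ psi) | psi in test_function V].

Let lifts_smooth : lifts `<=` smooth.
Proof. by move=> _ [psi tpsi <-]; exact: (smooth_from_rsub j0 tpsi.1). Qed.

Lemma UW W : open W -> bounded_set W -> Wclosure p lifts (cylinder W V) U H.
Proof.
move=> oW bW; exact: (Wclosure_from_rsub p1 j0 (open_measurable_rV oW) bW oV bV (@tsm _ _) u0W).
Qed.

Lemma difference_lateral W w g : open W -> bounded_set W ->
  Wclosure p (test_function (cylinder W V)) (cylinder W V) w g ->
  Wclosure p (lateral V) (cylinder W V) (fun x => w x - U x) (fun x => g x - H x).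
Proof.
move=> oW bW wW; have mD := measurable_cylinder (open_measurable_rV oW) mV.
have bD : bounded_set (cylinder W V) := bounded_cylinder bW bV.
have clos phi psi : test_function (cylinder W V) phi -> lifts psi ->
    lateral V (fun x => 1 * phi x + -1 * psi x).
  move=> tphi [psi' tpsi <-].
  have [s1 z1] := test_function_lateral tphi; have [s2 z2] := from_rsub_lateral (r := r) j0 tpsi.
  split; first exact: (smoothD (smoothM (smooth_cst 1) s1) (smoothM (smooth_cst (-1)) s2)).
  by move=> x Vx; rewrite z1// z2// !mulr0 addr0.
have := Wclosure_lin p1 mD bD (@tsm _ _) lifts_smooth clos wW (UW oW bW).
congr (Wclosure _ _ _ _ _); apply/funext => x; first by rewrite mul1r mulN1r.
by rewrite scale1r scaleN1r.
Qed.

(** The function (1 - alpha^q) u + alpha^q u_0. Its second term is a limit of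
    tensor products of test functions. *)
Lemma cut_off_competitor W alpha u g : open W -> bounded_set W -> test_function W alpha ->
  Wclosure p (test_function (cylinder W V)) (cylinder W V) u g ->
  Wclosure p (test_function (cylinder W V)) (cylinder W V)
   (fun x => u x - alpha (lsubmx x) ^+ q * (u x - U x))
   (fun x => (1 - alpha (lsubmx x) ^+ q) *: g x + alpha (lsubmx x) ^+ q *: H x -
      (u x - U x) *: row_mx ((q%:R * alpha (lsubmx x) ^+ q.-1) *: nabla alpha (lsubmx x)) 0).
Proof.
move=> oW bW talpha uW; have salpha := talpha.1.
have mD := measurable_cylinder (open_measurable_rV oW) mV.
have bD : bounded_set (cylinder W V) := bounded_cylinder bW bV.
pose rho0 (y : 'rV[R]_r) := alpha y ^+ q.
have srho0 : smooth rho0 := smoothX q salpha.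
pose rho (x : 'rV[R]_(r + m)) := rho0 (lsubmx x).
have srho : smooth rho := smooth_coordinate_map (coordinate_map_lsub m i0) srho0.
have trho0 : test_function W rho0.
  split=> //; have [_ [K [cK KW a0]]] := talpha; exists K; split => // y /a0 yE.
  by rewrite /rho0 yE expr0n; case: q q1 => [|[]].
have nrho x : nabla rho x = row_mx ((q%:R * alpha (lsubmx x) ^+ q.-1) *: nabla alpha (lsubmx x)) 0.
  rewrite (nabla_lsub i0 x srho0); congr row_mx; apply/rowP => i; rewrite !mxE /rho0.
  by rewrite -[q in X in partial _ X](prednK (ltnW q1)) partialX// prednK// ltnW.
pose eta (x : 'rV[R]_(r + m)) := 1 * 1 + -1 * rho x.
have s1 : smooth (fun _ : 'rV[R]_(r + m) => 1 : R) := smooth_cst 1.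
have seta : smooth eta := smoothD (smoothM (smooth_cst 1) s1) (smoothM (smooth_cst (-1)) srho).
have neta x : nabla eta x = - nabla rho x.
  rewrite (nabla_lin 1 (-1) x s1 srho) scale1r scaleN1r.
  by rewrite (_ : nabla _ x = 0) ?add0r//; apply/rowP => i; rewrite !mxE partial_cst.
have c1 phi : test_function (cylinder W V) phi -> test_function (cylinder W V) (fun x => eta x * phi x).
  move=> [sphi [K [cK KD phi0]]]; split; first exact: smoothM.
  by exists K; split => // x /phi0 ->; rewrite mulr0.
have c2 phi : lifts phi -> test_function (cylinder W V) (fun x => rho x * phi x).
  by move=> [psi tpsi <-]; exact: (test_function_tensor i0 j0 trho0 tpsi).
have w1 := Wclosure_mul p1 mD bD (@tsm _ _) seta c1 uW.
have w2 := Wclosure_mul p1 mD bD lifts_smooth srho c2 (UW oW bW).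
have c3 phi psi : test_function (cylinder W V) phi -> test_function (cylinder W V) psi ->
   test_function (cylinder W V) (fun x => 1 * phi x + 1 * psi x) by exact: test_functionD.
have := Wclosure_lin p1 mD bD (@tsm _ _) (@tsm _ _) c3 w1 w2.
congr (Wclosure _ _ _ _ _); apply/funext => x.
  by rewrite /eta /rho /rho0; ring.
rewrite neta nrho !scale1r /eta mul1r mulN1r -/(rho x).
move: (row_mx _ 0) => b; apply/rowP => i; rewrite !mxE -[alpha _ ^+ q]/(rho x); ring.
Qed.

Lemma cut_off_rint W u g : open W -> bounded_set W ->
  Wclosure p (test_function (cylinder W V)) (cylinder W V) u g ->
  [/\ rint (cylinder W V) (fun x => `|u x - U x| `^ p + enorm (g0 (rsubmx x)) `^ p),
   rint (cylinder W V) (fun x => `|u x - U x| `^ p),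
   rint (cylinder W V) (fun x => Gpart F (g x)) &
   rint (cylinder W V) (fun x => F (g x) - f (rsubmx x) * u x)].
Proof.
move=> oW bW uW; have mW := open_measurable_rV oW; have fW := bounded_lebesgue_lty mW bW.
have mD := measurable_cylinder mW mV; have bD : bounded_set (cylinder W V) := bounded_cylinder bW bV.
have fD := bounded_lebesgue_lty mD bD.
have [mu_ mg jug _] := uW; have [ju jg] := rint_wdens mD mu_ mg jug.
have [mw mh jwh _] := difference_lateral oW bW uW; have [jw jh] := rint_wdens mD mw mh jwh.
have [mu0 mg0 ju0 _] := u0W; have [iu0 ig0] := rint_wdens mV mu0 mg0 ju0.
have jg0 := (rint_from_rsub (r := r) mW fW mV (fun y _ => powR_ge0 _ _) ig0).1.
have jfD := (rint_from_rsub (r := r) mW fW mV (fun y _ => powR_ge0 _ _) jf).1.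
have mgr : measurable_fun (cylinder W V) (fun x => rsubmx (g x)).
  exact: (measurableT_comp (@measurable_rsubmx _ _ _ _) mg).
have jgr := rint_enorm_rsubmx p1 mD mg jg.
split; [exact: (rintD mD jw jg0)|exact: jw| |].
  apply: (rintB mD).
    exact: (rint_convex_growth p1 lambda0 Lambda0 F_convex F_lower F_upper mD fD mg jg).
  exact: (rint_convex_growth p1 lambda0 Lambda0 Fsec_convex Fsec_lower Fsec_upper mD fD mgr jgr).
exact: (rint_energy p1 pp' lambda0 Lambda0 F_convex F_lower F_upper mD fD
  (measurable_from_rsub mV mf) jfD mu_ mg ju jg).
Qed.

(** Minimality of u against the competitor of [cut_off_competitor]. *)
Lemma cut_off_estimate W alpha A u : open W -> bounded_set W -> test_function W alpha ->
  (forall y, 0 <= alpha y <= 1) -> 0 <= A <= 1 -> (forall y, q%:R * enorm (nabla alpha y) <= A) ->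
  is_minimizer p (cylinder W V) F (from_rsub f) u ->
  \int[mu]_(x in cylinder W V) (alpha (lsubmx x) ^+ q * Gpart F (grad (cylinder W V) u x)) +
  \int[mu]_(x in cylinder W V) (alpha (lsubmx x) ^+ q *
     excess (Fsec F) V f u0 (rsubmx x) (u x) (rsubmx (grad (cylinder W V) u x))) <=
  Lambda * (eps * \int[mu]_(x in cylinder W V) (alpha (lsubmx x) ^+ q * `|u x - U x| `^ p) +
     C * (A `^ s * \int[mu]_(x in cylinder W V) (`|u x - U x| `^ p + enorm (g0 (rsubmx x)) `^ p))).
Proof.
move=> oW bW talpha alpha01 A01 dalpha u_min; set D := cylinder W V.
have mW := open_measurable_rV oW; have mD : measurable D := measurable_cylinder mW mV.
have bD : bounded_set D := bounded_cylinder bW bV; have oD : open D := open_cylinder oW oV.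
set g := grad D u.
have uW : Wclosure p (test_function D) D u g := W1p0_Wclosure p1 oD bD u_min.1.
have hW := cut_off_competitor oW bW talpha uW.
have mfD : measurable_fun D (from_rsub f) := measurable_from_rsub mV mf.
have le := minimizer_le p1 lambda0 Lambda0 F_convex F_lower F_upper oD bD mfD u_min hW.
have [jwg jw jG jE] := cut_off_rint oW bW uW; have [_ _ _ jE'] := cut_off_rint oW bW hW.
set rho := fun y => alpha y ^+ q.
have rho01 y : 0 <= rho y <= 1.
  have /andP[a0 a1] := alpha01 y; by rewrite /rho exprn_ge0// exprn_ile1.
have mrho : measurable_fun W rho := smooth_measurable (smoothX q talpha.1).
have mrhoD : measurable_fun D (fun x => rho (lsubmx x)) := measurable_from_lsub mW mrho.
have rhoD (x : 'rV[R]_(r + m)) : D x -> `|rho (lsubmx x)| <= 1.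
  by move=> _; have /andP[r0 r1] := rho01 (lsubmx x); rewrite ger0_norm.
have o01 : 0 <= (1 : R) <= 1 by rewrite ler01 lexx.
have [_ jX _] := gap_le_excess p1 pp' lambda0 Lambda0 Fsec_convex Fsec_lower Fsec_upper oV bV mf jf u0_min
  oW bW mrho (fun y _ => rho01 y) o01 uW.
have k1 := rint_mulb mD jG mrhoD rhoD; have k2 := rint_mulb mD jX mrhoD rhoD.
have k3 := rint_mulb mD jw mrhoD rhoD.
rewrite -(RintegralD mD k1 k2) -(RintegralZl _ mD jwg) -(RintegralZl _ mD k3).
have l1 := rintZ (A `^ s) mD jwg; have l2 := rintZ eps mD k3; have l3 := rintZ C mD l1.
rewrite -(RintegralZl _ mD l1) -(RintegralD mD l2 l3) -(RintegralZl _ mD (rintD mD l2 l3)).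
have l4 := rintZ Lambda mD (rintD mD l2 l3).
have jEE := rintB mD jE jE'.
have le0 : \int[mu]_(x in D) (F (g x) - f (rsubmx x) * u x -
  (F ((1 - alpha (lsubmx x) ^+ q) *: g x + alpha (lsubmx x) ^+ q *: H x -
      (u x - U x) *: row_mx ((q%:R * alpha (lsubmx x) ^+ q.-1) *: nabla alpha (lsubmx x)) 0) -
   f (rsubmx x) * (u x - alpha (lsubmx x) ^+ q * (u x - U x)))) <= 0.
  by rewrite (RintegralB mD jE jE') subr_le0.
apply: (@le_trans _ _ (\int[mu]_(x in D) (F (g x) - f (rsubmx x) * u x -
  (F ((1 - alpha (lsubmx x) ^+ q) *: g x + alpha (lsubmx x) ^+ q *: H x -
      (u x - U x) *: row_mx ((q%:R * alpha (lsubmx x) ^+ q.-1) *: nabla alpha (lsubmx x)) 0) -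
   f (rsubmx x) * (u x - alpha (lsubmx x) ^+ q * (u x - U x)))) +
   \int[mu]_(x in D) (Lambda * (eps * (alpha (lsubmx x) ^+ q * `|u x - U x| `^ p) +
     C * (A `^ s * (`|u x - U x| `^ p + enorm (g0 (rsubmx x)) `^ p)))))); last by rewrite gerDr.
rewrite -(RintegralD mD jEE l4).
apply: (le_Rintegral mD (rintD mD k1 k2) (rintD mD jEE l4)) => x Dx /=.
have := cut_off_convexity (u x - U x) (g x) (g0 (rsubmx x)) A01 (alpha01 (lsubmx x)) (dalpha (lsubmx x)).
rewrite /H /excess /Gpart -/g0 /rho /from_rsub -[U x]/(u0 (rsubmx x)).
move: (Lambda * _) (F _) (F (_ - _)) => B Fg Fh.
move: (Fsec F (rsubmx (g x))) (Fsec F _) (alpha _ ^+ q) (f _) (u x) (u0 _) => c1 c2 c3 c4 c5 c6.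
by move=> h; rewrite -mulrDr; lra.
Qed.

End cut_off.

(** * Dilations and fixed cut-off functions *)

Section dilations.
Context {R : realType} {n : nat}.
Implicit Types (W : set 'rV[R]_n) (l : R).
Local Notation mu := (@lebesgue_rV R n).

Lemma dilationE W l : 0 < l -> [set l *: x | x in W] = (fun x => l^-1 *: x) @^-1` W.
Proof.
move=> l0; apply/seteqP; split => x /=.
  by move=> [y Wy <-]; rewrite scalerA mulVf ?gt_eqF// scale1r.
by move=> Wx; exists (l^-1 *: x) => //; rewrite scalerA divff ?gt_eqF// scale1r.
Qed.

Lemma open_dilation W l : 0 < l -> open W -> open [set l *: x | x in W].
Proof.
by move=> l0 oW; rewrite dilationE//; apply: open_comp => // x _; exact: (coordinate_map_scale _ _).1.
Qed.

Lemma dilation_norm_le W M l : 0 < l -> (forall x, W x -> `|x| <= M) ->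
  forall x, [set l *: x | x in W] x -> `|x| <= M * l.
Proof.
by move=> l0 WM _ [x Wx <-]; rewrite normrZ (gtr0_norm l0) mulrC ler_wpM2r ?WM// ltW.
Qed.

Lemma bounded_dilation W l : 0 < l -> bounded_set W -> bounded_set [set l *: x | x in W].
Proof.
move=> l0 /bounded_le[M M0 WM]; exists (M * l); split; first exact: num_real.
by move=> N MN x Wx; apply: ltW; apply: le_lt_trans MN; exact: (dilation_norm_le l0 WM Wx).
Qed.

Lemma dilation_subset W l0 l : starshaped0 W -> 0 < l0 -> l0 <= l ->
  [set l0 *: x | x in W] `<=` [set l *: x | x in W].
Proof.
move=> star l00 l0l _ [x Wx <-]; have lgt0 : 0 < l by exact: lt_le_trans l0l.
exists ((l0 / l) *: x); last by rewrite scalerA mulrCA divff ?gt_eqF// mulr1.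
apply: star => //; apply/andP; split; first by rewrite divr_ge0// ltW.
by rewrite ler_pdivrMr// mul1r.
Qed.

Lemma dilation_measure W : bounded_set W -> open W -> exists2 K : R, 0 <= K &
  forall l, 0 < l -> fine (mu [set l *: x | x in W]) <= K * l ^+ n.
Proof.
move=> bW oW; have [M M0 WM] := bounded_le bW.
exists ((4 * M) ^+ n); first by rewrite exprn_ge0// mulr_ge0// ltW.
move=> l l0; have Ml : 0 < M * l by rewrite mulr_gt0.
pose a : 'rV[R]_n := const_mx (- (2 * (M * l))); pose b : 'rV[R]_n := const_mx (2 * (M * l)).
have sub : [set l *: x | x in W] `<=` obox a b.
  move=> x /(dilation_norm_le l0 WM) xM i; rewrite !mxE -ltr_norml.
  by apply: le_lt_trans (coord_le_norm x i) _; apply: le_lt_trans xM _; lra.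
have E : mu (obox a b) = ((4 * M) ^+ n * l ^+ n)%:E.
  rewrite lebesgue_obox (eq_bigr (fun=> (4 * M * l)%:E)); last first.
    move=> i _; rewrite lebesgue_measure_itv/= !mxE lte_fin ifT; last by lra.
    by rewrite -EFinD; congr EFin; ring.
  by rewrite prodEFin prodr_const card_ord exprMn.
rewrite -lee_fin fineK; last first.
  rewrite ge0_fin_numE//; apply: bounded_lebesgue_lty; last exact: bounded_dilation.
  by apply: open_measurable_rV; exact: open_dilation.
rewrite -E; apply: le_measure; rewrite ?inE//; last exact: measurable_obox.
by apply: open_measurable_rV; exact: open_dilation.
Qed.

Lemma test_function_at0 W : open W -> W 0 -> exists chi : 'rV[R]_n -> R,
  [/\ test_function W chi, forall y, 0 <= chi y <= 1 & 0 < chi 0].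
Proof.
move=> oW W0; have /nbhs_ballP[e /= e0 eW] : nbhs (0 : 'rV[R]_n) W by exact: open_nbhs_nbhs.
have e2 : 0 < e / 2 by rewrite divr_gt0.
exists (@box_bump R n (const_mx (- (e / 2))) (const_mx (e / 2))); split.
- apply: test_function_bump => y yc; apply: eW; split=> // i j; rewrite ord1 mxE.
  rewrite /ball/= sub0r normrN; have := yc j; rewrite !mxE -ler_norml => /le_lt_trans; apply.
  by rewrite ltr_pdivrMr// ltr_pMr// ltr1n.
- by move=> y; rewrite bump_ge0 bump_le1.
- by apply: bump_gt0 => i; rewrite !mxE oppr_lt0 e2.
Qed.

Lemma test_function_dilation W chi l : 0 < l -> test_function W chi ->
  test_function [set l *: x | x in W] (fun y => chi (l^-1 *: y)).
Proof.
move=> l0 [schi [K [cK KW chi0]]]; split.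
  exact: (smooth_coordinate_map (coordinate_map_scale n l^-1) schi).
exists [set l *: x | x in K]; split.
- by apply: continuous_compact => //; apply: continuous_subspaceT => x; exact: scaler_continuous.
- by move=> _ [x /KW Wx <-]; exists x.
by move=> y Ky; apply: chi0 => Kx; apply: Ky; rewrite dilationE.
Qed.

Lemma nabla_dilation chi l y : smooth chi ->
  nabla (fun y : 'rV[R]_n => chi (l^-1 *: y)) y = l^-1 *: nabla chi (l^-1 *: y).
Proof.
move=> schi; apply/rowP => i; rewrite !mxE.
exact: (partial_coordinate_map i y (coordinate_map_scale n l^-1) schi).
Qed.

Lemma test_function_nabla_bounded W chi : test_function W chi ->
  exists2 B : R, 0 <= B & forall y, enorm (nabla chi y) <= B.
Proof.
move=> tchi.
have /choice[C CP] (i : 'I_n) : exists c : R, 0 <= c /\ forall y, `|partial i chi y| <= c.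
  by have [C C0 CP] := test_function_bounded (test_function_partial i tchi); exists C.
exists (\sum_i C i); first by rewrite sumr_ge0// => i _; case: (CP i).
move=> y; apply: le_trans (enorm_le_sum _) _; apply: ler_sum => i _.
by rewrite mxE; case: (CP i).
Qed.

End dilations.

(** * Decay of the excess and strong convergence *)

Lemma le_young_sub (R : realDomainType) (a b c d e e' : R) : a <= b -> c <= e + e' -> d <= c ->
  a <= b - d + (e + e').
Proof. by move=> *; lra. Qed.

Lemma absorb_energy (R : realFieldType) (X Y Z a b : R) : Y <= a -> Z <= 2^-1 * X -> X <= Y + (Z + b) ->
  X <= 2 * a + 2 * b.
Proof. by move=> *; lra. Qed.

Lemma half_absorb (R : realFieldType) (X E a b : R) : 0 <= X -> 0 <= E -> a <= 2^-1 * E -> X + E <= a + b ->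
  X <= 2 * b /\ E <= 2 * b.
Proof. by move=> *; split; lra. Qed.

Section uniform_estimates.
Context {R : realType} {r m : nat}.
Implicit Types (W : set 'rV[R]_r).
Local Notation mu := (@lebesgue_rV R (r + m)).
Local Notation mu1 := (@lebesgue_rV R r).
Local Notation mu2 := (@lebesgue_rV R m).
Local Notation rint D f := (mu.-integrable D (EFin \o f)).
Variables p p' k lambda Lambda : R.
Hypotheses (p1 : 1 < p) (pp' : p^-1 + p'^-1 = 1) (k0p : 0 <= k < p).
Variables (i0 : 'I_r) (j0 : 'I_m).
Variable F : 'rV[R]_(r + m) -> R.
Hypotheses (lambda0 : 0 < lambda) (Lambda0 : 0 < Lambda).
Hypothesis F_convex : forall x y (t : R), 0 <= t <= 1 ->
  F (t *: x + (1 - t) *: y) <= t * F x + (1 - t) * F y.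
Hypothesis F_lower : forall x, lambda * enorm x `^ p <= F x.
Hypothesis F_upper : forall x, F x <= Lambda * (enorm x `^ p + 1).
Hypothesis G_lower : forall xi, lambda * Gbound p k xi <= Gpart F xi.
Hypothesis G_upper : forall xi, Gpart F xi <= Lambda * Gbound p k xi.
Hypothesis r_small_0 : k = 0 -> r%:R < p.
Hypothesis r_small_k : 0 < k -> r%:R < k * p / (p - k).
Hypothesis F_uniform : 0 < k -> exists2 c : R, 0 < c & forall x y : 'rV[R]_m,
  c * enorm (x - y) `^ p <= gap (Fsec F) (2^-1) x y.
Variable V : set 'rV[R]_m.
Hypotheses (oV : open V) (bV : bounded_set V).
Variables f u0 : 'rV[R]_m -> R.
Hypotheses (mf : measurable_fun V f) (jf : mu2.-integrable V (EFin \o (fun y => `|f y| `^ p'))).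
Hypothesis u0_min : is_minimizer p V (Fsec F) f u0.

Let p0 : 0 < p. Proof. exact: lt_trans p1. Qed.
Let k0 : 0 <= k. Proof. by have /andP[] := k0p. Qed.
Let mV : measurable V. Proof. exact: open_measurable_rV. Qed.
Let g0 := grad V u0.
Let U : 'rV[R]_(r + m) -> R := from_rsub u0.
Let tsm n (D : set 'rV[R]_n) : test_function D `<=` smooth. Proof. by move=> ? []. Qed.
Let sC := @Fsec_convex R r m F F_convex.
Let sL := @Fsec_lower R r m p lambda F F_lower.
Let sU := @Fsec_upper R r m p Lambda F F_upper.
Let u0W : Wclosure p (test_function V) V u0 g0.
Proof. exact: (W1p0_Wclosure p1 oV bV u0_min.1). Qed.

Let msize W (u : 'rV[R]_(r + m) -> R) := \int[mu]_(x in cylinder W V) (`|u x - U x| `^ p + enorm (g0 (rsubmx x)) `^ p).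

Lemma weighted_ge0 W (a : 'rV[R]_r -> R) u g : open W -> bounded_set W -> measurable_fun W a ->
  (forall y, W y -> 0 <= a y <= 1) ->
  Wclosure p (test_function (cylinder W V)) (cylinder W V) u g ->
  0 <= \int[mu]_(x in cylinder W V) (a (lsubmx x) * Gpart F (g x)) /\
  0 <= \int[mu]_(x in cylinder W V) (a (lsubmx x) * excess (Fsec F) V f u0 (rsubmx x) (u x) (rsubmx (g x))).
Proof.
move=> oW bW ma a01 uW; split.
  apply: Rintegral_ge0 => x [Wx Vx]; apply: mulr_ge0; first by have /andP[] := a01 _ Wx.
  exact: (Gpart_ge0 lambda0 G_lower k0).
have o01 : 0 <= (1 : R) <= 1 by rewrite ler01 lexx.
have [_ _] := gap_le_excess p1 pp' lambda0 Lambda0 sC sL sU oV bV mf jf u0_min oW bW ma a01 o01 uW.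
rewrite mul1r; apply: le_trans; rewrite le_eqVlt; apply/orP; left; apply/eqP.
rewrite (eq_Rintegral _ (g := fun=> 0)); first by rewrite Rintegral_cst ?mul0r//; exact: (measurable_cylinder (open_measurable_rV oW) mV).
by move=> x _; rewrite /gap subrr mul1r !mul0r scale1r scale0r !addr0 subrr mulr0.
Qed.

(** When k > 0 the uniform convexity of F'' and Poincare's inequality absorb the
    first term of the remainder into the excess. *)
Lemma energy_decay : exists (q : nat) (s K : R), [/\ (1 < q)%N, r%:R < s, 0 < s, 0 <= K &
  forall W alpha A u, open W -> bounded_set W -> test_function W alpha ->
  (forall y, 0 <= alpha y <= 1) -> 0 <= A <= 1 -> (forall y, q%:R * enorm (nabla alpha y) <= A) ->
  is_minimizer p (cylinder W V) F (from_rsub f) u ->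
  \int[mu]_(x in cylinder W V) (alpha (lsubmx x) ^+ q * Gpart F (grad (cylinder W V) u x)) <=
    K * (A `^ s * msize W u) /\
  \int[mu]_(x in cylinder W V) (alpha (lsubmx x) ^+ q *
     excess (Fsec F) V f u0 (rsubmx x) (u x) (rsubmx (grad (cylinder W V) u x))) <= K * (A `^ s * msize W u)].
Proof.
have [q [s [q1 rs s0 rem]]] := remainder_bound p1 k0p r_small_0 r_small_k.
have facts W alpha : test_function W alpha -> (forall y, 0 <= alpha y <= 1) ->
    measurable_fun W (fun y => alpha y ^+ q) /\ (forall y, 0 <= alpha y ^+ q <= 1).
  move=> talpha a01; split; first exact: (smooth_measurable (smoothX q talpha.1)).
  by move=> y; have /andP[a0 a1] := a01 y; rewrite exprn_ge0// exprn_ile1.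
have [kE|kn0] := eqVneq k 0.
  have [C C0 remC] := rem 0 (or_intror (conj kE erefl)).
  exists q, s, (Lambda * C); split => //; first by rewrite mulr_ge0// ltW.
  move=> W alpha A u oW bW talpha a01 A01 dalpha u_min.
  have oD := open_cylinder oW oV; have bD := bounded_cylinder bW bV.
  have uW := W1p0_Wclosure p1 oD bD u_min.1.
  have [mrho rho01] := facts W alpha talpha a01.
  have [X0 E0] := weighted_ge0 oW bW mrho (fun y _ => rho01 y) uW.
  have := cut_off_estimate p1 pp' i0 j0 lambda0 Lambda0 F_convex F_lower F_upper G_upper q1 (lexx 0) C0 remC
    oV bV mf jf u0_min oW bW talpha a01 A01 dalpha u_min.
  rewrite -/(msize W u) mul0r add0r mulrA.
  move: (_ * _) (\int[mu]_(x in _) _) (\int[mu]_(x in _) _) X0 E0 => B X E X0 E0 h.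
  by split; lra.
have k_gt0 : 0 < k by rewrite lt0r kn0.
have [c c0 unif] := F_uniform k_gt0.
have [P P0 poinc] := poincare (r := r) p1 j0 oV bV.
(* with this eps the first term of the remainder is at most half of the excess *)
pose eps := c / (Lambda * (P + 1)).
have P1 : 0 < P + 1 by rewrite ltr_wpDl.
have eps0 : 0 < eps by rewrite divr_gt0// mulr_gt0.
have [C C0 remC] := rem eps (or_introl eps0).
exists q, s, (2 * (Lambda * C)); split => //; first by rewrite !mulr_ge0// ltW.
move=> W alpha A u oW bW talpha a01 A01 dalpha u_min.
have mW := open_measurable_rV oW; have oD := open_cylinder oW oV; have bD := bounded_cylinder bW bV.
have mD := measurable_cylinder mW mV.
have uW := W1p0_Wclosure p1 oD bD u_min.1.
have [mrho rho01] := facts W alpha talpha a01.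
have [X0 E0] := weighted_ge0 oW bW mrho (fun y _ => rho01 y) uW.
have := cut_off_estimate p1 pp' i0 j0 lambda0 Lambda0 F_convex F_lower F_upper G_upper q1 (ltW eps0) C0 remC
  oV bV mf jf u0_min oW bW talpha a01 A01 dalpha u_min.
rewrite -/(msize W u).
have dW := difference_lateral p1 j0 oV bV u0_min oW bW uW.
have l1 := poinc _ _ _ _ _ mW bW mrho (fun y _ => rho01 y) dW.
have h01 : 0 <= (2^-1 : R) <= 1 by rewrite invr_ge0 ler0n/= invf_le1// ler1n.
have [jgap _ l2] := gap_le_excess p1 pp' lambda0 Lambda0 sC sL sU oV bV mf jf u0_min oW bW mrho (fun y _ => rho01 y) h01 uW.
have mrhoD := measurable_from_lsub (V := V) mW mrho.
have rhoD (x : 'rV[R]_(r + m)) : cylinder W V x -> `|alpha (lsubmx x) ^+ q| <= 1.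
  by move=> _; have /andP[r0 r1] := rho01 (lsubmx x); rewrite ger0_norm.
set g := grad (cylinder W V) u in uW dW l1 l2 jgap X0 E0 *.
have [_ mgd jgd _] := dW; have [md _ _ _] := dW; have [_ jd] := rint_wdens mD md mgd jgd.
have jrd := rint_enorm_rsubmx p1 mD mgd jd.
have j1 := rint_mulb mD jrd mrhoD rhoD; have j2 := rint_mulb mD jgap mrhoD rhoD.
have l3 : c * \int[mu]_(x in cylinder W V) (alpha (lsubmx x) ^+ q *
     enorm (rsubmx (g x - row_mx 0 (from_rsub g0 x))) `^ p) <=
   \int[mu]_(x in cylinder W V) (alpha (lsubmx x) ^+ q * gap (Fsec F) (2^-1) (rsubmx (g x)) (g0 (rsubmx x))).
  rewrite -(RintegralZl _ mD j1); apply: (le_Rintegral mD (rintZ c mD j1) j2) => x Dx /=.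
  rewrite mulrCA; apply: ler_wpM2l; first by have /andP[] := rho01 (lsubmx x).
  rewrite (_ : rsubmx _ = rsubmx (g x) - g0 (rsubmx x)); first exact: unif.
  rewrite -[g0 _](@row_mxKr _ 1 r m 0 (from_rsub g0 x)).
  by apply/rowP => j; rewrite !mxE.
move=> est; have fin (X E Q N T b : R) : 0 <= X -> 0 <= E -> 0 <= N -> Q <= P * N -> c * N <= T -> T <= 2^-1 * E ->
    X + E <= Lambda * (eps * Q + b) -> X <= 2 * (Lambda * b) /\ E <= 2 * (Lambda * b).
  move=> X0' E0' N0 q1' q2 q3 q4.
  have eE : Lambda * (eps * Q) = c * Q / (P + 1) by rewrite /eps; field; rewrite !gt_eqF.
  have : c * Q / (P + 1) <= 2^-1 * E.
    rewrite ler_pdivrMr//; apply: (@le_trans _ _ (c * (P * N))); first by rewrite ler_wpM2l// ltW.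
    rewrite mulrCA; apply: (@le_trans _ _ (P * (2^-1 * E))).
      by apply: (ler_wpM2l P0); exact: le_trans q2 q3.
    by rewrite mulrC ler_wpM2l ?lerDl// mulr_ge0// invr_ge0.
  by rewrite -eE => q5; apply: half_absorb X0' E0' q5 _; rewrite -mulrDr.
have N0 : 0 <= \int[mu]_(x in cylinder W V) (alpha (lsubmx x) ^+ q *
     enorm (rsubmx (g x - row_mx 0 (from_rsub g0 x))) `^ p).
  apply: Rintegral_ge0 => x _; rewrite mulr_ge0 ?powR_ge0//.
  by have /andP[] := rho01 (lsubmx x).
have := fin _ _ _ _ _ _ X0 E0 N0 l1 l3 l2 est.
by rewrite !mulrA.
Qed.

(** The function 0 has an energy proportional to the measure of W. Poincare's and
    Young's inequalities absorb the term with f. *)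
Lemma minimizer_size : exists2 K : R, 0 <= K & forall W u, open W -> bounded_set W ->
  is_minimizer p (cylinder W V) F (from_rsub f) u -> msize W u <= K * fine (mu1 W).
Proof.
have p'0 : 0 < p' := lt_trans ltr01 (conjugate_gt1 p1 pp').
have [P P0 poinc] := poincare (r := r) p1 j0 oV bV.
(* with this eps Poincare's inequality bounds eps |u|^p by half of lambda |grad u|^p *)
pose eps := lambda / (2 * (P + 1)).
have P1 : 0 < P + 1 by rewrite ltr_wpDl.
have eps0 : 0 < eps by rewrite divr_gt0// mulr_gt0.
have [C C0 young] := young_eps p0 p'0 pp' eps0.
have [mu0 mg0 ju0 _] := u0W; have [iu0 ig0] := rint_wdens mV mu0 mg0 ju0.
have fV : (mu2 V < +oo)%E := bounded_lebesgue_lty mV bV.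
pose N1 := \int[mu2]_(y in V) (1 : R); pose Nf := \int[mu2]_(y in V) `|f y| `^ p'.
pose Nu := \int[mu2]_(y in V) `|u0 y| `^ p; pose Ng := \int[mu2]_(y in V) enorm (g0 y) `^ p.
have N10 : 0 <= N1 by apply: Rintegral_ge0.
have Nf0 : 0 <= Nf by apply: Rintegral_ge0 => y _; exact: powR_ge0.
have Nu0 : 0 <= Nu by apply: Rintegral_ge0 => y _; exact: powR_ge0.
have Ng0 : 0 <= Ng by apply: Rintegral_ge0 => y _; exact: powR_ge0.
pose T := 2 `^ p : R; have T0 : 0 <= T by exact: powR_ge0.
pose B := 2 / lambda * (Lambda * N1 + C * Nf).
have B0 : 0 <= B.
  exact: (mulr_ge0 (divr_ge0 (ler0n _ 2) (ltW lambda0))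
    (addr_ge0 (mulr_ge0 (ltW Lambda0) N10) (mulr_ge0 C0 Nf0))).
exists (T * (P * B + Nu) + Ng).
  exact: (addr_ge0 (mulr_ge0 T0 (addr_ge0 (mulr_ge0 P0 B0) Nu0)) Ng0).
move=> W u oW bW u_min; have mW := open_measurable_rV oW; have fW := bounded_lebesgue_lty mW bW.
set D := cylinder W V; have oD : open D := open_cylinder oW oV.
have bD : bounded_set D := bounded_cylinder bW bV; have mD : measurable D := measurable_cylinder mW mV.
have fD := bounded_lebesgue_lty mD bD.
have uW : Wclosure p (test_function D) D u (grad D u) := W1p0_Wclosure p1 oD bD u_min.1.
set g := grad D u in uW *.
have mfD : measurable_fun D (from_rsub f) := measurable_from_rsub mV mf.
have [j1 E1] := rint_from_rsub (r := r) mW fW mV (fun y _ => ler01) (rint_cst (1 : R) mV fV).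
have [jfD Ef] := rint_from_rsub (r := r) mW fW mV (fun y _ => powR_ge0 _ _) jf.
have [juD Eu] := rint_from_rsub (r := r) mW fW mV (fun y _ => powR_ge0 _ _) iu0.
have [jgD Eg] := rint_from_rsub (r := r) mW fW mV (fun y _ => powR_ge0 _ _) ig0.
rewrite -/D -/N1 -/Nf -/Nu -/Ng in j1 E1 jfD Ef juD Eu jgD Eg.
have [mu_ mg jug _] := uW; have [ju jg] := rint_wdens mD mu_ mg jug.
have w0 : 0 <= fine (mu1 W) by apply: fine_ge0.
have jgr := rint_enorm_rsubmx p1 mD mg jg.
have s0 : smooth (fun _ : 'rV[R]_(r + m) => 0 : R) := smooth_cst 0.
have t0 : test_function D (fun _ : 'rV[R]_(r + m) => 0 : R).
  by split => //; exists set0; split; [exact: compact0|move=> x []|].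
have zW := Wclosure_self p1 mD bD s0 t0.
have le := minimizer_le p1 lambda0 Lambda0 F_convex F_lower F_upper oD bD mfD u_min zW.
have je := rint_energy p1 pp' lambda0 Lambda0 F_convex F_lower F_upper mD fD mfD jfD mu_ mg ju jg.
have s1 : \int[mu]_(x in D) (F (g x) - from_rsub f x * u x) <= fine (mu1 W) * (Lambda * N1).
  apply: le_trans le _; rewrite mulrCA -E1 -(RintegralZl _ mD j1).
  have [mz mnz jz _] := zW; have [jz1 jz2] := rint_wdens mD mz mnz jz.
  have jez := rint_energy p1 pp' lambda0 Lambda0 F_convex F_lower F_upper mD fD mfD jfD mz mnz jz1 jz2.
  apply: (le_Rintegral mD jez (rintZ Lambda mD j1)) => x _ /=.
  rewrite mulr0 subr0 (_ : nabla _ x = 0); last by apply/rowP => i; rewrite !mxE partial_cst.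
  by apply: le_trans (F_upper _) _; rewrite enorm0 powR0 ?gt_eqF// add0r.
have wl := Wclosure_subset p1 mD bD (@tsm _ D) mD (fun x => id) (@test_function_lateral _ _ _ W V) uW.
have o01 : 0 <= (1 : R) <= 1 by rewrite ler01 lexx.
have s2 : \int[mu]_(x in D) `|u x| `^ p <= P * \int[mu]_(x in D) enorm (g x) `^ p.
  have m1 : measurable_fun W (fun _ : 'rV[R]_r => 1 : R) by exact: measurable_cst.
  have := poinc _ _ _ _ _ mW bW m1 (fun y _ => o01) wl; rewrite -/D.
  under eq_Rintegral do rewrite mul1r.
  under [X in _ <= _ * X]eq_Rintegral do rewrite mul1r.
  move=> h; apply: le_trans h _; apply: (ler_wpM2l P0); apply: (le_Rintegral mD jgr jg) => x _.
  by apply: ler_powR_base; [exact: ltW|exact: enorm_ge0|exact: enorm_rsub_le].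
have s3 : lambda * \int[mu]_(x in D) enorm (g x) `^ p <=
    \int[mu]_(x in D) (F (g x) - from_rsub f x * u x) +
    (eps * \int[mu]_(x in D) `|u x| `^ p + C * (fine (mu1 W) * Nf)).
  rewrite -Ef -(RintegralZl _ mD jg) -(RintegralZl _ mD ju) -(RintegralZl _ mD jfD).
  rewrite -(RintegralD mD (rintZ eps mD ju) (rintZ C mD jfD)).
  rewrite -(RintegralD mD je (rintD mD (rintZ eps mD ju) (rintZ C mD jfD))).
  apply: (le_Rintegral mD (rintZ lambda mD jg) (rintD mD je (rintD mD (rintZ eps mD ju) (rintZ C mD jfD)))) => x _ /=.
  have h1 := F_lower (g x); have h2 := young _ _ (normr_ge0 (u x)) (normr_ge0 (from_rsub f x)).
  have h3 : from_rsub f x * u x <= `|u x| * `|from_rsub f x|.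
    by rewrite mulrC -normrM ler_norm.
  exact: le_young_sub h1 h2 h3.
have s4 : \int[mu]_(x in D) enorm (g x) `^ p <= B * fine (mu1 W).
  move: s1 s2 s3; move: (\int[mu]_(x in D) enorm (g x) `^ p) (Rintegral_ge0 mu (fun x (_ : D x) => powR_ge0 (enorm (g x)) p)).
  move=> X X0; move: (\int[mu]_(x in D) _) (\int[mu]_(x in D) _) (fine _) => Z Y w s1 s2 s3.
  have s2' : eps * Z <= lambda / 2 * X.
    apply: (@le_trans _ _ (eps * (P * X))); first by rewrite ler_wpM2l// ltW.
    rewrite mulrA; apply: (ler_wpM2r X0); rewrite /eps mulrAC ler_pdivrMr ?mulr_gt0//.
    rewrite (_ : lambda / 2 * _ = lambda * (P + 1)); last by field.
    by apply: ler_wpM2l; [exact: ltW|rewrite lerDl].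
  rewrite /B -mulrA mulrAC ler_pdivlMr// mulrC.
  have -> : 2 * ((Lambda * N1 + C * Nf) * w) = 2 * (w * (Lambda * N1)) + 2 * (C * (w * Nf)) by ring.
  have e2 : lambda / 2 * X = 2^-1 * (lambda * X) by ring.
  rewrite e2 in s2'; exact: absorb_energy s1 s2' s3.
have sz : msize W u <= T * (\int[mu]_(x in D) `|u x| `^ p + fine (mu1 W) * Nu) + fine (mu1 W) * Ng.
  rewrite -Eu -Eg -(RintegralD mD ju juD) -(RintegralZl _ mD (rintD mD ju juD)).
  rewrite -(RintegralD mD (rintZ T mD (rintD mD ju juD)) jgD).
  have [jsz _ _ _] := cut_off_rint p1 pp' j0 lambda0 Lambda0 F_convex F_lower F_upper oV bV mf jf u0_min oW bW uW.
  apply: (le_Rintegral mD jsz (rintD mD (rintZ T mD (rintD mD ju juD)) jgD)) => x _ /=.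
  apply: lerD => //; apply: le_trans (norm_powRD_le _ _ (ltW p0)) _; by rewrite normrN.
apply: le_trans sz _.
have -> : (T * (P * B + Nu) + Ng) * fine (mu1 W) =
  T * (P * (B * fine (mu1 W)) + fine (mu1 W) * Nu) + fine (mu1 W) * Ng by ring.
rewrite lerD2r; apply: (ler_wpM2l T0); rewrite lerD2r; apply: le_trans s2 _.
exact: ler_wpM2l.
Qed.

Variable w' : set 'rV[R]_r.
Hypotheses (ow : open w') (bw : bounded_set w') (w0 : w' 0) (star : starshaped0 w').
Variable u : R -> 'rV[R]_(r + m) -> R.
Hypothesis u_min : forall l, 0 < l -> is_minimizer p (Omega w' V l) F (from_rsub f) (u l).

Local Notation dil l := [set l *: x | x in w'].
Local Notation Om l := (Omega w' V l).
Let g l := grad (Om l) (u l).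

Let odil l : 0 < l -> open (dil l). Proof. by move=> l0; exact: open_dilation. Qed.
Let bdil l : 0 < l -> bounded_set (dil l). Proof. by move=> l0; exact: bounded_dilation. Qed.
Let mdil l : 0 < l -> measurable (dil l). Proof. by move=> l0; exact: open_measurable_rV (odil l0). Qed.
Let oOm l : 0 < l -> open (Om l). Proof. by move=> l0; exact: open_cylinder (odil l0) oV. Qed.
Let bOm l : 0 < l -> bounded_set (Om l). Proof. by move=> l0; exact: bounded_cylinder (bdil l0) bV. Qed.
Let mOm l : 0 < l -> measurable (Om l). Proof. by move=> l0; exact: open_measurable_rV (oOm l0). Qed.
Let Om_subset l0 l : 0 < l0 -> l0 <= l -> Om l0 `<=` Om l.
Proof. by move=> l00 l0l x [Wx Vx]; split => //; exact: (dilation_subset star l00 l0l). Qed.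
Let uW l (l0 : 0 < l) : Wclosure p (test_function (Om l)) (Om l) (u l) (g l).
Proof. exact: (W1p0_Wclosure p1 (oOm l0) (bOm l0) (u_min l0).1). Qed.

Lemma powR_Ninfty (e : R) : 0 < e -> forall eps : R, 0 < eps -> exists2 t : R, 0 < t &
  forall l, t <= l -> l `^ (- e) <= eps.
Proof.
move=> e0 eps eps0; have eV0 : 0 < eps^-1 by rewrite invr_gt0.
exists (eps^-1 `^ e^-1); first exact: powR_gt0.
move=> l tl; have l0 : 0 < l by apply: lt_le_trans tl; exact: powR_gt0.
rewrite powRN -[leRHS]invrK lef_pV2 ?posrE ?powR_gt0//.
have -> : eps^-1 = (eps^-1 `^ e^-1) `^ e by rewrite -powRrM mulVf ?gt_eqF// powRr1// ltW.
by apply: ler_powR_base => //; [exact: ltW|exact: powR_ge0].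
Qed.

(** The cut-offs are rescalings of a fixed function, with gradients of order 1/l,
    while Omega_l has a measure of order l^r: everything is of order l^(r - s). *)
Lemma energy_vanishes (l0 : R) : 0 < l0 -> forall eps, 0 < eps -> exists2 l1, l0 <= l1 &
  forall l, l1 <= l -> \int[mu]_(x in Om l0) Gpart F (g l x) <= eps /\
   forall theta, 0 <= theta <= 1 ->
     \int[mu]_(x in Om l0) gap (Fsec F) theta (rsubmx (g l x)) (g0 (rsubmx x)) <= eps.
Proof.
move=> l00 eps eps0; have [q [s [K1 [q1 rs s0 K10 decay]]]] := energy_decay.
have [K2 K20 bound] := minimizer_size.
have [K3 K30 meas] := dilation_measure bw ow.
have [chi [tchi chi01 chi0]] := test_function_at0 ow w0.
have [B B0 dchi] := test_function_nabla_bounded tchi.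
have [M M0 wM] := bounded_le bw.
pose c := chi 0 / 2; have c0 : 0 < c by rewrite divr_gt0.
have /nbhs_ballP[d /= d0 dP] : \forall y \near (0 : 'rV[R]_r), `|chi 0 - chi y| <= c.
  have cchi : {for (0 : 'rV[R]_r), continuous chi} by exact: (smooth_continuous tchi.1).
  by move/(@cvgrPdist_le _ _ _ (nbhs (0 : 'rV[R]_r))) : cchi; exact.
have cP y : `|y| < d -> c <= chi y.
  move=> yd; have : `|chi 0 - chi y| <= c.
    apply: dP; split => // i j; rewrite ord1 mxE /ball/= sub0r normrN.
    by apply: le_lt_trans yd; exact: coord_le_norm.
  by rewrite ler_norml => /andP[_]; rewrite /c; lra.
have qB0 : 0 <= q%:R * B :> R by rewrite mulr_ge0.
pose K := K1 * ((q%:R * B) `^ s * (K2 * K3)).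
have K0 : 0 <= K by exact: (mulr_ge0 K10 (mulr_ge0 (powR_ge0 _ _) (mulr_ge0 K20 K30))).
have cq0 : 0 < c ^+ q by rewrite exprn_gt0.
have eps1 : 0 < c ^+ q * eps / (K + 1) by rewrite divr_gt0 ?mulr_gt0// ltr_wpDl.
have sr0 : 0 < s - r%:R by rewrite subr_gt0.
have [t t0 tP] := powR_Ninfty sr0 eps1.
pose l1 := Num.max (Num.max l0 t) (Num.max (q%:R * B + 1) (2 * M * l0 / d)).
exists l1; first by rewrite !le_max lexx.
move=> l; rewrite /l1 !ge_max => /andP[/andP[l0l tl] /andP[qBl Ml]].
have lgt0 : 0 < l by exact: lt_le_trans l0l.
pose alpha (y : 'rV[R]_r) := chi (l^-1 *: y); pose A := q%:R * B / l.
have A01 : 0 <= A <= 1.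
  apply/andP; split; first by rewrite divr_ge0// ltW.
  by rewrite ler_pdivrMr// mul1r; apply: le_trans qBl; rewrite lerDl.
have talpha := test_function_dilation lgt0 tchi.
have dalpha y : q%:R * enorm (nabla alpha y) <= A.
  rewrite (nabla_dilation l y tchi.1) enormZ gtr0_norm ?invr_gt0// mulrCA /A [leRHS]mulrC.
  by apply: ler_wpM2l; [rewrite invr_ge0 ltW|apply: ler_wpM2l].
have alpha01 y : 0 <= alpha y <= 1 := chi01 _.
have [X E] := decay (dil l) alpha A (u l) (odil lgt0) (bdil lgt0) talpha alpha01 A01 dalpha (u_min lgt0).
have A_s : A `^ s * (K2 * (K3 * l ^+ r)) = (q%:R * B) `^ s * (K2 * K3) * l `^ (- (s - r%:R)).
  rewrite /A powRM ?invr_ge0 ?(ltW lgt0)// -powR_inv1 ?(ltW lgt0)// -powRrM mulN1r.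
  rewrite opprB addrC powRD ?(gt_eqF lgt0) ?implybT// powR_mulrn ?(ltW lgt0)//; ring.
have small : K1 * (A `^ s * msize (dil l) (u l)) <= c ^+ q * eps.
  apply: (@le_trans _ _ (K * l `^ (- (s - r%:R)))).
    rewrite /K -[leRHS]mulrA -A_s; apply: (ler_wpM2l K10); apply: ler_wpM2l; first exact: powR_ge0.
    apply: le_trans (bound _ _ (odil lgt0) (bdil lgt0) (u_min lgt0)) _.
    by apply: (ler_wpM2l K20); exact: meas.
  apply: (@le_trans _ _ (K * (c ^+ q * eps / (K + 1)))); first by apply: (ler_wpM2l K0); exact: tP.
  by rewrite mulrA ler_pdivrMr ?ltr_wpDl// mulrC ler_wpM2l ?lerDl// mulr_ge0// ltW.
have mrho : measurable_fun (dil l) (fun y => alpha y ^+ q) := smooth_measurable (smoothX q talpha.1).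
have mrhoD := measurable_from_lsub (V := V) (mdil lgt0) mrho.
have rho01 y : 0 <= alpha y ^+ q <= 1 by have /andP[a0 a1] := alpha01 y; rewrite exprn_ge0// exprn_ile1.
have rhoD (x : 'rV[R]_(r + m)) : Om l x -> `|alpha (lsubmx x) ^+ q| <= 1.
  by move=> _; have /andP[r0 r1] := rho01 (lsubmx x); rewrite ger0_norm.
have local (h : 'rV[R]_(r + m) -> R) : rint (Om l) h -> (forall x, 0 <= h x) ->
    \int[mu]_(x in Om l) (alpha (lsubmx x) ^+ q * h x) <= K1 * (A `^ s * msize (dil l) (u l)) ->
    \int[mu]_(x in Om l0) h x <= eps.
  move=> jh h0 le; have jrh := rint_mulb (mOm lgt0) jh mrhoD rhoD.
  rewrite -(ler_pM2l cq0); apply: le_trans small; apply: le_trans le.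
  have sub := Om_subset l00 l0l.
  have := Rintegral_le_subset (mOm lgt0) (mOm l00) sub jrh.
  move=> h1; apply: (le_trans _ (h1 _)); last first.
    by move=> x _; rewrite mulr_ge0//; have /andP[] := rho01 (lsubmx x).
  have jh0 := integrableS (mOm lgt0) (mOm l00) sub jh.
  rewrite -(RintegralZl _ (mOm l00) jh0).
  apply: (le_Rintegral (mOm l00) (rintZ _ (mOm l00) jh0) (integrableS (mOm lgt0) (mOm l00) sub jrh)) => x [Wx Vx] /=.
  apply: ler_wpM2r => //; rewrite lerXn2r ?nnegrE//; first exact: ltW.
    by have /andP[] := alpha01 (lsubmx x).
  apply: cP; rewrite normrZ gtr0_norm ?invr_gt0// mulrC ltr_pdivrMr//.
  apply: le_lt_trans (dilation_norm_le l00 wM Wx) _; rewrite ler_pdivrMr// in Ml.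
  have := mulr_gt0 M0 l00; rewrite mulrC [d * l]mulrC; lra.
have [_ _ jG _] := cut_off_rint p1 pp' j0 lambda0 Lambda0 F_convex F_lower F_upper oV bV mf jf u0_min
  (odil lgt0) (bdil lgt0) (uW lgt0).
have [_ E0] := weighted_ge0 (odil lgt0) (bdil lgt0) mrho (fun y _ => rho01 y) (uW lgt0).
split; first by apply: (local _ jG) => // x; exact: (Gpart_ge0 lambda0 G_lower k0).
move=> theta th01.
have [jgap _ l2] := gap_le_excess p1 pp' lambda0 Lambda0 sC sL sU oV bV mf jf u0_min (odil lgt0) (bdil lgt0)
  mrho (fun y _ => rho01 y) th01 (uW lgt0).
apply: (local _ jgap) => [x|]; first exact: gap_ge0.
apply: le_trans l2 _; apply: le_trans E; rewrite ler_piMl//.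
by have /andP[] := th01.
Qed.

Lemma tail_small (h : 'rV[R]_m -> R) : mu2.-integrable V (EFin \o h) -> (forall y, 0 <= h y) ->
  forall e, 0 < e -> exists2 M : R, 0 <= M &
  \int[mu2]_(y in V) (h y * \1_(`]M, +oo[%classic) (enorm (g0 y))) <= e.
Proof.
move=> jh h0 e e0; have [_ mg0 _ _] := u0W; have mh := rint_measurable jh.
pose f_ (j : nat) y := h y * \1_(`]j%:R, +oo[%classic) (enorm (g0 y)).
have mf_ j : measurable_fun V (f_ j).
  apply: (measurable_funM mh).
  have mi : measurable_fun [set: R] (\1_(`]j%:R, +oo[%classic) : R -> R).
    by apply: measurable_indic; exact: measurable_itv.
  exact: (measurableT_comp mi (measurable_enorm mg0)).
have c0 : \int[mu2]_(y in V) f_ j y @[j --> \oo] --> \int[mu2]_(y in V) (0 : R).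
  apply: (rint_dominated mV mf_ _ _ jh); first exact: measurable_cst.
    move=> y Vy; apply/cvgrPdist_le => d d0; near=> j.
    rewrite /f_ indicE memNset ?mulr0 ?subrr ?normr0 ?(ltW d0)//= in_itv/= andbT; apply/negP; rewrite -leNgt.
    near: j; exact: nbhs_infty_ger.
  move=> j y _; rewrite normrM (ger0_norm (h0 y)) ler_piMr// indicE.
  by case: (_ \in _); rewrite ?normr1 ?normr0.
rewrite (Rintegral_cst _ mV) mul0r in c0.
have [j _ jP] : \forall j \near \oo, `|0 - \int[mu2]_(y in V) f_ j y| <= e.
  by move/cvgrPdist_le : c0; exact.
exists j%:R => //; have := jP j (leqnn j); rewrite sub0r normrN; exact: le_trans (ler_norm _).
Unshelve. all: by end_near. Qed.

Hypothesis F_strict : forall x y (t : R), x != y -> 0 < t < 1 ->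
  Fsec F (t *: x + (1 - t) *: y) < t * Fsec F x + (1 - t) * Fsec F y.

(** Where |g_0| <= M the gap controls the distance of the gradients up to a small
    constant. Where |g_0| > M it still controls their p-th powers up to those of
    g_0, whose integral there is small. *)
Lemma transverse_gradient_vanishes (l0 : R) : 0 < l0 -> forall eps, 0 < eps -> exists2 l1, l0 <= l1 &
  forall l, l1 <= l -> \int[mu]_(x in Om l0) enorm (rsubmx (g l x) - g0 (rsubmx x)) `^ p <= eps.
Proof.
move=> l00 eps eps0.
have [t t01 [C C1 coer]] := gap_coercive p1 lambda0 Lambda0 sC sL sU.
have gap_gt0 x y : x != y -> 0 < gap (Fsec F) t x y by move=> xy; rewrite /gap subr_gt0 F_strict.
pose T := 2 `^ p : R; have T0 : 0 <= T by exact: powR_ge0.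
have C0 : 0 <= C := le_trans ler01 C1.
have C20 : 0 <= T * (C + 1) := mulr_ge0 T0 (addr_ge0 C0 ler01).
have [mu0 mg0 ju0 _] := u0W; have [iu0 ig0] := rint_wdens mV mu0 mg0 ju0.
have fV : (mu2 V < +oo)%E := bounded_lebesgue_lty mV bV.
have mW0 := mdil l00; have fW0 := bounded_lebesgue_lty mW0 (bdil l00).
pose w := fine (mu1 (dil l0)); have w_ge0 : 0 <= w by apply: fine_ge0.
pose N1 := \int[mu2]_(y in V) (1 : R); have N10 : 0 <= N1 by apply: Rintegral_ge0.
pose h y := enorm (g0 y) `^ p + 1.
have jh : mu2.-integrable V (EFin \o h) := rintD mV ig0 (rint_cst 1 mV fV).
have h0 y : 0 <= h y by rewrite addr_ge0// powR_ge0.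
have e1 : 0 < eps / 3 / (T * (C + 1) * w + 1).
  by rewrite !divr_gt0// ltr_wpDl// mulr_ge0.
have [M M0 tail] := tail_small jh h0 e1.
set Nt := \int[mu2]_(y in V) _ in tail.
have e2 : 0 < eps / 3 / (w * N1 + 1) by rewrite !divr_gt0// ltr_wpDl// mulr_ge0.
have [C' C'0 dist] := gap_distance p1 lambda0 Lambda0 sC sL sU t01 C1 coer gap_gt0 M0 e2.
pose C3 := C' + T * C; have C30 : 0 <= C3 := addr_ge0 C'0 (mulr_ge0 T0 C0).
have e3 : 0 < eps / 3 / (C3 + 1) by rewrite !divr_gt0// ltr_wpDl.
have [l1 l01 vanish] := energy_vanishes l00 e3.
exists l1 => // l l1l; have l0l := le_trans l01 l1l; have lgt0 := lt_le_trans l00 l0l.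
have t01' : 0 <= t <= 1 by case/andP: t01 => /ltW -> /ltW ->.
have [_ /(_ t t01')] := vanish l l1l.
have sub := Om_subset l00 l0l.
have o01 : 0 <= (1 : R) <= 1 by rewrite ler01 lexx.
have m1 : measurable_fun (dil l) (fun _ : 'rV[R]_r => 1 : R) by exact: measurable_cst.
have [jgap' _ _] := gap_le_excess p1 pp' lambda0 Lambda0 sC sL sU oV bV mf jf u0_min (odil lgt0) (bdil lgt0)
  m1 (fun y _ => o01) t01' (uW lgt0).
have jgap := integrableS (mOm lgt0) (mOm l00) sub jgap'.
set Ig := \int[mu]_(x in _) _ => Ig_le.
pose ind y : R := \1_(`]M, +oo[%classic) (enorm (g0 y)).
have mind : measurable_fun V ind.
  have mi : measurable_fun [set: R] (\1_(`]M, +oo[%classic) : R -> R).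
    by apply: measurable_indic; exact: measurable_itv.
  exact: (measurableT_comp mi (measurable_enorm mg0)).
have jt : mu2.-integrable V (EFin \o (fun y => h y * ind y)).
  under eq_fun do rewrite mulrC.
  apply: (rint_mulb (C := 1) mV jh mind) => y _; rewrite /ind indicE.
  by case: (_ \in _); rewrite ?normr1 ?normr0.
have ht0 y : 0 <= h y * ind y by rewrite mulr_ge0// /ind indicE.
have [j1 E1] := rint_from_rsub (r := r) mW0 fW0 mV (fun y _ => ler01) (rint_cst (1 : R) mV fV).
have [jtD Et] := rint_from_rsub (r := r) mW0 fW0 mV (fun y _ => ht0 y) jt.
have {}E1 : \int[mu]_(x in Om l0) from_rsub (fun=> 1 : R) x = w * N1 := E1.
have {}Et : \int[mu]_(x in Om l0) from_rsub (fun y => h y * ind y) x = w * Nt := Et.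
set b := eps / 3 / (w * N1 + 1) in dist e2.
have key xi zeta : enorm (xi - zeta) `^ p <= b * 1 + (C3 * gap (Fsec F) t xi zeta +
    T * (C + 1) * ((enorm zeta `^ p + 1) * \1_(`]M, +oo[%classic) (enorm zeta))).
  have g_ge0 : 0 <= gap (Fsec F) t xi zeta by apply: gap_ge0.
  have z0 : 0 <= enorm zeta `^ p := powR_ge0 _ _.
  rewrite indicE; have [zM|Mz] := leP (enorm zeta) M.
    rewrite memNset/= ?mulr0 ?addr0 ?mulr1; last by rewrite in_itv/= andbT ltNge zM.
    apply: le_trans (dist _ _ zM) _; rewrite lerD2l; apply: ler_wpM2r => //.
    by rewrite lerDl mulr_ge0.
  rewrite mem_set ?mulr1/=; last by rewrite in_itv/= andbT.
  apply: le_trans (enorm_powRB _ _ (ltW p0)) _; apply: ler_wpDl; first exact: ltW.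
  have h1 := coer xi zeta.
  apply: (@le_trans _ _ (T * (C * (gap (Fsec F) t xi zeta + (enorm zeta `^ p + 1)) + (enorm zeta `^ p + 1)))).
    by apply: (ler_wpM2l T0); apply: lerD => //; rewrite lerDl.
  rewrite /C3; move: (gap _ _ _ _) (enorm zeta `^ p) g_ge0 => G Z G0.
  have -> : (C' + T * C) * G + T * (C + 1) * (Z + 1) = T * (C * (G + (Z + 1)) + (Z + 1)) + C' * G by ring.
  by rewrite lerDl mulr_ge0.
have jb := rintZ b (mOm l00) j1; have jg3 := rintZ C3 (mOm l00) jgap.
have jt3 := rintZ (T * (C + 1)) (mOm l00) jtD.
have jR := rintD (mOm l00) jb (rintD (mOm l00) jg3 jt3).
have mgl : measurable_fun (Om l0) (g l) by have [_ mg _ _] := uW lgt0; exact: (measurable_funS (mOm lgt0) sub mg).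
have md : measurable_fun (Om l0) (fun x => rsubmx (g l x) - g0 (rsubmx x)).
  apply: measurable_rVP (mOm l00) _ => j; under eq_fun do rewrite mxE [X in _ + X]mxE.
  apply: measurable_funB; apply: measurable_rV_coord.
    exact: (measurableT_comp (@measurable_rsubmx _ _ _ _) mgl).
  exact: (measurable_from_rsub (W := dil l0) mV mg0).
have jd : rint (Om l0) (fun x => enorm (rsubmx (g l x) - g0 (rsubmx x)) `^ p).
  apply: (rint_le (mOm l00) (measurableT_comp (measurable_powR p) (measurable_enorm md)) jR) => x _.
  by rewrite (ger0_norm (powR_ge0 _ _)); exact: key.
apply: le_trans (le_Rintegral (mOm l00) jd jR (fun x _ => key _ _)) _.
rewrite (RintegralD (mOm l00) jb (rintD (mOm l00) jg3 jt3)) (RintegralD (mOm l00) jg3 jt3).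
rewrite (RintegralZl _ (mOm l00) j1) (RintegralZl _ (mOm l00) jgap) (RintegralZl _ (mOm l00) jtD).
rewrite E1 Et -/Ig.
have third (a c d : R) : 0 <= a -> c <= eps / 3 / (d + 1) -> 0 <= d -> a <= d -> 0 <= eps -> a * c <= eps / 3.
  move=> a0 cle d0 ad _; apply: (@le_trans _ _ (a * (eps / 3 / (d + 1)))); first exact: ler_wpM2l.
  have E0 : 0 <= eps / 3 by rewrite divr_ge0// ltW.
  rewrite mulrA ler_pdivrMr ?ltr_wpDl// mulrC; apply: (ler_wpM2l E0).
  by rewrite ler_wpDr.
have q1 : b * (w * N1) <= eps / 3.
  by rewrite mulrC; apply: third; [exact: mulr_ge0|exact: lexx|exact: mulr_ge0|exact: lexx|exact: ltW].
have q2 : C3 * Ig <= eps / 3 by apply: third Ig_le _ _ _; rewrite ?(ltW eps0).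
have q3 : T * (C + 1) * (w * Nt) <= eps / 3.
  rewrite mulrA; apply: third tail _ _ _; [exact: mulr_ge0|exact: mulr_ge0|exact: lexx|exact: ltW].
rewrite [leRHS](_ : eps = eps / 3 + (eps / 3 + eps / 3)); last by field.
by apply: lerD q1 _; exact: lerD.
Qed.

Let H (x : 'rV[R]_(r + m)) : 'rV[R]_(r + m) := row_mx 0 (from_rsub g0 x).

Let dW l0 l : 0 < l0 -> l0 <= l ->
  Wclosure p (@smooth R (r + m)) (Om l0) (fun x => u l x - U x) (fun x => g l x - H x).
Proof.
move=> l00 l0l; have lgt0 := lt_le_trans l00 l0l.
have lsm : lateral V `<=` @smooth R (r + m) by move=> ? [].
exact: (Wclosure_subset p1 (mOm lgt0) (bOm lgt0) lsm (mOm l00) (Om_subset l00 l0l) lsm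
  (difference_lateral p1 j0 oV bV u0_min (odil lgt0) (bdil lgt0) (uW lgt0))).
Qed.

(** G controls the gradient in x', the gap the difference of the gradients in x'',
    and Poincare's inequality then the difference of the functions. *)
Lemma distance_vanishes (l0 : R) : 0 < l0 -> forall eps, 0 < eps -> exists2 l1, l0 <= l1 &
  forall l, l1 <= l -> \int[mu]_(x in Om l0) `|u l x - U x| `^ p +
    \int[mu]_(x in Om l0) enorm (g l x - H x) `^ p <= eps.
Proof.
move=> l00 eps eps0.
have [P P0 poinc] := poincare (r := r) p1 j0 oV bV.
pose T := 2 `^ p : R; have T0 : 0 <= T by exact: powR_ge0.
have PT0 : 0 <= P + T by exact: addr_ge0.
have e1 : 0 < eps / 2 / (P + T + 1) by rewrite !divr_gt0// ltr_wpDl.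
have e2 : 0 < lambda * (eps / 2 / (T + 1)) by rewrite mulr_gt0// !divr_gt0// ltr_wpDl.
have [l1 l01 Qle] := transverse_gradient_vanishes l00 e1.
have [l2 l02 Gle] := energy_vanishes l00 e2.
exists (Num.max l1 l2); first by rewrite le_max l01.
move=> l; rewrite ge_max => /andP[l1l l2l]; have l0l := le_trans l01 l1l; have lgt0 := lt_le_trans l00 l0l.
have [G0 _] := Gle l l2l; have {}Qle := Qle l l1l.
have sub := Om_subset l00 l0l; have mD := mOm l00.
have [mw mh jwh _] := dW l00 l0l; have [jw jh] := rint_wdens mD mw mh jwh.
set Q := \int[mu]_(x in _) _ in Qle.
have rE x : rsubmx (g l x - H x) = rsubmx (g l x) - g0 (rsubmx x).
  rewrite -[g0 _](@row_mxKr _ 1 r m 0 (from_rsub g0 x)).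
  by apply/rowP => j; rewrite !mxE.
have lE x : lsubmx (g l x - H x) = lsubmx (g l x).
  by apply/rowP => j; rewrite [LHS]mxE [LHS]mxE [X in _ + X]mxE row_mxEl mxE subr0 [RHS]mxE.
have s1 : \int[mu]_(x in Om l0) `|u l x - U x| `^ p <= P * Q.
  pose a : 'rV[R]_r -> R := \1_(dil l0).
  have ma : measurable_fun (dil l) a by apply: measurable_indic; exact: mdil.
  have a01 y : dil l y -> 0 <= a y <= 1.
    by move=> _; rewrite /a indicE; case: (_ \in _); rewrite ?lexx ?ler01.
  have dl := difference_lateral p1 j0 oV bV u0_min (odil lgt0) (bdil lgt0) (uW lgt0).
  have aE (h : 'rV[R]_(r + m) -> R) :
      \int[mu]_(x in Om l) (a (lsubmx x) * h x) = \int[mu]_(x in Om l0) h x.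
    rewrite [RHS](Rintegral_restrict h sub); apply: eq_Rintegral => x /set_mem[Wx Vx].
    rewrite /patch /a indicE; have [Wx0|Wx0] := pselect (dil l0 (lsubmx x)).
      by rewrite !mem_set// mul1r.
    by rewrite !memNset ?mul0r// => -[].
  have E : \int[mu]_(x in Om l0) enorm (rsubmx (g l x - H x)) `^ p = Q.
    by apply: eq_Rintegral => x _; rewrite rE.
  have le := poinc _ _ _ _ _ (mdil lgt0) (bdil lgt0) ma a01 dl.
  rewrite (aE (fun x => `|u l x - U x| `^ p)) (aE (fun x => enorm (rsubmx (g l x - H x)) `^ p)) in le.
  by rewrite -E; exact: le.
have jQ : rint (Om l0) (fun x => enorm (rsubmx (g l x) - g0 (rsubmx x)) `^ p).
  have := rint_enorm_rsubmx p1 mD mh jh; by under eq_fun do rewrite rE.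
have [_ _ jG' _] := cut_off_rint p1 pp' j0 lambda0 Lambda0 F_convex F_lower F_upper oV bV mf jf u0_min
  (odil lgt0) (bdil lgt0) (uW lgt0).
have jG := integrableS (mOm lgt0) mD sub jG'.
have s2 : \int[mu]_(x in Om l0) enorm (g l x - H x) `^ p <=
    T * (lambda^-1 * \int[mu]_(x in Om l0) Gpart F (g l x) + Q).
  rewrite -(RintegralZl _ mD jG) -(RintegralD mD (rintZ lambda^-1 mD jG) jQ).
  rewrite -(RintegralZl _ mD (rintD mD (rintZ lambda^-1 mD jG) jQ)).
  apply: (le_Rintegral mD jh (rintZ T mD (rintD mD (rintZ lambda^-1 mD jG) jQ))) => x _ /=.
  apply: (@le_trans _ _ ((enorm (lsubmx (g l x - H x)) + enorm (rsubmx (g l x - H x))) `^ p)).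
    by apply: ler_powR_base; [exact: ltW|exact: enorm_ge0|exact: enorm_le_lrsub].
  apply: le_trans (powRD_le (ltW p0) (enorm_ge0 _) (enorm_ge0 _)) _.
  rewrite lE rE; apply: (ler_wpM2l T0); rewrite lerD2r mulrC ler_pdivlMr// mulrC.
  apply: le_trans (G_lower (g l x)); apply: ler_wpM2l; first exact: ltW.
  by rewrite /Gbound lerDl !mulr_ge0 ?powR_ge0.
set G := \int[mu]_(x in _) _ in G0 s2.
have Q0 : 0 <= Q by apply: Rintegral_ge0 => x _; exact: powR_ge0.
have t1 : (P + T) * Q <= eps / 2.
  rewrite ler_pdivlMr ?ltr_wpDl// in Qle; apply: le_trans Qle; rewrite mulrC.
  by apply: (ler_wpM2l Q0); rewrite lerDl.
have t2 : T * (lambda^-1 * G) <= eps / 2.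
  have G1 : lambda^-1 * G <= eps / 2 / (T + 1) by rewrite ler_pdivrMl.
  apply: le_trans (ler_wpM2l T0 G1) _; rewrite mulrA ler_pdivrMr ?ltr_wpDl// mulrC.
  by apply: ler_wpM2l; rewrite ?lerDl// divr_ge0// ltW.
apply: le_trans (lerD s1 s2) _; rewrite mulrDr addrCA -mulrDl [leRHS]splitr.
exact: lerD.
Qed.

Lemma strong_convergence (l0 : R) : 0 < l0 -> W1p_strong_cvg p (Om l0) +oo u U.
Proof.
move=> l00; have oD := oOm l00; have bD := bOm l00; have mD := mOm l00.
have sm : @smooth R (r + m) `<=` @smooth R (r + m) by [].
split.
- exists l0; split; first exact: num_real.
  move=> l /ltW l0l; have lgt0 := lt_le_trans l00 l0l.
  exact: (Wclosure_W1p p1 oD bD (@tsm _ _) (Wclosure_subset p1 (mOm lgt0) (bOm lgt0) (@tsm _ _) mD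
    (Om_subset l00 l0l) (fun x => id) (uW lgt0))).1.
- have lsm : [set (@from_rsub R r m _ psi) | psi in test_function V] `<=` @smooth R (r + m).
    by move=> _ [psi tpsi <-]; exact: (smooth_from_rsub j0 tpsi.1).
  exact: (Wclosure_W1p p1 oD bD lsm (UW p1 j0 oV bV u0_min (odil l00) (bdil l00))).1.
pose a l := \int[mu]_(x in Om l0) `|u l x - U x| `^ p.
pose b l := \int[mu]_(x in Om l0) enorm (g l x - H x) `^ p.
have a0 l : 0 <= a l by apply: Rintegral_ge0 => x _; exact: powR_ge0.
have b0 l : 0 <= b l by apply: Rintegral_ge0 => x _; exact: powR_ge0.
have ab : (fun l => a l + b l) @ +oo --> (0 : R).
  apply/cvgrPdist_le => e e0; have [l1 l01 le] := distance_vanishes l00 e0.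
  exists l1; split; first exact: num_real.
  by move=> l /ltW l1l; rewrite sub0r normrN ger0_norm ?addr_ge0//; exact: le.
have /(cvg_Wnorm0 p1 a0 b0) := ab; apply: cvg_trans; apply: near_eq_cvg.
exists l0; split; first exact: num_real.
by move=> l /ltW l0l; rewrite (Wclosure_W1p p1 oD bD sm (dW l00 l0l)).2.
Qed.
End uniform_estimates.

(** * Weak and strong limits *)

Section weak_limits.
Context {R : realType} {n : nat}.
Local Notation mu := (@lebesgue_rV R n).
Local Notation rint D f := (mu.-integrable D (EFin \o f)).
Variable p : R.
Hypothesis p1 : 1 < p.
Implicit Types (D : set 'rV[R]_n) (u v w : 'rV[R]_n -> R).

Let p0 : 0 < p. Proof. exact: lt_trans p1. Qed.

Lemma W1pB D u v : open D -> bounded_set D -> W1p p D u -> W1p p D v -> W1p p D (fun x => u x - v x).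
Proof.
move=> oD bD uW vW; have mD := open_measurable_rV oD.
have [gu mu_ mgu ju] := W1p_rint p1 oD bD uW; have [gv mv mgv jv] := W1p_rint p1 oD bD vW.
exact: (wdens_W1p p1 oD bD (weak_gradientB mD gu gv) (measurable_funB mu_ mv)
  (rV_measurableB mD mgu mgv) (rint_wdensB p1 mD mu_ mv mgu mgv ju jv)).1.
Qed.

(** Over a bounded set the L^1 norm is bounded by the L^p norm N: integrate
    |w| <= t + t^(1-p) |w|^p, with t = N. *)
Lemma Rintegral_norm_le D w : measurable D -> bounded_set D -> measurable_fun D w ->
  rint D (fun x => `|w x| `^ p) -> rint D w /\
  \int[mu]_(x in D) `|w x| <= (fine (mu D) + 1) * (\int[mu]_(x in D) `|w x| `^ p) `^ p^-1.
Proof.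
move=> mD bD mw jw; have fD := bounded_lebesgue_lty mD bD.
have jt t : rint D (fun x => t + t `^ (1 - p) * `|w x| `^ p).
  exact: (rintD mD (rint_cst t mD fD) (rintZ _ mD jw)).
have w1 : rint D w.
  by apply: (rint_le mD mw (jt 1)) => x _; exact: le_small_powR (ltW p1) (normr_ge0 _) ltr01.
split => //; have d0 : 0 <= fine (mu D) by apply: fine_ge0.
set I := \int[mu]_(x in D) `|w x| `^ p; have I0 : 0 <= I by apply: Rintegral_ge0 => x _; exact: powR_ge0.
have le t : 0 < t -> \int[mu]_(x in D) `|w x| <= t * fine (mu D) + t `^ (1 - p) * I.
  move=> t0; rewrite -(RintegralZl _ mD jw) -(Rintegral_cst mu mD t).
  rewrite -(RintegralD mD (rint_cst t mD fD) (rintZ _ mD jw)).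
  apply: (le_Rintegral mD (rint_abs mD w1) (jt t)) => x _.
  exact: le_small_powR (ltW p1) (normr_ge0 _) t0.
have [I_eq0|In0] := eqVneq I 0.
  rewrite I_eq0 powR0 ?invr_eq0 ?gt_eqF// mulr0; apply/ler_addgt0Pr => e e0; rewrite add0r.
  have t0 : 0 < e / (fine (mu D) + 1) by rewrite divr_gt0// ltr_wpDl.
  apply: le_trans (le _ t0) _; rewrite I_eq0 mulr0 addr0 mulrAC ler_pdivrMr ?ltr_wpDl//.
  by rewrite ler_wpM2l ?lerDl// ltW.
have {}I0 : 0 < I by rewrite lt0r In0.
have N0 : 0 < I `^ p^-1 by exact: powR_gt0.
apply: le_trans (le _ N0) _; rewrite -powRrM mulrBr mulr1 mulVf ?gt_eqF//.
rewrite -{3}[I]powRr1 ?(ltW I0)// -powRD ?(gt_eqF I0) ?implybT// subrK.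
by rewrite mulrDl mul1r mulrC.
Qed.

Lemma W1p_norm1_le D w : open D -> bounded_set D -> W1p p D w ->
  rint D w /\ ((\int[mu]_(x in D) `|w x|)%:E <= (fine (mu D) + 1)%:E * Wnorm p D w)%E.
Proof.
move=> oD bD wW; have mD := open_measurable_rV oD.
have [gw mw mgw jwg] := W1p_rint p1 oD bD wW.
have [jw jg] := rint_wdens mD mw mgw jwg.
have [w1 le] := Rintegral_norm_le mD bD mw jw; split => //.
have [_ ->] := wdens_W1p p1 oD bD gw mw mgw jwg.
rewrite -EFinM lee_fin; apply: le_trans le _; apply: ler_wpM2l.
  by rewrite addr_ge0// fine_ge0.
by rewrite lerDl powR_ge0.
Qed.

(** The functional w |-> int_D w sgn (u - v) detects the difference of two limits. *)
Lemma weak_strong_unique D (v_ : nat -> 'rV[R]_n -> R) u v : open D -> bounded_set D ->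
  W1p_weak_cvg p D \oo v_ u -> W1p_strong_cvg p D \oo v_ v -> ae_eq mu D u v.
Proof.
move=> oD bD [vW uW weak] [_ v0W strong]; have mD := open_measurable_rV oD.
have [_ mu_ _ _] := W1p_rint p1 oD bD uW; have [_ mv _ _] := W1p_rint p1 oD bD v0W.
pose sg (t : R) : R := 2 * \1_(`[0, +oo[%classic) t - 1.
have sgE t : t * sg t = `|t|.
  rewrite /sg indicE; have [t0|t0] := leP 0 t.
    by rewrite mem_set/= ?in_itv/= ?t0// ger0_norm//; ring.
  by rewrite memNset/= ?in_itv/= ?andbT ?leNgt ?t0// ltr0_norm//; ring.
have sg1 t : `|sg t| <= 1.
  rewrite /sg indicE; case: (_ \in _) => /=; last by rewrite mulr0 sub0r normrN normr1.
  by rewrite (_ : 2 * 1 - 1 = 1) ?normr1//; ring.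
have msg : measurable_fun [set: R] sg.
  apply: measurable_funB; last exact: measurable_cst.
  apply: measurable_funM; first exact: measurable_cst.
  by apply: measurable_indic; exact: measurable_itv.
have md : measurable_fun D (fun x => u x - v x) by exact: measurable_funB.
have ms : measurable_fun D (fun x => sg (u x - v x)) := measurableT_comp msg md.
pose L (w : 'rV[R]_n -> R) := \int[mu]_(x in D) (sg (u x - v x) * w x).
have jL w : W1p p D w -> rint D (fun x => sg (u x - v x) * w x).
  by move=> /(W1p_norm1_le oD bD)[jw _]; apply: (rint_mulb mD jw ms) => x _; exact: sg1.
have L_le w : W1p p D w -> ((`|L w|)%:E <= (fine (mu D) + 1)%:E * Wnorm p D w)%E.
  move=> wW; have [jw le] := W1p_norm1_le oD bD wW; apply: le_trans le; rewrite lee_fin.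
  apply: le_trans (le_normr_Rintegral mD (jL _ wW)) _.
  apply: (le_Rintegral mD (rint_abs mD (jL _ wW)) (rint_abs mD jw)) => x _.
  by rewrite normrM ler_piMl// sg1.
have L_lin a w1 w2 : W1p p D w1 -> W1p p D w2 -> L (fun x => a * w1 x + w2 x) = a * L w1 + L w2.
  move=> W1 W2; rewrite /L -(RintegralZl _ mD (jL _ W1)) -(RintegralD mD (rintZ a mD (jL _ W1)) (jL _ W2)).
  by apply: eq_Rintegral => x _; ring.
have dualL : W1p_dual p D L.
  by split; [exact: L_lin|exists (fine (mu D) + 1)].
have LB w1 w2 : W1p p D w1 -> W1p p D w2 -> L (fun x => w1 x - w2 x) = L w1 - L w2.
  move=> W1 W2; rewrite addrC -mulN1r -L_lin//; congr L; apply/funext => x; ring.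
have c1 := weak L dualL.
have c2 : L (v_ j) @[j --> \oo] --> L v.
  apply/cvgrPdist_le => e e0.
  have d1 : 0 < fine (mu D) + 1 by rewrite ltr_wpDl// fine_ge0.
  have ed : 0 < e / (fine (mu D) + 1) by rewrite divr_gt0.
  move/fine_cvgP : strong => -[fin /cvgrPdist_le /(_ _ ed) small].
  near=> j.
  have Wj : W1p p D (v_ j) by near: j.
  have Fj : Wnorm p D (fun x => v_ j x - v x) \is a fin_num by near: j.
  have Sj : `|0 - (fine \o (fun j => Wnorm p D (fun x => v_ j x - v x))) j| <= e / (fine (mu D) + 1).
    by near: j.
  rewrite distrC -LB// -lee_fin; apply: le_trans (L_le _ (W1pB oD bD Wj v0W)) _.
  rewrite -(fineK Fj) -EFinM lee_fin mulrC -ler_pdivlMr//; apply: le_trans Sj.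
  by rewrite /= sub0r normrN ler_norm.
have LE : L u = L v by exact: (cvg_unique _ c1 c2).
have zero : \int[mu]_(x in D) `|u x - v x| = 0.
  transitivity (L (fun x => u x - v x)); last by rewrite LB// LE subrr.
  by apply: eq_Rintegral => x _; rewrite mulrC sgE.
have [jd _] := W1p_norm1_le oD bD (W1pB oD bD uW v0W).
have /(ae_eq_integral_abs mu mD) : measurable_fun D (EFin \o (fun x => u x - v x)) by exact/measurable_EFinP.
case=> [h _]; have {}h := h ltac:(by rewrite -[LHS]/(\int[mu]_(x in D) (`|u x - v x|)%:E)%E -(EFin_Rintegral mD (rint_abs mD jd)) zero).
by apply: filterS h => x /= h Dx; apply/eqP; rewrite -subr_eq0; apply/eqP; have [] := h Dx.
Unshelve. all: by end_near. Qed.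

End weak_limits.

(** * The asymptotic behaviour of the minimizers *)

Section growing_cylinders.
Context {R : realType} {r m : nat}.

Lemma Omega_oo_cover (w' : set 'rV[R]_r) (V : set 'rV[R]_m) : open w' -> w' 0 ->
  Omega_oo V `<=` \bigcup_j Omega w' V j.+1%:R.
Proof.
move=> ow w0 x [_ Vx].
have /nbhs_ballP[e /= e0 eW] : nbhs (0 : 'rV[R]_r) w' by exact: open_nbhs_nbhs.
pose j := Num.truncn (`|lsubmx x| / e); exists j => //; split => //.
rewrite dilationE//=; apply: eW; split => // i l; rewrite ord1 mxE /ball/= sub0r normrN.
apply: le_lt_trans (coord_le_norm _ _) _; rewrite normrZ gtr0_norm ?invr_gt0//.
rewrite mulrC ltr_pdivrMr// mulrC -ltr_pdivrMr//; exact: truncnS_gt.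
Qed.

Lemma ae_eq_bigcup n (D : nat -> set 'rV[R]_n) (E : set 'rV[R]_n) (u v : 'rV[R]_n -> R) :
  E `<=` \bigcup_j D j -> (forall j, ae_eq (lebesgue_rV n) (D j) u v) -> ae_eq (lebesgue_rV n) E u v.
Proof.
move=> ED /ae_foralln; apply: filterS => x /= h /ED[j _ Dx]; exact: h Dx.
Qed.

Lemma convex_functionE n (F : 'rV[R]_n -> R) : convex_function setT F ->
  forall x y (t : R), 0 <= t <= 1 -> F (t *: x + (1 - t) *: y) <= t * F x + (1 - t) * F y.
Proof.
move=> cF x y t /andP[t0 t1]; have := cF (Itv01 t0 t1) x y; rewrite !inE => /(_ I I).
by rewrite convRE.
Qed.

End growing_cylinders.

Theorem theorem4p4 (R : realType) (r m : nat) (hr : (0 < r)%N) (hm : (0 < m)%N)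
  (p p' k : R) (hp : 1 < p) (hp' : p^-1 + p'^-1 = 1) (hk : 0 <= k < p)
  (w' : set 'rV[R]_r) (w'_open : open w') (w'_bounded : bounded_set w')
  (w'_0 : w' 0) (w'_star : starshaped0 w') (w'_gauge : lipschitz (gauge w'))
  (w'' : set 'rV[R]_m) (w''_open : open w'') (w''_bounded : bounded_set w'')
  (F : 'rV[R]_(r + m) -> R) (F_convex : convex_function setT F)
  (lambda Lambda : R) (hlambda : 0 < lambda) (hLambda : lambda <= Lambda)
  (F_bounds : forall xi,
     lambda * enorm xi `^ p <= F xi <= Lambda * (enorm xi `^ p + 1))
  (G_bounds : forall xi,
     lambda * Gbound p k xi <= Gpart F xi <= Lambda * Gbound p k xi)
  (F''_uniform : 0 < k -> exists2 beta : R, 0 < beta &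
     forall (xi zeta : 'rV[R]_m) (theta mu : R),
       0 <= theta <= 1 -> 0 <= mu <= 1 -> theta + mu = 1 ->
       Fsec F (theta *: xi + mu *: zeta) <=
       theta * Fsec F xi + mu * Fsec F zeta
       - k * beta * theta * mu * (theta `^ (p - 1) + mu `^ (p - 1))
         * enorm (xi - zeta) `^ p)
  (f'' : 'rV[R]_m -> R) (hf'' : Lp p' w'' f'')
  (r_small_0 : k = 0 -> r%:R < p)
  (r_small_k : 0 < k -> r%:R < k * p / (p - k))
  (F''_strict : strictly_convex (Fsec F))
  (u_oo : 'rV[R]_m -> R) (hu_oo : is_minimizer p w'' (Fsec F) f'' u_oo)
  (u : R -> 'rV[R]_(r + m) -> R)
  (hu : forall l : R, 0 < l ->
     is_minimizer p (Omega w' w'' l) F (from_rsub f'') (u l)) :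
  (forall (l : nat -> R) (u_star : 'rV[R]_(r + m) -> R),
     (forall j, 0 < l j) -> l j @[j --> \oo] --> +oo ->
     W1p_loc p (Omega_oo w'') u_star -> zero_trace p (Omega_oo w'') u_star ->
     (forall l0 : R, 0 < l0 ->
        W1p_weak_cvg p (Omega w' w'' l0) \oo (fun j => u (l j)) u_star) ->
     ae_eq (lebesgue_rV (r + m)) (Omega_oo w'') u_star (from_rsub u_oo)) /\
  (forall l0 : R, 0 < l0 ->
     W1p_strong_cvg p (Omega w' w'' l0) +oo u (from_rsub u_oo)).
Proof.
have Lambda0 : 0 < Lambda := lt_le_trans hlambda hLambda.
have cF := convex_functionE F_convex.
have F_lower xi : lambda * enorm xi `^ p <= F xi by have /andP[] := F_bounds xi.
have F_upper xi : F xi <= Lambda * (enorm xi `^ p + 1) by have /andP[] := F_bounds xi.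
have G_lower xi : lambda * Gbound p k xi <= Gpart F xi by have /andP[] := G_bounds xi.
have G_upper xi : Gpart F xi <= Lambda * Gbound p k xi by have /andP[] := G_bounds xi.
have uniform : 0 < k -> exists2 c : R, 0 < c & forall x y : 'rV[R]_m,
    c * enorm (x - y) `^ p <= gap (Fsec F) (2^-1) x y.
  move=> k0; have [beta beta0 unif] := F''_uniform k0.
  have h0 : 0 < 2^-1 `^ (p - 1) :> R by rewrite powR_gt0// invr_gt0.
  exists (k * beta * 2^-1 * 2^-1 * (2^-1 `^ (p - 1) + 2^-1 `^ (p - 1))).
    by rewrite !mulr_gt0 ?invr_gt0 ?addr_gt0.
  move=> x y; have E : (1 - 2^-1 : R) = 2^-1 by field.
  have h01 : 0 <= (2^-1 : R) <= 1 by rewrite invr_ge0 ler0n/= invf_le1// ler1n.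
  have := unif x y 2^-1 2^-1 h01 h01 ltac:(by field).
  by rewrite /gap E; move: (_ * enorm _ `^ p) (Fsec F (_ + _)) (2^-1 * _) (2^-1 * _) => a b c d; lra.
have p'1 : 1 < p' := conjugate_gt1 hp hp'.
have m'' := open_measurable_rV w''_open.
have [mf jf] := (LpP p'1 f'' m'').1 hf''.
have strict x y (t : R) : x != y -> 0 < t < 1 ->
    Fsec F (t *: x + (1 - t) *: y) < t * Fsec F x + (1 - t) * Fsec F y by exact: F''_strict.
have strong l0 (l00 : 0 < l0) : W1p_strong_cvg p (Omega w' w'' l0) +oo u (from_rsub u_oo).
  exact: (strong_convergence hp hp' hk (Ordinal hr) (Ordinal hm) hlambda Lambda0 cF F_lower F_upper
    G_lower G_upper r_small_0 r_small_k uniform w''_open w''_bounded mf jf hu_oo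
    w'_open w'_bounded w'_0 w'_star hu strict l00).
split; last exact: strong.
move=> l u_star l_gt0 l_oo _ _ weak.
apply: ae_eq_bigcup (Omega_oo_cover w'_open w'_0) _ => j.
have j0 : 0 < j.+1%:R :> R by [].
have oD : open (Omega w' w'' j.+1%:R) := open_cylinder (open_dilation j0 w'_open) w''_open.
have bD : bounded_set (Omega w' w'' j.+1%:R) := bounded_cylinder (bounded_dilation j0 w'_bounded) w''_bounded.
apply: (weak_strong_unique hp oD bD (weak _ j0)).
have [s1 s2 s3] := strong _ j0; split => //; first exact: (l_oo _ s1).
exact: (@cvg_comp _ _ _ l _ _ _ _ l_oo s3).
Qed.
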